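(* Let $r\ge1$ be an integer and $\alpha_1,\ldots,\alpha_r\in[0,1)$. The residue of the multiple Hurwitz zeta function $\zeta_r(s_1,\ldots,s_r;\alpha_1,\ldots,\alpha_r)$ along the hyperplane $H_{1,0}$ is the restriction of $\zeta_{r-1}(s_2,\ldots,s_r;\alpha_2,\ldots,\alpha_r)$ to $H_{1,0}$. Its residue along the hyperplane $H_{i,k}$, where $2\le i\le r$ and $k\ge0$, is the restriction to $H_{i,k}$ of the product of $\zeta_{r-i}(s_{i+1},\ldots,s_r;\alpha_{i+1},\ldots,\alpha_r)$ with the $(0,k)$-th entry of the matrix $$\prod_{d=1}^{i-1}\mathbf{B}(\alpha_{d+1}-\alpha_d;\,s_1+\cdots+s_d-d)$$ (the factors being multiplied in the order $d=1,2,\ldots,i-1$ from left to right).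
   Context: For $r \ge 1$ let $U_r := \{(s_1,\ldots,s_r)\in\mathbb{C}^r \mid \Re(s_1+\cdots+s_i) > i \text{ for all } 1\le i\le r\}$. For $(s_1,\ldots,s_r)\in U_r$ the multiple Hurwitz zeta function of depth $r$ is $$\zeta_r(s_1,\ldots,s_r;\alpha_1,\ldots,\alpha_r) := \sum_{n_1>\cdots>n_r>0}\frac{1}{(n_1+\alpha_1)^{s_1}\cdots(n_r+\alpha_r)^{s_r}}$$ (the $n_i$ integers), and the same symbol denotes its meromorphic continuation to $\mathbb{C}^r$. The depth-zero function is $\zeta_0:=1$. For integers $1\le i\le r$ and $k\ge 0$, $H_{i,k} := \{(s_1,\ldots,s_r)\in\mathbb{C}^r \mid s_1+\cdots+s_i=i-k\}$. The function $\zeta_r(s_1,\ldots,s_r;\alpha_1,\ldots,\alpha_r)$ has at most simple poles along $H_{1,0}$ and along the $H_{i,k}$ with $2\le i\le r$, $k\ge0$, and no other poles; its residue along $H_{i,k}$ is by definition the restriction to $H_{i,k}$ of the meromorphic function $(s_1+\cdots+s_i-i+k)\,\zeta_r(s_1,\ldots,s_r;\alpha_1,\ldots,\alpha_r)$. For $a\in\mathbb{R}$ and an indeterminate $t$, $\mathbf{B}(a;t)$ is the infinite upper triangular matrix with rows and columns indexed by $\{0,1,2,\ldots\}$ whose $(n,m)$ entry is $0$ if $m<n$, is $\frac{1}{t+n}$ if $m=n$, and is $$\frac{(t+n+1)(t+n+2)\cdots(t+m-1)}{(m-n)!}\,B_{m-n}(a)$$ if $m>n$ (an empty product being $1$). Here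 $B_n(t)$ is the $n$-th Bernoulli polynomial, $\frac{xe^{tx}}{e^x-1}=\sum_{n\ge0}B_n(t)\frac{x^n}{n!}$. Products of upper triangular matrices involve only finite sums. *)

(* Defs.v *)
From HB Require Import structures.
From mathcomp Require Import all_boot all_order all_algebra.
From mathcomp Require Import finmap.
From mathcomp Require Import all_classical all_reals all_analysis.
From mathcomp Require Import complex.
From mathcomp.analysis.showcase Require summability.

Set Implicit Arguments.
Unset Strict Implicit.
Unset Printing Implicit Defensive.

Import Order.TTheory GRing.Theory Num.Theory numFieldNormedType.Exports.

Local Open Scope classical_set_scope.
Local Open Scope ring_scope.
Local Open Scope complex_scope.

(* R[i] seen only as a numClosedFieldType, so that it carries the topology and
   the normed space structure over itself (and not over R). *)
Definition cplx (R : realType) : numClosedFieldType := R[i].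

Section ComplexPower.
Variable R : realType.
Implicit Types (x : R) (z : cplx R).

Definition cexp z : cplx R :=
  (expR (complex.Re z))%:C * (cos (complex.Im z) +i* sin (complex.Im z)).

(* Used only for x > 0. *)
Definition cpow x z : cplx R := cexp (z * (ln x)%:C).

End ComplexPower.

Section Bernoulli.
Variable R : realType.

(* [bernoulli a n] is B_n(a): [bernoulli a] is the only coefficient sequence
   whose exponential generating series sums to x e^(a x) / (e^x - 1) for all
   small x != 0. *)
Definition bernoulli (a : R) : nat -> R :=
  get [set b : nat -> R | \forall x \near 0^',
    series (fun n => b n * x ^+ n / n`!%:R) n @[n --> \oo] -->
    x * expR (a * x) / (expR x - 1)].

End Bernoulli.

Section TriangularMatrices.
Variable R : realType.
Local Notation umx := (nat -> nat -> cplx R).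

Definition umx1 : umx := fun n m => (n == m)%:R.

(* For upper triangular A and B, only n <= l <= m contributes to the entry
   (n, m) of the product. *)
Definition umx_mul (A B : umx) : umx :=
  fun n m => \sum_(n <= l < m.+1) A n l * B l m.

Definition bmx (a : R) (t : cplx R) : umx := fun n m =>
  if (m < n)%N then 0
  else if m == n then (t + n%:R)^-1
  else (\prod_(n.+1 <= j < m) (t + j%:R)) / (m - n)`!%:R
       * (bernoulli a (m - n))%:C.

End TriangularMatrices.

Section Hyperplanes.
Variables (R : realType) (r : nat).
Implicit Types (s p : 'rV[cplx R]_r) (i k : nat).

(* s_1 + ... + s_i; the column indices of s start at 0. *)
Definition psum i s : cplx R := \sum_(j < r | (j < i)%N) s 0 j.

Definition hyp i k : set 'rV[cplx R]_r := [set s | psum i s = i%:R - k%:R].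

Definition hform i k s : cplx R := psum i s - i%:R + k%:R.

Definition polar i k : bool :=
  [&& i == 1, k == 0 & 1 <= r]%N || (2 <= i <= r)%N.

Definition polar_locus : set 'rV[cplx R]_r :=
  [set s | exists i k, polar i k /\ hyp i k s].

(* This set is open and dense in H_{i,k}: equality at its points is equality
   of meromorphic functions on H_{i,k}. *)
Definition hyp_generic i k : set 'rV[cplx R]_r :=
  [set p | hyp i k p /\
    forall i' k', polar i' k' -> (i', k') <> (i, k) -> ~ hyp i' k' p].

Definition holomorphic_near p (g : 'rV[cplx R]_r -> cplx R) : Prop :=
  \forall s \near p, differentiable g s.

(* A function on C^r with singularities in the polar locus is represented by a
   total function whose values on the polar locus are irrelevant. *)
Definition simple_poles_on_polar_locus (F : 'rV[cplx R]_r -> cplx R) : Prop :=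
  forall p, exists (I : seq (nat * nat)) (g : 'rV[cplx R]_r -> cplx R),
    [/\ uniq I, all (fun h => polar h.1 h.2) I, holomorphic_near p g
      & \forall s \near p, ~ polar_locus s ->
          g s = (\prod_(h <- I) hform h.1 h.2 s) * F s].

(* The meromorphic function represented by G is holomorphic at p, with value
   v there; p may lie on the polar locus. *)
Definition mero_value (G : 'rV[cplx R]_r -> cplx R) p (v : cplx R) : Prop :=
  exists g : 'rV[cplx R]_r -> cplx R,
    [/\ holomorphic_near p g,
        \forall s \near p, ~ polar_locus s -> g s = G s
      & g p = v].

End Hyperplanes.

Section Zeta.
Variable R : realType.

Definition Udom r : set 'rV[cplx R]_r :=
  [set s | forall i, (1 <= i <= r)%N -> i%:R < complex.Re (psum i s)].

(* Indices n_1 > ... > n_r > 0. *)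
Definition dtuple r := {n : r.-tuple nat | sorted gtn n && all (ltn 0) n}.

Definition zeta_term r (alpha : r.-tuple R) (s : 'rV[cplx R]_r)
    (n : dtuple r) : cplx R :=
  \prod_(j < r) (cpow ((tnth (val n) j)%:R + tnth alpha j) (s 0 j))^-1.

(* [summability.sum] is the limit over finite sets of indices: on Udom the
   series converges absolutely, and this is its sum. *)
Definition zeta_series r (alpha : r.-tuple R) (s : 'rV[cplx R]_r) : cplx R :=
  summability.sum (zeta_term alpha s).

Definition is_zeta_continuation r (alpha : r.-tuple R)
    (F : 'rV[cplx R]_r -> cplx R) : Prop :=
  (forall s, Udom s -> F s = zeta_series alpha s) /\
  simple_poles_on_polar_locus F.

(* The complement of the polar locus is connected and contains Udom, so the
   values off the polar locus are uniquely determined. *)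
Definition zeta r (alpha : r.-tuple R) : 'rV[cplx R]_r -> cplx R :=
  get [set F : 'rV[cplx R]_r -> cplx R | is_zeta_continuation alpha F].

Lemma zeta_series0 (alpha : 0.-tuple R) (s : 'rV[cplx R]_0) :
  zeta_series alpha s = 1.
Proof.
rewrite /zeta_series /summability.sum.
pose e : dtuple 0 := exist _ [tuple] isT.
have H1 (n : dtuple 0) : n = e by apply/val_inj/tuple0.
have FF := @summability.totally_filter (dtuple 0).
apply: cvg_lim; first exact: norm_hausdorff.
apply: cvg_near_cst.
exists (fset1 e) => //= A eA.
have -> : A = fset1 e.
  apply/fsetP => n; rewrite (H1 n) in_fset1 eqxx.
  by apply: (fsubsetP eA); rewrite in_fset1.
rewrite /summability.partial_sum.
have He : e \in fset1 e by rewrite in_fset1.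
rewrite (bigD1 (FSetSub He))//= big1 ?addr0.
  by rewrite /zeta_term big_ord0.
by move=> i; rewrite -val_eqE /= => /negP[]; apply/eqP/H1.
Qed.

(* Depth zero: the only index is the empty tuple, with the empty product. *)
Lemma zeta0 (alpha : 0.-tuple R) (s : 'rV[cplx R]_0) :
  zeta alpha s = 1.
Proof.
have ex : exists F : 'rV[cplx R]_0 -> cplx R, is_zeta_continuation alpha F.
  exists (cst 1); split => [t _|p]; first by rewrite zeta_series0.
  exists [::], (cst 1); split => //.
    by near=> t; exact: differentiable_cst.
  by near=> t => _; rewrite big_nil mul1r.
have [zetaU _] : is_zeta_continuation alpha (zeta alpha) by exact: getPex ex.
by rewrite zetaU ?zeta_series0 // => -[].
Unshelve. all: by end_near.
Qed.

(* The residue of zeta alpha along H_{i,k} has value v at p. *)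
Definition zeta_residue_at r (alpha : r.-tuple R) (i k : nat)
    (p : 'rV[cplx R]_r) (v : cplx R) : Prop :=
  mero_value (fun s => hform i k s * zeta alpha s) p v.

Lemma tail_ord_subproof r i (j : 'I_(r - i)) : (i + j < r)%N.
Proof. by rewrite -ltn_subRL. Qed.

Definition tail_ord r i (j : 'I_(r - i)) : 'I_r :=
  Ordinal (tail_ord_subproof j).

(* (s_1, ..., s_r) |-> (s_{i+1}, ..., s_r). *)
Definition tail r i (s : 'rV[cplx R]_r) : 'rV[cplx R]_(r - i) :=
  colsub (@tail_ord r i) s.

(* The product over d = 1, ..., i-1 of
   B(alpha_{d+1} - alpha_d; s_1 + ... + s_d - d), from left to right;
   alpha`_d is alpha_{d+1}. *)
Definition bmx_prod r (alpha : r.-tuple R) (s : 'rV[cplx R]_r) (i : nat) :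
    nat -> nat -> cplx R :=
  \big[@umx_mul R/@umx1 R]_(1 <= d < i)
    bmx (alpha`_d - alpha`_d.-1) (psum d s - d%:R).

End Zeta.

(* Main.v *)
(* Put w = s_1 - 1 and a = alpha_2 - alpha_1.  By the defining identity of the
   Bernoulli polynomials,
     w (n + alpha_1)^(-s_1) = Phi (n - 1) - Phi n - O(n^(-Re w - K - 2)),
     Phi n = sum_(k <= K) (w)_k B_k(a) / k! (n + alpha_2)^(-w - k),
   where (w)_k = w (w + 1) ... (w + k - 1).  Summation by parts in the outermost
   sum then gives
     w zeta_r(s) = sum_(k <= K) (w)_k B_k(a) / k! zeta_(r-1)(m_k s) - Rem_K(s),
     m_k s = (s_1 + s_2 - 1 + k, s_3, ..., s_r),
   with parameters alpha_2, ..., alpha_r on the right and Rem_K holomorphic on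
   the domain Re (s_1 + ... + s_i) > i - K - 1 for all i.  By induction on r this
   is the continuation; the formulas for different K agree by the identity
   theorem.  It also yields the residues: m_l maps H_{i,k} to H_{i-1,k-l},
   (w)_l B_l(a) / l! divided by w is the entry (0, l) of B(a; w), and B(a; t + l)
   is B(a; t) with rows and columns shifted by l. *)

Require Import Defs.
From HB Require Import structures.
From mathcomp Require Import all_boot all_order all_algebra.
From mathcomp Require Import finmap.
From mathcomp Require Import all_classical all_reals all_analysis.
From mathcomp Require Import complex.
From mathcomp Require Import ring lra.
From mathcomp.analysis.showcase Require summability.
Import Order.TTheory GRing.Theory Num.Theory numFieldNormedType.Exports.
Local Open Scope classical_set_scope.
Local Open Scope ring_scope.
Local Open Scope complex_scope.
Set Implicit Arguments.
Unset Strict Implicit.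
Unset Printing Implicit Defensive.

(** * Cauchy's theorem and its consequences *)

(** Holomorphy means Frechet differentiability over [cplx R] near a point. Two theorems about it are
    needed: Weierstrass' theorem, because series and remainders are limits of finite nested sums,
    and the identity theorem, because the formulas for different [K] live on different domains. Both
    come from one inequality, [circle_bound]: the modulus at the centre is at most any bound on a
    circle. It follows from Goursat's theorem for rectangles in logarithmic coordinates, with real
    primitives along the sides in place of contour integrals. Convergence depends on the partial
    sums s_1 + ... + s_i while single exponents may have negative real part, so nested sums are
    estimated by moving surplus decay from outer to inner indices ([weighted_msum]). The complement
    of infinitely many hyperplanes has to be crossed; each of its points is joined to the domain of
    convergence by a segment that avoids them all. The induction for the residues passes through
    H_(1,k) with k >= 1, where there is no pole; the value 0 found there is an off-diagonal entry of
    the identity matrix, the empty product. *)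

Section RealRectangle.
Variable R : realType.

Lemma mvt_closed (F f : R -> R) (a b : R) : a <= b ->
  (forall x, a <= x <= b -> is_derive x 1 F (f x)) ->
  exists2 c, a <= c <= b & F b - F a = f c * (b - a).
Proof.
move=> ab dF.
have [||c] := @MVT_segment R F f a b ab.
- by move=> x; rewrite in_itv/= => /andP[ax xb]; apply: dF; rewrite !ltW.
- apply: derivable_within_continuous => x; rewrite in_itv/= => xab.
  by case: (dF x xab).
- by rewrite in_itv/= => cab ->; exists c.
Qed.

Lemma primitive_exists (f : R -> R) (a : R) : continuous f ->
  exists F : R -> R, forall x, a < x -> is_derive x 1 F (f x).
Proof.
move=> cf; exists (fun x => (\int[lebesgue_measure]_(t in `[a, x]) f t)%R).
move=> x ax.
have [] := @continuous_FTC1 R f (BLeft a) x (x + 1) _ _ _ (cf x).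
- by rewrite ltrDl.
- apply: continuous_compact_integrable; first exact: segment_compact.
  exact: continuous_subspaceT.
- exact: ax.
- by move=> dF F'; apply: DeriveDef; [exact: dF|rewrite -derive1E; exact: F'].
Qed.

Lemma dist_le_length (x l y z : R) :
  x <= y <= x + l -> x <= z <= x + l -> `|z - y| <= l.
Proof. by rewrite ler_norml; lra. Qed.

Lemma half_step (a b x x' l : R) : 0 < l -> a <= x -> x + l *+ 2 <= b ->
  x' = x \/ x' = x + l -> [/\ a <= x', x' + l <= b, x <= x' & x' + l <= x + l *+ 2].
Proof. by rewrite !mulr2n => ? ? ? [->|->]; split; lra. Qed.

Section Rectangle.
Variables (u v V H : R -> R -> R) (a b c d : R).
Hypotheses (ab : a < b) (cd : c < d).
Let inbox (x y : R) := (a <= x <= b) && (c <= y <= d).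
Hypothesis dV : forall x y, inbox x y -> is_derive y 1 (V x) (u x y).
Hypothesis dH : forall x y, inbox x y -> is_derive x 1 (H^~ y) (v x y).
(** The common [p] is the Cauchy-Riemann equation du/dx = dv/dy, which makes [v dx + u dy] closed.
    Only pointwise differentiability is asked for, as in Goursat's theorem. *)
Hypothesis duv : forall x y, inbox x y -> exists p q q' : R,
  forall e, 0 < e -> exists2 r, 0 < r & forall x' y', inbox x' y' ->
    `|x' - x| <= r -> `|y' - y| <= r ->
    `|u x' y' - u x y - p * (x' - x) - q * (y' - y)|
       <= e * (`|x' - x| + `|y' - y|) /\
    `|v x' y' - v x y - q' * (x' - x) - p * (y' - y)|
       <= e * (`|x' - x| + `|y' - y|).

(* [V] and [H] are primitives of [u] and [v] along vertical and horizontal sides,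
   so this is the integral of [v dx + u dy] around the rectangle. *)
Definition circ x l y m := V (x + l) (y + m) - V (x + l) y - V x (y + m) + V x y
  - (H (x + l) (y + m) - H x (y + m) - H (x + l) y + H x y).

Lemma circ_split x l y m :
  circ x (l *+ 2) y (m *+ 2) =
  circ x l y m + circ (x + l) l y m + circ x l (y + m) m + circ (x + l) l (y + m) m.
Proof. rewrite /circ !mulr2n !addrA; ring. Qed.

(** By the mean value theorem the vertical sides contribute about [p * l * m] and the horizontal
    ones the same with the opposite sign. The terms in [q] and [q'] cancel because the two points
    compared share their ordinate, respectively their abscissa. Four values are replaced by their
    linear approximations, hence [e / 4]. *)
Lemma circ_small x0 y0 : inbox x0 y0 -> forall e, 0 < e -> exists2 r, 0 < r &
  forall x l y m, 0 <= l <= r -> 0 <= m <= r -> x <= x0 <= x + l ->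
   y <= y0 <= y + m -> inbox x y -> inbox (x + l) (y + m) ->
   `|circ x l y m| <= e * (l + m) ^+ 2.
Proof.
move=> in0 e e0; have [p [q [q' duv0]]] := duv in0.
have e4 : 0 < e / 4 by rewrite divr_gt0.
have [r r0 duvr] := duv0 _ e4; exists r => // x l y m.
move=> /andP[l0 lr] /andP[m0 mr] xx0 yy0 inxy inxyl.
have [/andP[/andP[ax _] /andP[cy _]] /andP[/andP[_ xb] /andP[_ yd]]] := conj inxy inxyl.
have inx z : x <= z <= x + l -> a <= z <= b.
  by move=> /andP[xz zx]; rewrite (le_trans ax xz) (le_trans zx xb).
have iny z : y <= z <= y + m -> c <= z <= d.
  by move=> /andP[yz zy]; rewrite (le_trans cy yz) (le_trans zy yd).
have nearx z : x <= z <= x + l -> `|z - x0| <= l by apply: dist_le_length.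
have neary z : y <= z <= y + m -> `|z - y0| <= m by apply: dist_le_length.
have inb z t : x <= z <= x + l -> y <= t <= y + m -> inbox z t.
  by move=> zx ty; rewrite /inbox inx// iny.
have xl : x <= x <= x + l by rewrite lexx lerDl.
have xl' : x <= x + l <= x + l by rewrite lexx lerDl l0.
have ym : y <= y <= y + m by rewrite lexx lerDl.
have ym' : y <= y + m <= y + m by rewrite lexx lerDl m0.
have duvb z t : x <= z <= x + l -> y <= t <= y + m ->
    `|u z t - u x0 y0 - p * (z - x0) - q * (t - y0)| <= e / 4 * (l + m) /\
    `|v z t - v x0 y0 - q' * (z - x0) - p * (t - y0)| <= e / 4 * (l + m).
  move=> zx ty; have nz := nearx z zx; have nt := neary t ty.
  have [h1 h2] := duvr z t (inb _ _ zx ty) (le_trans nz lr) (le_trans nt mr).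
  by split; [apply: le_trans h1 _|apply: le_trans h2 _]; rewrite ler_pM2l// lerD.
have [c1 hc1 Vc1] : exists2 c1, y <= c1 <= y + m &
    V (x + l) (y + m) - V x (y + m) - (V (x + l) y - V x y) =
    (u (x + l) c1 - u x c1) * (y + m - y).
  apply: (@mvt_closed (fun z => V (x + l) z - V x z)
    (fun z => u (x + l) z - u x z)); first by rewrite lerDl.
  by move=> z yz; apply: is_deriveB; apply: dV; apply: inb.
have [c2 hc2 Hc2] : exists2 c2, x <= c2 <= x + l &
    H (x + l) (y + m) - H (x + l) y - (H x (y + m) - H x y) =
    (v c2 (y + m) - v c2 y) * (x + l - x).
  apply: (@mvt_closed (fun z => H z (y + m) - H z y)
    (fun z => v z (y + m) - v z y)); first by rewrite lerDl.
  move=> z xz; apply: (@is_deriveB _ _ _ (H^~ (y + m)) (H^~ y));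
  by apply: dH; apply: inb.
have -> : circ x l y m = (u (x + l) c1 - u x c1 - p * l) * m
   - (v c2 (y + m) - v c2 y - p * m) * l.
  transitivity ((u (x + l) c1 - u x c1) * (y + m - y) -
    (v c2 (y + m) - v c2 y) * (x + l - x)); last by ring.
  by rewrite -Vc1 -Hc2 /circ; ring.
have [A1 _] := duvb _ _ xl' hc1; have [A2 _] := duvb _ _ xl hc1.
have [_ A3] := duvb _ _ hc2 ym'; have [_ A4] := duvb _ _ hc2 ym.
have T1 : `|u (x + l) c1 - u x c1 - p * l| <= e / 4 * (l + m) *+ 2.
  have -> : u (x + l) c1 - u x c1 - p * l =
    (u (x + l) c1 - u x0 y0 - p * (x + l - x0) - q * (c1 - y0)) -
    (u x c1 - u x0 y0 - p * (x - x0) - q * (c1 - y0)) by ring.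
  by apply: le_trans (ler_normB _ _) _; rewrite mulr2n lerD.
have T2 : `|v c2 (y + m) - v c2 y - p * m| <= e / 4 * (l + m) *+ 2.
  have -> : v c2 (y + m) - v c2 y - p * m =
    (v c2 (y + m) - v x0 y0 - q' * (c2 - x0) - p * (y + m - y0)) -
    (v c2 y - v x0 y0 - q' * (c2 - x0) - p * (y - y0)) by ring.
  by apply: le_trans (ler_normB _ _) _; rewrite mulr2n lerD.
have -> : e * (l + m) ^+ 2 =
    e / 4 * (l + m) *+ 2 * (l + m) + e / 4 * (l + m) *+ 2 * (l + m).
  by rewrite !mulr2n; field.
have lm0 : 0 <= e / 4 * (l + m) by rewrite mulr_ge0 ?addr_ge0// ltW.
apply: le_trans (ler_normB _ _) _.
rewrite !normrM (ger0_norm l0) (ger0_norm m0).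
have K0 : 0 <= e / 4 * (l + m) *+ 2 by rewrite mulrn_wge0.
apply: lerD.
  apply: le_trans (ler_wpM2r m0 T1) _.
  by rewrite ler_wpM2l// lerDr.
apply: le_trans (ler_wpM2r l0 T2) _.
by rewrite ler_wpM2l// lerDl.
Qed.

Let L n := (b - a) / 2 ^+ n.
Let M n := (d - c) / 2 ^+ n.
Let LS n : L n = L n.+1 *+ 2.
Proof. by rewrite /L exprS; field. Qed.
Let MS n : M n = M n.+1 *+ 2.
Proof. by rewrite /M exprS; field. Qed.
Let L0 n : 0 < L n.
Proof. by rewrite divr_gt0 ?subr_gt0// exprn_gt0. Qed.
Let M0 n : 0 < M n.
Proof. by rewrite divr_gt0 ?subr_gt0// exprn_gt0. Qed.

(** Goursat's bisection: some quarter keeps at least a quarter of the modulus. The chosen rectangles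
    shrink to a point, where [circ_small] bounds [circ] by an arbitrarily small multiple of the
    squared size, and that square also drops by 4 at each step. *)
Lemma circ_eq0 : circ a (b - a) c (d - c) = 0.
Proof.
apply/eqP/negPn/negP => Qn0.
set eta := `|circ a (b - a) c (d - c)|.
have eta0 : 0 < eta by rewrite normr_gt0.
pose P n (p : R * R) := [/\ a <= p.1, p.1 + L n <= b, c <= p.2, p.2 + M n <= d
   & eta / 4 ^+ n <= `|circ p.1 (L n) p.2 (M n)|].
pose sub n (p q : R * R) := [/\ p.1 <= q.1, q.1 + L n.+1 <= p.1 + L n,
   p.2 <= q.2 & q.2 + M n.+1 <= p.2 + M n].
have step n p : exists q, P n p -> P n.+1 q /\ sub n p q.
  case: (pselect (P n p)) => [|nP]; last by exists p.
  case=> p1a p1b p2c p2d Hp.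
  have : exists q : R * R, [/\ q.1 = p.1 \/ q.1 = p.1 + L n.+1,
      q.2 = p.2 \/ q.2 = p.2 + M n.+1
     & eta / 4 ^+ n.+1 <= `|circ q.1 (L n.+1) q.2 (M n.+1)|].
    apply: contrapT => nq.
    have small x y : x = p.1 \/ x = p.1 + L n.+1 -> y = p.2 \/ y = p.2 + M n.+1 ->
       `|circ x (L n.+1) y (M n.+1)| < eta / 4 ^+ n.+1.
      move=> hx hy; rewrite ltNge; apply/negP => h.
      by apply: nq; exists (x, y).
    move: Hp; rewrite LS MS circ_split.
    have s1 := small _ _ (or_introl erefl) (or_introl erefl).
    have s2 := small _ _ (or_intror erefl) (or_introl erefl).
    have s3 := small _ _ (or_introl erefl) (or_intror erefl).
    have s4 := small _ _ (or_intror erefl) (or_intror erefl).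
    have -> : eta / 4 ^+ n = eta / 4 ^+ n.+1 * 4.
      by rewrite exprS; field; rewrite expf_neq0.
    rewrite leNgt => /negP; apply.
    apply: le_lt_trans (ler_normD _ _) _.
    apply: le_lt_trans (lerD (ler_normD _ _) (lexx _)) _.
    apply: le_lt_trans (lerD (lerD (ler_normD _ _) (lexx _)) (lexx _)) _.
    lra.
  case=> q [hq1 hq2 Hq]; exists q => _.
  have [|h1 h2 h3 h4] := @half_step _ b _ _ _ (L0 n.+1) p1a _ hq1; first by rewrite -LS; exact: p1b.
  have [|k1 k2 k3 k4] := @half_step _ d _ _ _ (M0 n.+1) p2c _ hq2; first by rewrite -MS; exact: p2d.
  by split; split=> //; rewrite (LS n, MS n).
have [f Hf] := choice (fun np : nat * (R * R) => step np.1 np.2).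
pose s := fix s n := if n is m.+1 then f (m, s m) else (a, c).
have Ps n : P n (s n).
  elim: n => [|n IH]; last by have [] := Hf (n, s n) IH.
  by rewrite /P /= /L /M expr0 !divr1; split => //; lra.
have Ss n : sub n (s n) (s n.+1) by have [] := Hf (n, s n) (Ps n).
have mono n k : [/\ (s n).1 <= (s (n + k)%N).1,
    (s (n + k)%N).1 + L (n + k)%N <= (s n).1 + L n, (s n).2 <= (s (n + k)%N).2
    & (s (n + k)%N).2 + M (n + k)%N <= (s n).2 + M n].
  elim: k => [|k [i1 i2 i3 i4]]; first by rewrite addn0.
  rewrite addnS; have [j1 j2 j3 j4] := Ss (n + k)%N; split.
  - exact: le_trans j1.
  - exact: le_trans i2.
  - exact: le_trans j3.
  - exact: le_trans i4.
have bd n m : [/\ (s n).1 <= (s m).1 + L m & (s n).2 <= (s m).2 + M m].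
  case: (leqP n m) => nm.
    have [i1 _ i3 _] := mono n (m - n)%N; move: i1 i3.
    by rewrite subnKC// => i1 i3; rewrite ler_wpDr ?ler_wpDr// ltW.
  have [_ i2 _ i4] := mono m (n - m)%N; move: i2 i4; rewrite subnKC ?(ltnW nm)//.
  by move=> i2 i4; split; [apply: le_trans i2|apply: le_trans i4]; rewrite lerDl ltW.
(* The suprema of the lower left corners are the coordinates of the point common to all
   rectangles. *)
pose X := range (fun n => (s n).1); pose Y := range (fun n => (s n).2).
have Xub m : ubound X ((s m).1 + L m) by move=> _ [n _ <-]; have [] := bd n m.
have Yub m : ubound Y ((s m).2 + M m) by move=> _ [n _ <-]; have [] := bd n m.
have X0 : X !=set0 by exists (s 0).1; exists 0%N.
have Y0 : Y !=set0 by exists (s 0).2; exists 0%N.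
have x0P n : (s n).1 <= sup X <= (s n).1 + L n.
  apply/andP; split; last exact: ge_sup.
  by apply: ub_le_sup; [exists ((s 0).1 + L 0); exact: Xub | exists n].
have y0P n : (s n).2 <= sup Y <= (s n).2 + M n.
  apply/andP; split; last exact: ge_sup.
  by apply: ub_le_sup; [exists ((s 0).2 + M 0); exact: Yub | exists n].
have in0 : inbox (sup X) (sup Y).
  have /andP[x1 x2] := x0P 0%N; have /andP[y1 y2] := y0P 0%N.
  have [p1 p2 p3 p4 _] := Ps 0%N.
  by rewrite /inbox (le_trans p1 x1) (le_trans x2 p2) (le_trans p3 y1) (le_trans y2 p4).
have D0 : 0 < (b - a) + (d - c) by rewrite addr_gt0 ?subr_gt0.
(* Since [L n + M n] is [((b - a) + (d - c)) / 2 ^+ n], this value turns the bound of [circ_small]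
   into half of [eta / 4 ^+ n]. *)
have e0 : 0 < eta / (((b - a) + (d - c)) ^+ 2 * 2).
  by rewrite divr_gt0// mulr_gt0// exprn_gt0.
have [r r0 Hr] := circ_small in0 e0.
have [n nr] : exists n, L n <= r /\ M n <= r.
  pose n := Num.bound (((b - a) + (d - c)) / r); exists n.
  have : ((b - a) + (d - c)) / r < 2 ^+ n.
    apply: lt_le_trans (archi_boundP _) _; first by rewrite divr_ge0; lra.
    by rewrite -natrX ler_nat ltnW// ltn_expl.
  have p0 : 0 < 2 ^+ n :> R by rewrite exprn_gt0.
  rewrite ltr_pdivrMr// => /ltW h; rewrite /L /M !ler_pdivrMr// ![r * _]mulrC.
  by split; apply: le_trans h; rewrite ?lerDl ?lerDr subr_ge0 ltW.
case: nr => Lr Mr; have [i1 i2 i3 i4] := Ps n.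
apply/negP; rewrite -ltNge.
have Ln0 := L0 n; have Mn0 := M0 n.
apply: le_lt_trans (Hr _ _ _ _ _ _ (x0P n) (y0P n) _ _) _.
- by rewrite Lr ltW.
- by rewrite Mr ltW.
- by rewrite /inbox i1 i3 (le_trans _ i2) ?(le_trans _ i4)// lerDl ltW.
- by rewrite /inbox i2 i4 (le_trans i1) ?(le_trans i3)// lerDl ltW.
have -> : eta / ((b - a + (d - c)) ^+ 2 * 2) * (L n + M n) ^+ 2 = eta / 4 ^+ n / 2.
  have -> : 4 ^+ n = (2 ^+ n) ^+ 2 :> R.
    by rewrite -exprM mulnC exprM expr2; congr (_ ^+ _); rewrite -natrM.
  by rewrite /L /M; field; rewrite expf_neq0// lt0r_neq0.
have : 0 < eta / 4 ^+ n by rewrite divr_gt0// exprn_gt0.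
by move=> h; rewrite ltr_pdivrMr// mulr_natr mulr2n ltrDl.
Qed.

End Rectangle.
End RealRectangle.

(** * Real-valued modulus and sum norm *)

Section ComplexModulus.
Variable R : realType.
Local Notation C := (cplx R).
Implicit Types (x y : R) (z w : C).

(** The norm of [cplx R] takes its values in [cplx R]; estimates are made with this modulus, which
    lies in [R]. *)
Definition cabs z : R := Normc.normc z.
Arguments cabs : simpl never.

Lemma normE z : `|z| = (cabs z)%:C.
Proof. by rewrite normc_def /cabs; case: z. Qed.

Lemma cabs_ge0 z : 0 <= cabs z.
Proof. by case: z => a b; apply: sqrtr_ge0. Qed.

Lemma cabs0 : cabs 0 = 0.
Proof. exact: Normc.normc0. Qed.

Lemma cabs1 : cabs 1 = 1.
Proof. exact: Normc.normc1. Qed.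

Lemma cabs0_eq0 z : cabs z = 0 -> z = 0.
Proof. exact: Normc.eq0_normc. Qed.

Lemma cabs_gt0 z : z != 0 -> 0 < cabs z.
Proof.
by move=> z0; rewrite lt_def cabs_ge0 andbT; apply: contra z0 => /eqP/cabs0_eq0->.
Qed.

Lemma cabsM z w : cabs (z * w) = cabs z * cabs w.
Proof. exact: Normc.normcM. Qed.

Lemma cabsV z : cabs z^-1 = (cabs z)^-1.
Proof. exact: Normc.normcV. Qed.

Lemma cabsN z : cabs (- z) = cabs z.
Proof. exact: normcN. Qed.

Lemma cabsD z w : cabs (z + w) <= cabs z + cabs w.
Proof. exact: le_normcD. Qed.

Lemma cabsB z w : cabs (z - w) <= cabs z + cabs w.
Proof. by rewrite -(cabsN w) cabsD. Qed.

Lemma cabs_distC z w : cabs (z - w) = cabs (w - z).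
Proof. by rewrite -cabsN opprB. Qed.

Lemma cabs_real x : cabs x%:C = `|x|.
Proof. by rewrite /cabs /= expr0n addr0 sqrtr_sqr. Qed.

Lemma cabs_nat n : cabs n%:R = n%:R.
Proof.
have -> : n%:R = (n%:R : R)%:C :> C by rewrite rmorph_nat.
by rewrite cabs_real normr_nat.
Qed.

Lemma cabs_prod (I : Type) (s : seq I) (P : pred I) (F : I -> C) :
  cabs (\prod_(i <- s | P i) F i) = \prod_(i <- s | P i) cabs (F i).
Proof. by apply: (big_morph cabs cabsM cabs1). Qed.

Lemma cabs_sum (I : Type) (s : seq I) (P : pred I) (F : I -> C) :
  cabs (\sum_(i <- s | P i) F i) <= \sum_(i <- s | P i) cabs (F i).
Proof.
apply: (big_ind2 (fun a b => cabs a <= b)) => //; first by rewrite cabs0.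
by move=> a b c d ab cd; apply: le_trans (cabsD _ _) _; apply: lerD.
Qed.

Lemma ReD z w : complex.Re (z + w) = complex.Re z + complex.Re w.
Proof. by case: z; case: w. Qed.
Lemma ImD z w : complex.Im (z + w) = complex.Im z + complex.Im w.
Proof. by case: z; case: w. Qed.
Lemma ReN z : complex.Re (- z) = - complex.Re z.
Proof. by case: z. Qed.
Lemma ImN z : complex.Im (- z) = - complex.Im z.
Proof. by case: z. Qed.
Lemma ReM z w : complex.Re (z * w) =
  complex.Re z * complex.Re w - complex.Im z * complex.Im w.
Proof. by case: z; case: w. Qed.
Lemma ImM z w : complex.Im (z * w) =
  complex.Re z * complex.Im w + complex.Im z * complex.Re w.
Proof. by case: z => a b; case: w => c d /=; rewrite [b * c]mulrC. Qed.

Lemma Re_nat n : complex.Re (n%:R : C) = n%:R.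
Proof.
by have -> : n%:R = (n%:R : R)%:C :> C by rewrite rmorph_nat.
Qed.

Lemma Im_nat n : complex.Im (n%:R : C) = 0.
Proof.
by have -> : n%:R = (n%:R : R)%:C :> C by rewrite rmorph_nat.
Qed.

Lemma Re_le_cabs z : `|complex.Re z| <= cabs z.
Proof.
case: z => a b; rewrite /cabs /= -sqrtr_sqr ler_sqrt ?addr_ge0 ?sqr_ge0//.
by rewrite lerDl sqr_ge0.
Qed.

Lemma Im_le_cabs z : `|complex.Im z| <= cabs z.
Proof.
case: z => a b; rewrite /cabs /= -sqrtr_sqr ler_sqrt ?addr_ge0 ?sqr_ge0//.
by rewrite lerDr sqr_ge0.
Qed.

Lemma cabs_le_ReIm z : cabs z <= `|complex.Re z| + `|complex.Im z|.
Proof.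
have -> : z = (complex.Re z)%:C + 'i * (complex.Im z)%:C by exact: complexE.
apply: le_trans (cabsD _ _) _; rewrite ReD ImD cabsM !cabs_real /=.
by rewrite /cabs /= expr0n expr1n add0r sqrtr1 !(mul0r,mul1r,subr0,addr0,add0r).
Qed.

Lemma ltC_real (x : R) : (0 < x%:C :> C) = (0 < x).
Proof. by rewrite ltcR. Qed.

Lemma gt0_complexE (e : C) : 0 < e -> exists2 x : R, 0 < x & e = x%:C.
Proof.
case: e => a b; rewrite ltcE /= => /andP[/eqP-> a0]; by exists a.
Qed.

Lemma cabs_dist_lt z0 z (e : R) : `|z0 - z| < e%:C :> C = (cabs (z - z0) < e).
Proof. by rewrite normE cabs_distC ltcR. Qed.

Lemma near_cplx z0 (P : set C) :
  (\forall z \near z0, P z) <->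
  exists2 r : R, 0 < r & forall z, cabs (z - z0) < r -> P z.
Proof.
split=> [/nbhs_ballP[e /= /gt0_complexE[r r0 ->] H]|[r r0 H]].
  by exists r => // z zr; apply: H; rewrite -ball_normE /ball_/= cabs_dist_lt.
apply/nbhs_ballP; exists r%:C => /=; first by rewrite ltC_real.
by move=> z; rewrite -ball_normE /ball_/= cabs_dist_lt; exact: H.
Qed.

(** The sum norm, equivalent to the maximum norm of the topology, bounds every coordinate and every
    partial sum [psum] with constant 1. *)
Definition vabs m (v : 'rV[C]_m) : R := \sum_j cabs (v 0 j).

Lemma vabs_ge0 m (v : 'rV[C]_m) : 0 <= vabs v.
Proof. by apply: sumr_ge0 => j _; apply: cabs_ge0. Qed.

Lemma vabs0 m : vabs (0 : 'rV[C]_m) = 0.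
Proof. by apply: big1 => j _; rewrite mxE cabs0. Qed.

Lemma vabsD m (v w : 'rV[C]_m) : vabs (v + w) <= vabs v + vabs w.
Proof.
by rewrite -big_split; apply: ler_sum => j _; rewrite mxE cabsD.
Qed.

Lemma vabsZ m (a : C) (v : 'rV[C]_m) : vabs (a *: v) = cabs a * vabs v.
Proof. by rewrite mulr_sumr; apply: eq_bigr => j _; rewrite mxE cabsM. Qed.

Lemma cabs_le_vabs m (v : 'rV[C]_m) j : cabs (v 0 j) <= vabs v.
Proof.
rewrite /vabs (bigD1 j)//= lerDl; apply: sumr_ge0 => i _; exact: cabs_ge0.
Qed.

Lemma near_rV m (p : 'rV[C]_m) (P : set 'rV[C]_m) :
  (\forall s \near p, P s) <->
  exists2 r : R, 0 < r & forall h, vabs h < r -> P (p + h).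
Proof.
split=> [/nbhs_ballP[e /= /gt0_complexE[r r0 ->] H]|[r r0 H]].
  exists r => // h hr; apply: H; split; first by rewrite ltC_real.
  move=> i j; rewrite !ord1 -ball_normE /ball_/= cabs_dist_lt mxE (addrC (p _ _)) addrK.
  by apply: le_lt_trans hr; apply: cabs_le_vabs.
(* Division by [m.+1] covers [m = 0] and keeps the sum of [m] coordinates strictly below [r]. *)
have r'0 : 0 < r / m.+1%:R by rewrite divr_gt0.
apply/nbhs_ballP; exists (r / m.+1%:R)%:C => /=; first by rewrite ltC_real.
move=> s [_ ps]; have -> : s = p + (s - p) by rewrite addrC subrK.
apply: H; apply: (@le_lt_trans _ _ (\sum_(j < m) r / m.+1%:R)).
  apply: ler_sum => j _; have := ps 0 j.
  by rewrite -ball_normE /ball_/= cabs_dist_lt !mxE => /ltW.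
rewrite sumr_const card_ord -[_ *+ m]mulr_natr mulrAC ltr_pdivrMr//.
by rewrite ltr_pM2l// ltr_nat.
Qed.

Lemma rV_norm_le m (v : 'rV[C]_m) : `|v| <= (vabs v)%:C.
Proof.
have h0 : 0 <= (vabs v)%:C :> C by rewrite lecR vabs_ge0.
rewrite -[(`|v|)]/(mx_norm v) mx_normE.
rewrite -[leRHS]/((NngNum h0)%:num) num_le; apply/bigmax_leP; split=> //.
by move=> [i j] _ /=; rewrite -num_le /= ord1 normE lecR cabs_le_vabs.
Qed.

Lemma rV_norm_ge m (v : 'rV[C]_m) : (vabs v)%:C <= m%:R * `|v|.
Proof.
rewrite /vabs rmorph_sum /= mulr_natl -[X in _ *+ X]card_ord -sumr_const.
apply: ler_sum => j _; rewrite -normE -[(`|v|)]/(mx_norm v) mx_normE.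
have K (ij : 'I_1 * 'I_m) : `|v ij.1 ij.2| <=
    (\big[Num.max/0%:nng]_i `|v i.1 i.2|%:nng)%:num.
  by rewrite -[leLHS]nngE num_le; exact: le_bigmax.
exact: (K (0, j)).
Qed.

End ComplexModulus.
Arguments cabs : simpl never.

(** * Differentiability through an explicit linear part *)

Section DifferentiableGeneral.
Variables (K : numFieldType) (V W : normedModType K).

(** ['d f x] is a chosen linear map; once some continuous linear map has the right remainder, the
    choice has the defining property. *)
Lemma differentiable_of_linear (f : V -> W) (df : {linear V -> W}) x :
  continuous df ->
  (forall e, 0 < e -> \forall h \near 0, `|f (x + h) - f x - df h| <= e * `|h|) ->
  differentiable f x.
Proof.
move=> cdf H; apply/diffP => /=.
apply: (@getPex _ (fun (df : {linear V -> W}) => continuous df /\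
  forall y, f y = f (lim (nbhs x)) + df (y - lim (nbhs x))
                  +o_(y \near x) (y - lim (nbhs x)))).
exists df; split=> // ; rewrite lim_id //.
have : f = (fun y => f x + df (y - x)) +o_x (center x).
  apply/eqaddoP => e e0.
  have nx : \forall y \near x, `|f y - f x - df (y - x)| <= e * `|y - x|.
    rewrite (near_shift 0) subr0; apply: filterS (H e e0) => h /=.
    by rewrite addrK (addrC h).
  by apply: filterS nx => y; rewrite !fctE opprD addrA.
move=> H1 y.
by rewrite {1}H1; congr (_ + _).
Qed.

Lemma near_eq_differentiable (f g : V -> W) x :
  (\forall y \near x, f y = g y) -> differentiable f x -> differentiable g x.
Proof.
move=> fg df; apply: (@differentiable_of_linear g ('d f x)).
  exact: diff_continuous.
move=> e e0; have := diff_locallyxC df => dfx.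
have fgx : f x = g x by exact: nbhs_singleton fg.
have fgh : \forall h \near 0, f (x + h) = g (x + h).
  move: fg; rewrite (near_shift 0) subr0; apply: filterS => h /=.
  by rewrite addrC.
have oh : \forall h \near 0, `|f (x + h) - f x - 'd f x h| <= e * `|h|.
  have : (fun h => f (x + h)) = (fun h => f x + 'd f x h) +o_ (0 : V) id.
    by apply/funext => h; rewrite dfx.
  move=> /eqaddoP/(_ e e0); apply: filterS => h /=.
  by rewrite !fctE opprD addrA.
by near=> h; rewrite -fgx -(near fgh h)//; near: h.
Unshelve. all: by end_near. Qed.

End DifferentiableGeneral.

Section ExplicitDerivative.
Variable R : realType.
Local Notation C := (cplx R).

Definition has_gradient m (f : 'rV[C]_m -> C) (p c : 'rV[C]_m) :=
  forall e : R, 0 < e -> exists2 r : R, 0 < r & forall h, vabs h < r ->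
    cabs (f (p + h) - f p - \sum_j c 0 j * h 0 j) <= e * vabs h.

Lemma near_diff_bound m (f : 'rV[C]_m -> C) p : differentiable f p ->
  forall e : C, 0 < e -> \forall h \near 0, `|f (p + h) - f p - 'd f p h| <= e * `|h|.
Proof.
move=> df e e0; have dfx := diff_locallyxC df.
have : (fun h => f (p + h)) = (fun h => f p + 'd f p h) +o_ (0 : 'rV_m) id.
  by apply/funext => h; rewrite dfx.
move=> /eqaddoP/(_ e e0); apply: filterS => h /=.
by rewrite !fctE opprD addrA.
Qed.

Lemma differentiable_gradient m (f : 'rV[C]_m -> C) p :
  differentiable f p -> exists c, has_gradient f p c.
Proof.
move=> df; exists (\row_j 'd f p (delta_mx 0 j)) => e e0.
have e'0 : 0 < e%:C :> C by rewrite ltC_real.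
have /near_rV[r r0 H] := near_diff_bound df e'0.
exists r => // h hr; have := H h hr; rewrite add0r.
have -> : 'd f p h = \sum_j (\row_j 'd f p (delta_mx 0 j)) 0 j * h 0 j.
  rewrite {1}[h]row_sum_delta linear_sum; apply: eq_bigr => j _.
  by rewrite linearZ mxE mulrC.
rewrite normE => /le_trans; rewrite -lecR => -> //.
by rewrite rmorphM ler_wpM2l ?rV_norm_le// ltW.
Qed.

Lemma gradient_differentiable m (f : 'rV[C]_m -> C) p c :
  has_gradient f p c -> differentiable f p.
Proof.
move=> fc; pose L (h : 'rV[C]_m) : C := \sum_j c 0 j * h 0 j.
have linL : linear L.
  move=> a x y; rewrite /L scaler_sumr -big_split; apply: eq_bigr => j _ /=.
  by rewrite !mxE mulrDr; congr (_ + _); rewrite mulrCA.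
pose LM := GRing.isLinear.Build _ _ _ _ _ linL.
pose LL : {linear _ -> _} := HB.pack L LM.
have cL : continuous LL.
  move=> h; apply: differentiable_continuous.
  have -> : (LL : 'rV[C]_m -> C) = (\sum_j (fun h : 'rV[C]_m => c 0 j *: h 0 j)).
    by apply/funext => v; rewrite fct_sumE.
  by apply: differentiable_sum => j; apply: differentiableZ; exact: differentiable_coord.
apply: (@differentiable_of_linear _ _ _ f LL) => // e /gt0_complexE[r r0 ->].
have r'0 : 0 < r / m.+1%:R by rewrite divr_gt0.
have [d d0 H] := fc _ r'0.
apply/near_rV; exists d => // h hd; rewrite add0r normE.
apply: (@le_trans _ _ ((r / m.+1%:R)%:C * (vabs h)%:C)).
  by rewrite -rmorphM lecR; exact: H.
apply: (@le_trans _ _ ((r / m.+1%:R)%:C * (m%:R * `|h|))).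
  by rewrite ler_wpM2l ?rV_norm_ge// lecR ltW.
rewrite mulrA ler_wpM2r// rmorphM -mulrA -[leRHS]mulr1 ler_wpM2l ?lecR ?(ltW r0)//.
have -> : m%:R = (m%:R : R)%:C :> C by rewrite rmorph_nat.
by rewrite -rmorphM lecR mulrC ler_pdivrMr// mul1r ler_nat.
Qed.

Definition has_cderiv (f : C -> C) (z d : C) :=
  forall e : R, 0 < e -> exists2 r : R, 0 < r & forall h, cabs h < r ->
    cabs (f (z + h) - f z - d * h) <= e * cabs h.

Lemma differentiable_cderiv (f : C -> C) z :
  differentiable f z -> exists d, has_cderiv f z d.
Proof.
move=> df; exists ('d f z 1) => e e0.
have e'0 : 0 < e%:C :> C by rewrite ltC_real.
have dfx := diff_locallyxC df.
have : (fun h => f (z + h)) = (fun h => f z + 'd f z h) +o_ (0 : C) id.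
  by apply/funext => h; rewrite dfx.
move=> /eqaddoP/(_ _ e'0)/near_cplx[r r0 H].
exists r => // h hr; have := H h; rewrite subr0 => /(_ hr).
rewrite !fctE opprD addrA [X in `|_ - X|](_ : _ = 'd f z 1 * h); last first.
  by rewrite -{1}[h]mulr1 -[h * 1]/(h *: (1 : C^o)) linearZ mulrC.
by rewrite !normE -rmorphM lecR.
Qed.

Lemma cderiv_differentiable (f : C -> C) z d :
  has_cderiv f z d -> differentiable f z.
Proof.
move=> fd; pose L (h : C) : C := h *: (d : C^o).
have linL : linear L by move=> a x y; rewrite /L scalerDl scalerA.
pose LM := GRing.isLinear.Build _ _ _ _ _ linL.
pose LL : {linear _ -> _} := HB.pack L LM.
apply: (@differentiable_of_linear _ _ _ f LL); first exact: scalel_continuous.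
move=> e /gt0_complexE[r r0 ->].
have [b b0 H] := fd _ r0; apply/near_cplx; exists b => // h; rewrite subr0 => hb.
by rewrite !normE -rmorphM lecR [LL h]mulrC; exact: H.
Qed.

End ExplicitDerivative.

(** * The complex exponential *)

Section ComplexExponential.
Variable R : realType.
Local Notation C := (cplx R).
Implicit Types (x y : R) (z w : C).

Lemma is_derive_bound (f : R -> R) x d : is_derive x 1 f d ->
  forall e : R, 0 < e -> exists2 r : R, 0 < r & forall h, `|h| < r ->
    `|f (x + h) - f x - d * h| <= e * `|h|.
Proof.
move=> [df vf] e e0.
have dfx := diff_locallyxC (iffLR (derivable1_diffP _ _) df).
have : (fun h => f (x + h)) = (fun h => f x + 'd f x h) +o_ (0 : R) id.
  by apply/funext => h; rewrite dfx.
move=> /eqaddoP/(_ _ e0)/nbhs_ballP[r /= r0 H].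
exists r => // h hr; have := H h; rewrite -ball_normE /= sub0r normrN => /(_ hr).
rewrite !fctE opprD addrA; congr (`|_ - _| <= _).
by rewrite diff1E ?derive1E ?vf; [exact: mulrC|exact/derivable1_diffP].
Qed.

Lemma bound_is_derive (f : R -> R) x d :
  (forall e : R, 0 < e -> exists2 r : R, 0 < r & forall h, `|h| < r ->
    `|f (x + h) - f x - d * h| <= e * `|h|) -> is_derive x 1 f d.
Proof.
move=> H.
have cv : h^-1 *: (f (h *: (1 : R^o) + x) - f x) @[h --> (0 : R)^'] --> d.
  apply/cvgrPdist_le => e e0; have [r r0 Hr] := H e e0.
  near=> h.
  have h0 : h != 0 by near: h; exact: nbhs_dnbhs_neq.
  have hr : `|h| < r by near: h; apply: dnbhs0_lt.
  have := Hr h hr; rewrite -[h *: 1]/(h * 1) mulr1 (addrC h) => Hh.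
  rewrite -[_ *: _]/(_ * _) distrC.
  have -> : h^-1 * (f (x + h) - f x) - d = h^-1 * (f (x + h) - f x - d * h).
    by rewrite [RHS]mulrBr [_ * (d * _)]mulrCA mulVf// mulr1.
  by rewrite normrM normfV mulrC ler_pdivrMr ?normr_gt0.
apply: DeriveDef; first by apply/cvg_ex; exists d.
exact: cvg_lim cv.
Unshelve. all: by end_near. Qed.

Lemma cexp0 : cexp 0 = 1 :> C.
Proof. by rewrite /cexp /= expR0 cos0 sin0 mul1r. Qed.

Lemma cexpD z w : cexp (z + w) = cexp z * cexp w.
Proof.
rewrite /cexp ReD ImD expRD rmorphM cosD sinD /= -!mulrA; congr (_ * _).
rewrite mulrCA; congr (_ * _); apply/eqP; rewrite eq_complex /=.
by rewrite [sin _ * cos _]mulrC addrC eqxx addrC eqxx.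
Qed.

Lemma cexp_neq0 z : cexp z != 0.
Proof.
apply/negP => /eqP e0; have := cexpD z (- z); rewrite subrr cexp0 e0 mul0r.
by move/eqP; rewrite oner_eq0.
Qed.

Lemma cexpN z : cexp (- z) = (cexp z)^-1.
Proof.
by apply: (mulfI (cexp_neq0 z)); rewrite -cexpD subrr cexp0 divff// cexp_neq0.
Qed.

Lemma cabs_cexp z : cabs (cexp z) = expR (complex.Re z).
Proof.
rewrite /cexp cabsM cabs_real ger0_norm ?expR_ge0// [X in _ * X](_ : _ = 1) ?mulr1//.
by rewrite /cabs /= cos2Dsin2 sqrtr1.
Qed.

Lemma Re_cexp z : complex.Re (cexp z) = expR (complex.Re z) * cos (complex.Im z).
Proof. by rewrite /cexp ReM /= mul0r subr0. Qed.

Lemma Im_cexp z : complex.Im (cexp z) = expR (complex.Re z) * sin (complex.Im z).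
Proof. by rewrite /cexp ImM /= mul0r addr0. Qed.

Lemma cexp_real x : cexp (x%:C) = (expR x)%:C :> C.
Proof. by rewrite /cexp /= cos0 sin0 mulr1. Qed.

Lemma cexp_im y : cexp (0 +i* y) = cos y +i* sin y :> C.
Proof. by rewrite /cexp /= expR0 mul1r. Qed.

Lemma cexp_2pi z : cexp (z + (0 +i* (pi *+ 2))) = cexp z.
Proof.
by rewrite cexpD cexp_im cos2pi sin2pi mulr1.
Qed.

Lemma cexp_cderiv0 : has_cderiv (@cexp R) 0 1.
Proof.
move=> e e0.
(* The four error terms below are at most 1, 2, 4 and 1 times [e' * cabs h]; [e' <= 1] also gives
   [|a| <= 1] and lets first order errors be absorbed. *)
have [e' [e'0 e'1 e'8]] : exists e' : R, [/\ 0 < e', e' <= 1 & e' *+ 8 <= e].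
  exists (Num.min (e / 8) 1); split.
  - by rewrite lt_min ltr01 divr_gt0.
  - by rewrite ge_min lexx orbT.
  - by rewrite -[Num.min _ _ *+ 8]mulr_natr -ler_pdivlMr// ge_min lexx.
have [r1 r10 H1] := is_derive_bound (is_derive_expR 0) e'0.
have [r2 r20 H2] := is_derive_bound (is_derive_cos 0) e'0.
have [r3 r30 H3] := is_derive_bound (is_derive_sin 0) e'0.
exists (Num.min (Num.min r1 r2) (Num.min r3 e')).
  by rewrite !lt_min r10 r20 r30 e'0.
move=> h; rewrite !lt_min => /andP[/andP[h1 h2] /andP[h3 h4]].
have ha := Re_le_cabs h; have hb := Im_le_cabs h.
set H := cabs h; set a := complex.Re h in ha *; set b := complex.Im h in hb *.
have := H1 a (le_lt_trans ha h1); have := H2 b (le_lt_trans hb h2).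
have := H3 b (le_lt_trans hb h3).
rewrite !add0r cexp0 !mul1r expR0 cos0 sin0 oppr0 mul0r !subr0 !mul1r addr0 => B3 B2 B1.
have hH0 : 0 <= H := cabs_ge0 _.
have le_a : e' * `|a| <= e' * H by rewrite ler_pM2l.
have le_b : e' * `|b| <= e' * H by rewrite ler_pM2l.
have cosb : `|cos b| <= 1 by rewrite ler_norml cos_geN1 cos_le1.
have a1 : `|a| <= 1 by apply: le_trans ha _; apply: le_trans e'1; apply: ltW.
have ea : `|expR a - 1| <= `|a| *+ 2.
  have -> : expR a - 1 = expR a - 1 - a + a by rewrite subrK.
  rewrite mulr2n; apply: le_trans (ler_normD _ _) _; rewrite lerD//.
  by apply: le_trans B1 _; rewrite ler_piMl.
have sb : `|sin b| <= `|b| *+ 2.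
  have -> : sin b = sin b - b + b by rewrite subrK.
  rewrite mulr2n; apply: le_trans (ler_normD _ _) _; rewrite lerD//.
  by apply: le_trans B3 _; rewrite ler_piMl.
apply: le_trans (cabs_le_ReIm _) _.
rewrite !(ReD, ImD, ReN, ImN) Re_cexp Im_cexp -/a -/b /= oppr0 addr0.
have -> : expR a * cos b - 1 - a = (expR a - 1 - a) * cos b + (1 + a) * (cos b - 1).
  by ring.
have -> : expR a * sin b - b = (expR a - 1) * sin b + (sin b - b) by ring.
have T1 : `|(expR a - 1 - a) * cos b| <= e' * H.
  rewrite normrM; apply: le_trans le_a; apply: le_trans B1.
  by rewrite ler_piMr.
have T2 : `|(1 + a) * (cos b - 1)| <= e' * H *+ 2.
  rewrite normrM -mulr_natl; apply: ler_pM => //; last exact: le_trans B2 _.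
  by apply: le_trans (ler_normD _ _) _; rewrite normr1 -[2%:R]/(1 + 1 : R) lerD2l.
have T3 : `|(expR a - 1) * sin b| <= e' * H *+ 4.
  have : `|expR a - 1| * `|sin b| <= (`|a| *+ 2) * (`|b| *+ 2) by apply: ler_pM.
  rewrite normrM => /le_trans; apply.
  rewrite mulrnAl mulrnAr -mulrnA lerMn2r /=.
  by apply: ler_pM => //; apply: le_trans ha _; apply: ltW.
have T4 : `|sin b - b| <= e' * H by apply: le_trans B3 _.
apply: (@le_trans _ _ (e' *+ 8 * H)); last by rewrite ler_wpM2r.
rewrite mulrnAl.
have -> : e' * H *+ 8 = (e' * H + e' * H *+ 2) + (e' * H *+ 4 + e' * H).
  by rewrite -mulrS -mulrSr -mulrnDr.
by rewrite lerD//; apply: le_trans (ler_normD _ _) _; rewrite lerD.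
Qed.

Lemma cexp_cderiv z : has_cderiv (@cexp R) z (cexp z).
Proof.
move=> e e0.
have c0 : 0 < cabs (cexp z) by rewrite cabs_gt0// cexp_neq0.
have e'0 : 0 < e / cabs (cexp z) by rewrite divr_gt0.
have [r r0 H] := cexp_cderiv0 e'0; exists r => // h hr.
have -> : cexp (z + h) - cexp z - cexp z * h =
    cexp z * (cexp (0 + h) - cexp 0 - 1 * h).
  by rewrite cexpD add0r cexp0; ring.
by rewrite cabsM mulrC -ler_pdivlMr// mulrAC H.
Qed.

Lemma differentiable_cexp z : differentiable (@cexp R) z.
Proof. exact: cderiv_differentiable (@cexp_cderiv z). Qed.

Lemma differentiable_continuous_eps (f : C -> C) z : differentiable f z ->
  forall e : R, 0 < e -> exists2 r : R, 0 < r & forall w,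
    cabs (w - z) < r -> cabs (f w - f z) < e.
Proof.
move=> /differentiable_continuous cf e e0.
have /cvgrPdist_lt/(_ e%:C) := cf; rewrite ltC_real => /(_ e0) /near_cplx[r r0 H].
by exists r => // w wr; have := H w wr; rewrite cabs_dist_lt.
Qed.

End ComplexExponential.

(** * The value at the centre of a circle *)

Section CircleBound.
Variable R : realType.
Local Notation C := (cplx R).
Implicit Types (x y : R) (z w : C).

Lemma continuous_eps (g : R -> R) :
  (forall y e : R, 0 < e -> exists2 r : R, 0 < r & forall y', `|y' - y| < r ->
    `|g y' - g y| < e) -> continuous g.
Proof.
move=> H y; apply/cvgrPdist_lt => e e0; have [r r0 Hr] := H y e e0.
near=> t; rewrite distrC; apply: Hr; rewrite distrC; near: t.
exact: cvgr_dist_lt.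
Unshelve. all: by end_near. Qed.

Lemma rotate_to_real z : exists2 k : C, cabs k = 1 & k * z = (cabs z)%:C.
Proof.
have [->|z0] := eqVneq z 0.
  by exists 1; rewrite ?cabs1// mulr0 cabs0.
have c0 := cabs_gt0 z0.
exists ((cabs z)%:C / z); last by rewrite divfK.
by rewrite cabsM cabsV cabs_real gtr0_norm// divff// gt_eqF.
Qed.

Lemma min_lipschitz (a b c : R) : `|Num.min a c - Num.min b c| <= `|a - b|.
Proof.
have := ler_norm (a - b); have := ler_norm (b - a); rewrite [(`|b - a|)]distrC.
move: `|a - b| => N; rewrite ler_norml.
by case: (ltP a c); case: (ltP b c) => ? ? ? ?; lra.
Qed.

(* In logarithmic coordinates the circles about 0 become vertical segments of
   length 2 pi.  By periodicity the rectangle identity says that the increment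
   of a primitive of [Re f] along such a segment does not depend on the
   radius. *)
Lemma circle_bound (f : C -> C) (r rho M : R) : 0 < r -> r < rho ->
  (forall z, 0 < cabs z -> cabs z < rho -> differentiable f z) ->
  (forall e : R, 0 < e -> exists2 d : R, 0 < d &
     forall z, cabs z < d -> cabs (f z - f 0) < e) ->
  (forall y, 0 <= y <= pi *+ 2 -> cabs (f (r%:C * cexp (0 +i* y))) <= M) ->
  cabs (f 0) <= M.
Proof.
move=> r0 rrho df cf0 fM; rewrite leNgt; apply/negP => Mf.
have rho0 : 0 < rho := lt_trans r0 rrho.
have pi2 : 0 < (pi : R) *+ 2 by rewrite pmulrn_lgt0// pi_gt0.
(* After this rotation the value at the centre is real and nonnegative, so that real parts
   suffice. *)
have [k k1 kf0] := rotate_to_real (f 0).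
have e0 : 0 < cabs (f 0) - M by rewrite subr_gt0.
have [d d0 Hd] := cf0 _ e0.
(* [X2] is the logarithm of the given radius and [x1] that of a smaller circle, on which [f] differs
   from [f 0] by less than the supposed excess over [M]. *)
pose X2 := ln r; pose x1 := Num.min (ln d - 1) (ln r - 1).
have x1X2 : x1 < X2 by rewrite gt_min [X in _ || X]gtrBl ltr01 orbT.
have x1d : expR x1 < d.
  rewrite -[ltRHS]lnK// ltr_expR gt_min [X in X || _]gtrBl ltr01; done.
have expX2 : expR X2 = r by rewrite lnK.
pose G w := k * f (cexp w).
have dG w : complex.Re w <= X2 -> exists d, has_cderiv G w d.
  move=> wX; apply: differentiable_cderiv; rewrite /G.
  apply: (@differentiableZ _ _ _ (fun w => f (cexp w)) k).
  apply: (@differentiable_comp _ _ _ _ (@cexp R) f); first exact: differentiable_cexp.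
  by apply: df; rewrite cabs_cexp ?expR_gt0// (le_lt_trans _ rrho)// -expX2 ler_expR.
have GD w h : w + h = (complex.Re w + complex.Re h) +i* (complex.Im w + complex.Im h).
  by case: w; case: h.
pose u x y := complex.Re (G (x +i* y)); pose v x y := complex.Im (G (x +i* y)).
have per x y : G (x +i* (y + pi *+ 2)) = G (x +i* y).
  by rewrite /G -(cexp_2pi (x +i* y)) GD /= addr0.
have contG w : complex.Re w <= X2 -> forall e : R, 0 < e ->
    exists2 t : R, 0 < t & forall w', cabs (w' - w) < t -> cabs (G w' - G w) < e.
  move=> /dG[b Gb]; apply: differentiable_continuous_eps.
  exact: cderiv_differentiable Gb.
have cu x : x <= X2 -> continuous (u x).
  move=> xX; apply: continuous_eps => y e e'0.
  have [t t0 Ht] := contG (x +i* y) xX e e'0; exists t => // y' y't.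
  rewrite /u -ReN -ReD; apply: le_lt_trans (Re_le_cabs _) _; apply: Ht.
  apply: le_lt_trans (cabs_le_ReIm _) _.
  by rewrite ReD ReN ImD ImN /= subrr normr0 add0r.
(* Frozen beyond [X2], [v] is continuous on the whole line and so has a primitive there. *)
have cv y : continuous (fun x => v (Num.min x X2) y).
  apply: continuous_eps => x e e'0.
  have mX : Num.min x X2 <= X2 by rewrite ge_min lexx orbT.
  have [t t0 Ht] := contG (Num.min x X2 +i* y) mX e e'0; exists t => // x' x't.
  rewrite /v -ImN -ImD; apply: le_lt_trans (Im_le_cabs _) _; apply: Ht.
  apply: le_lt_trans (cabs_le_ReIm _) _.
  rewrite ReD ReN ImD ImN /= subrr normr0 addr0.
  by apply: le_lt_trans x't; exact: min_lipschitz.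
have [V HV] : {V : R -> R -> R & forall x, x <= X2 -> forall y, -1 < y ->
    is_derive y 1 (V x) (u x y)}.
  apply: (choice (P := fun x F => x <= X2 -> forall y, -1 < y ->
    is_derive y 1 F (u x y))) => x.
  have [xX|xX] := leP x X2; last by exists (cst 0).
  by have [F HF] := primitive_exists (-1) (cu x xX); exists F.
have [H HH] : {H : R -> R -> R & forall y x, x1 - 1 < x ->
    is_derive x 1 (H y) (v (Num.min x X2) y)}.
  apply: (choice (P := fun y F => forall x, x1 - 1 < x ->
    is_derive x 1 F (v (Num.min x X2) y))) => y.
  by have [F HF] := primitive_exists (x1 - 1) (cv y); exists F.
have HH' y x : x1 <= x <= X2 -> is_derive x 1 (H y) (v x y).
  move=> /andP[x1x xX2]; have := HH y x; rewrite min_l//; apply.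
  by rewrite (lt_le_trans _ x1x)// gtrBl.
have Q0 : circ V (fun x y => H y x) x1 (X2 - x1) 0 (pi *+ 2 - 0) = 0.
  apply: (@circ_eq0 R u v V (fun x y => H y x) x1 X2 0 (pi *+ 2) x1X2 pi2).
  - move=> x y /andP[/andP[_ xX] /andP[y0 _]]; apply: HV => //.
    by apply: lt_le_trans y0; rewrite oppr_lt0.
  - by move=> x y /andP[xX _]; exact: HH'.
  - move=> x y /andP[/andP[_ xX] _].
    have [b Gb] := dG (x +i* y) xX.
    (* Multiplication by the complex derivative [b], as a real matrix. *)
    exists (complex.Re b), (- complex.Im b), (complex.Im b) => e e'0.
    have [t t0 Ht] := Gb e e'0; exists (t / 3); first by rewrite divr_gt0.
    move=> x' y' _ hx hy.
    pose h : C := (x' - x) +i* (y' - y).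
    have hh : cabs h <= `|x' - x| + `|y' - y| by exact: cabs_le_ReIm.
    have ht : cabs h < t.
      apply: le_lt_trans hh _; apply: le_lt_trans (lerD hx hy) _.
      by move: t0; clear; lra.
    have e1 : x +i* y + h = x' +i* y' by rewrite GD /= ![_ + (_ - _)]addrC !subrK.
    have := Ht h ht; rewrite e1 => B.
    have {}B := le_trans B (ler_wpM2l (ltW e'0) hh).
    split; apply: le_trans B.
    + apply: le_trans (Re_le_cabs _); rewrite !(ReD, ReN) ReM /= /u.
      by rewrite le_eqVlt; apply/orP; left; apply/eqP; congr `|_|; ring.
    + apply: le_trans (Im_le_cabs _); rewrite !(ImD, ImN) ImM /= /v.
      by rewrite le_eqVlt; apply/orP; left; apply/eqP; congr `|_|; ring.
have {}Q0 : V X2 (pi *+ 2) - V X2 0 - (V x1 (pi *+ 2) - V x1 0) =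
    H (pi *+ 2) X2 - H 0 X2 - (H (pi *+ 2) x1 - H 0 x1).
  move: Q0; rewrite /circ [x1 + _]addrC !subrK !add0r !subr0 => Q0.
  by apply/eqP; rewrite -subr_eq0; apply/eqP; rewrite -[RHS]Q0; ring.
(* The horizontal sides cancel: [v] takes equal values at heights 0 and [pi *+ 2], so the difference
   of the two primitives has derivative zero. *)
have [c _ Hc] : exists2 c, x1 <= c <= X2 &
    (H (pi *+ 2) X2 - H 0 X2) - (H (pi *+ 2) x1 - H 0 x1) = 0 * (X2 - x1).
  apply: (@mvt_closed _ (fun x => H (pi *+ 2) x - H 0 x) (fun=> 0)); first exact: ltW.
  move=> x xb; have := is_deriveB (HH' (pi *+ 2) x xb) (HH' 0 x xb).
  by rewrite /v -[in pi *+ 2](add0r (pi *+ 2)) per subrr.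
have mvtV x : x <= X2 -> exists2 c, 0 <= c <= pi *+ 2 &
    V x (pi *+ 2) - V x 0 = u x c * (pi *+ 2 - 0).
  move=> xX; apply: mvt_closed; first exact: ltW.
  by move=> y /andP[y0 _]; apply: HV => //; apply: lt_le_trans y0; rewrite oppr_lt0.
have [c1 c1b V1] := mvtV x1 (ltW x1X2).
have [c2 c2b V2] := mvtV X2 (lexx _).
move: Q0; rewrite V1 V2 Hc mul0r subr0 -mulrBl => /eqP.
rewrite mulf_eq0 (gt_eqF pi2) orbF subr_eq0 => /eqP u12.
have uM : u X2 c2 <= M.
  apply: le_trans (ler_norm _) _; apply: le_trans (Re_le_cabs _) _.
  rewrite /G cabsM k1 mul1r; apply: le_trans (fM c2 c2b).
  have -> : X2 +i* c2 = X2%:C + (0 +i* c2) by rewrite GD /= addr0 add0r.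
  by rewrite cexpD cexp_real expX2.
(* On the small circle the mean value exceeds [M], yet it equals a value at most [M] on the given
   circle. *)
have : `|u x1 c1 - cabs (f 0)| < cabs (f 0) - M.
  have -> : u x1 c1 - cabs (f 0) = complex.Re (k * (f (cexp (x1 +i* c1)) - f 0)).
    by rewrite mulrBr kf0 ReD ReN.
  apply: le_lt_trans (Re_le_cabs _) _; rewrite cabsM k1 mul1r; apply: Hd.
  by rewrite cabs_cexp.
rewrite -u12 distrC => /(le_lt_trans (ler_norm _)).
by rewrite ltrD2l ltrN2 ltNge uM.
Qed.

End CircleBound.

(** * Cauchy's estimate and the identity theorem along a segment *)

Section IdentityTheorem.
Variable R : realType.
Local Notation C := (cplx R).
Implicit Types (x y : R) (z w : C).

Lemma differentiable_prod (V : normedModType C) (I : Type) (s : seq I)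
    (F : I -> V -> C) (x : V) :
  (forall i, differentiable (F i) x) ->
  differentiable (fun v => \prod_(i <- s) F i v) x.
Proof.
move=> dF; elim: s => [|i s IH].
  have -> : (fun v => \prod_(i <- [::]) F i v) = cst 1.
    by apply/funext => v; rewrite big_nil.
  exact: differentiable_cst.
have -> : (fun v => \prod_(i <- i :: s) F i v) =
    F i * (fun v => \prod_(i <- s) F i v).
  by apply/funext => v; rewrite big_cons.
exact: differentiableM.
Qed.

(** Cauchy's estimate, from [circle_bound] for the difference quotient with value [d] at 0. At the
    centre that lemma asks only for continuity, so the singularity of the quotient need not be
    removed first. *)
Lemma cderiv_bound (f : C -> C) (d : C) (r rho M : R) : 0 < r -> r < rho ->
  (forall z, cabs z < rho -> differentiable f z) ->
  (forall z, cabs z < rho -> cabs (f z) <= M) ->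
  has_cderiv f 0 d -> cabs d <= M *+ 2 / r.
Proof.
move=> r0 rrho df fM fd.
pose psi z := if z == 0 then d else (f z - f 0) / z.
have psi0 : psi 0 = d by rewrite /psi eqxx.
rewrite -psi0; apply: (circle_bound r0 rrho).
- move=> z z0 zr.
  have zn0 : z != 0 by apply: contraTneq z0 => ->; rewrite cabs0 ltxx.
  apply: (@near_eq_differentiable _ _ _ (fun w => (f w - f 0) * w^-1)).
    apply/near_cplx; exists (cabs z) => // w wz; rewrite /psi ifN//.
    by apply: contraTneq wz => ->; rewrite sub0r cabsN ltxx.
  apply: (@differentiableM _ _ (fun w => f w - f 0) (fun w => w^-1)).
    by apply: differentiableB; [exact: df|exact: differentiable_cst].
  exact: differentiable_Rinv.
- move=> e e0; have e2 : 0 < e / 2 by rewrite divr_gt0.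
  have [b b0 Hb] := fd _ e2; exists b => // z zb; rewrite psi0 /psi.
  case: eqVneq => [_|zn0]; first by rewrite subrr cabs0.
  have z0 := cabs_gt0 zn0.
  have -> : (f z - f 0) / z - d = (f (0 + z) - f 0 - d * z) / z.
    by rewrite add0r; field.
  rewrite cabsM cabsV ltr_pdivrMr//; apply: le_lt_trans (Hb z zb) _.
  by rewrite ltr_pM2r// ltr_pdivrMr// ltr_pMr// ltr1n.
- move=> y _; set z := _ * _.
  have zr : cabs z = r.
    by rewrite cabsM cabs_cexp /= expR0 mulr1 cabs_real gtr0_norm.
  rewrite /psi ifN; last first.
    by apply: contraTneq r0 => z0; rewrite -zr z0 cabs0 ltxx.
  rewrite cabsM cabsV zr ler_wpM2r ?invr_ge0 ?(ltW r0)//.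
  apply: le_trans (cabsB _ _) _; rewrite mulr2n lerD// fM ?zr//.
  by rewrite cabs0 (lt_trans r0).
Qed.

(* If f vanishes on an arc of the unit circle, then the product of the
   rotations of f by N-th roots of unity vanishes on the whole circle. *)
Lemma zero_of_zero_near1 (f : C -> C) (rho eps : R) : 1 < rho -> 0 < eps ->
  (forall z, cabs z < rho -> differentiable f z) ->
  (forall z, cabs (z - 1) < eps -> f z = 0) -> f 0 = 0.
Proof.
move=> rho1 eps0 df f0.
have pi2 : 0 < (pi : R) *+ 2 by rewrite pmulrn_lgt0// pi_gt0.
have [d d0 Hd] := differentiable_continuous_eps (@differentiable_cexp R 0) eps0.
(* [N] is so large that [t < d]: all points of the unit circle with angle in [0, t) are within [eps]
   of 1. *)
pose N := (Num.bound (pi *+ 2 / d)).+1; pose t : R := pi *+ 2 / N%:R.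
have N0 : 0 < N%:R :> R by rewrite ltr0n.
have t0 : 0 < t by rewrite divr_gt0.
have td : t < d.
  rewrite ltr_pdivrMr// mulrC -ltr_pdivrMr//.
  apply: lt_trans (archi_boundP _) _; first by rewrite divr_ge0// ltW.
  by rewrite ltr_nat.
pose F z := \prod_(j < N.+1) f (cexp (0 +i* (t * j%:R)) * z).
have rot1 y : cabs (cexp (0 +i* y) : C) = 1 by rewrite cabs_cexp /= expR0.
have dF z : cabs z < rho -> differentiable F z.
  move=> zr; apply: differentiable_prod => j.
  apply: (@differentiable_comp _ _ _ _ (fun w => cexp (0 +i* (t * j%:R)) * w) f).
    by apply: differentiableM; [exact: differentiable_cst|exact: ex_diff].
  by apply: df; rewrite cabsM rot1 mul1r.
have : cabs (F 0) <= 0.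
  apply: (@circle_bound _ F 1 rho) => //.
  - by move=> z _; exact: dF.
  - move=> e e0; have dF0 : differentiable F 0.
      by apply: dF; rewrite cabs0 (lt_trans _ rho1).
    have [b b0 Hb] := differentiable_continuous_eps dF0 e0; exists b => // z zb.
    by apply: Hb; rewrite subr0.
  - move=> y /andP[y0 y2]; rewrite mul1r.
    (* The least such [j] rotates the angle [y] into [0, t) modulo a full turn, where the
       corresponding factor of [F] vanishes. Hence [F] is zero on the circle, and [F 0] is a power
       of [f 0]. *)
    have ex : exists j : nat, pi *+ 2 <= y + t * j%:R.
      by exists N; rewrite /t divfK ?gt_eqF// lerDr.
    have jN : (ex_minn ex <= N)%N.
      by case: ex_minnP => j _; apply; rewrite /t divfK ?gt_eqF// lerDr.
    have [jl ju] : pi *+ 2 <= y + t * (ex_minn ex)%:R /\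
        y + t * (ex_minn ex)%:R < pi *+ 2 + t.
      case: ex_minnP => -[|j] h1 h2; split => //.
        by rewrite mulr0 addr0 (le_lt_trans y2)// ltrDl.
      have : y + t * j%:R < pi *+ 2.
        by rewrite ltNge; apply/negP => /h2; rewrite ltnn.
      by rewrite -natr1 mulrDr mulr1 addrA ltrD2r.
    have jN1 : (ex_minn ex < N.+1)%N by rewrite ltnS.
    rewrite /F (bigD1 (Ordinal jN1))//= f0 ?mul0r ?cabs0//.
    have -> : cexp (0 +i* (t * (ex_minn ex)%:R)) * cexp (0 +i* y) =
        cexp (0 +i* (y + t * (ex_minn ex)%:R - pi *+ 2)) :> C.
      rewrite -cexpD -[in RHS]cexp_2pi; congr cexp.
      by apply/eqP; rewrite eq_complex /= !addr0 eqxx subrK addrC eqxx.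
    rewrite -cexp0; apply: Hd; rewrite subr0.
    apply: le_lt_trans (cabs_le_ReIm _) _; rewrite /= normr0 add0r ger0_norm.
      by apply: lt_trans td; rewrite ltrBlDl.
    by rewrite subr_ge0.
rewrite /F cabs_prod => h.
have : \prod_(j < N.+1) cabs (f (cexp (0 +i* (t * j%:R)) * 0)) == 0.
  by rewrite eq_le h prodr_ge0// => j _; exact: cabs_ge0.
by rewrite prodf_seq_eq0 => /hasP[j _ /= /eqP/cabs0_eq0]; rewrite mulr0.
Qed.

(** The affine map sending 0 to [w] and 1 to [b] reduces this to the unit circle. *)
Lemma zero_of_zero_near (f : C -> C) (b w : C) (rho eps : R) : 0 < eps ->
  cabs (b - w) < rho ->
  (forall z, cabs (z - w) < rho -> differentiable f z) ->
  (forall z, cabs (z - b) < eps -> f z = 0) -> f w = 0.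
Proof.
move=> eps0 bw df f0.
have [->|nbw] := eqVneq w b; first by rewrite f0// subrr cabs0.
have c0 : 0 < cabs (b - w) by rewrite cabs_gt0// subr_eq0 eq_sym.
have := @zero_of_zero_near1 (fun z => f (w + z * (b - w))) (rho / cabs (b - w))
  (eps / cabs (b - w)).
rewrite mul0r addr0; apply.
- by rewrite ltr_pdivlMr// mul1r.
- by rewrite divr_gt0.
- move=> z; rewrite ltr_pdivlMr// -cabsM => zr.
  apply: (@differentiable_comp _ _ _ _ (fun z => w + z * (b - w)) f).
    apply: differentiableD; first exact: differentiable_cst.
    by apply: differentiableM; [exact: ex_diff|exact: differentiable_cst].
  by apply: df; rewrite addrC addKr.
- move=> z; rewrite ltr_pdivlMr// -cabsM => zr; apply: f0.
  by rewrite (_ : _ - b = (z - 1) * (b - w))//; ring.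
Qed.

(** The infimum of the parameters near which [f] vanishes has a disc of holomorphy. Zeros near a
    parameter just above it spread over a disc reaching below it, so the infimum can only be 0. *)
Lemma zero_along_segment (f : C -> C) (T : R) : 0 <= T ->
  (forall t : R, 0 <= t <= T -> \forall z \near (t%:C : C), differentiable f z) ->
  (\forall z \near (T%:C : C), f z = 0) -> f 0 = 0.
Proof.
move=> T0 df fT.
pose A := [set t : R | 0 <= t <= T /\ \forall z \near (t%:C : C), f z = 0].
have AT : A T by split=> //; rewrite T0 lexx.
have infA : has_inf A.
  by split; [exists T|exists 0 => t [/andP[]]].
have s0 : 0 <= inf A by apply: lb_le_inf; [exists T|move=> t [/andP[]]].
have sT : inf A <= T by apply: ge_inf => //; case: infA.
have /near_cplx[rho rho0 Hrho] := df (inf A) (introT andP (conj s0 sT)).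
(* If [t] is within [rho / 4] of the infimum and [w] within [rho / 4] of [t], the disc of radius
   [rho / 2] about [w] lies in the disc of holomorphy and contains [t]. *)
have rho4 : 0 < rho / 4 by rewrite divr_gt0.
have [t [/andP[t0 tT] /near_cplx[eps eps0 Heps]] tl] := inf_adherent rho4 infA.
have st : inf A <= t by apply: ge_inf; [case: infA|split; [rewrite t0|apply/near_cplx; exists eps]].
have dts : cabs (t%:C - (inf A)%:C : C) < rho / 4.
  by rewrite -rmorphB cabs_real ger0_norm ?subr_ge0// ltrBlDl.
have Z w : cabs (w - t%:C) < rho / 4 -> f w = 0.
  move=> wt; apply: (@zero_of_zero_near f t%:C w (rho / 2) eps) => //.
    rewrite cabs_distC; apply: lt_trans wt _.
    by move: rho0; clear; lra.
  move=> z zw; apply: Hrho.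
  have -> : z - (inf A)%:C = (z - w) + (w - t%:C) + (t%:C - (inf A)%:C).
    by rewrite !addrA !subrK.
  apply: le_lt_trans (cabsD _ _) _; apply: le_lt_trans (lerD (cabsD _ _) (lexx _)) _.
  by move: zw wt dts; move: (cabs _) (cabs _) (cabs _); clear; move=> ? ? ? ? ? ?; lra.
have [s00|] := eqVneq (inf A) 0.
  by apply: Z; rewrite cabs_distC subr0; rewrite s00 subr0 in dts.
move=> sn0; have sgt0 : 0 < inf A by rewrite lt_def sn0.
pose d := Num.min (inf A) (rho / 4 - (t - inf A)) / 2.
have mn0 : 0 < Num.min (inf A) (rho / 4 - (t - inf A)).
  by rewrite lt_min sgt0 subr_gt0 ltrBlDl.
have d0 : 0 < d by rewrite divr_gt0.
have : d < Num.min (inf A) (rho / 4 - (t - inf A)).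
  by rewrite ltr_pdivrMr// ltr_pMr// ltr1n.
rewrite lt_min => /andP[d1 d2].
have : A (inf A - d).
  split; first by rewrite subr_ge0 (ltW d1)/= (le_trans _ sT)// gerBl ltW.
  apply/near_cplx; exists (rho / 4 - (t - inf A) - d); first by rewrite subr_gt0.
  move=> z zd; apply: Z.
  have -> : z - t%:C = (z - (inf A - d)%:C) - (t - (inf A - d))%:C.
    by rewrite !(rmorphB (real_complex R)); ring.
  apply: le_lt_trans (cabsB _ _) _; rewrite cabs_real ger0_norm; last first.
    by rewrite subr_ge0 (le_trans _ st)// gerBl ltW.
  rewrite -ltrBrDr; apply: lt_le_trans zd _.
  by rewrite le_eqVlt; apply/orP; left; apply/eqP; ring.
by move=> /(ge_inf (proj2 infA)); rewrite leNgt gtrBl d0.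
Qed.

End IdentityTheorem.

(** * Uniform limits of holomorphic functions *)

Section Weierstrass.
Variable R : realType.
Local Notation C := (cplx R).
Implicit Types (x y : R) (z w : C).

Definition has_rderiv (f : R -> C) (t : R) (d : C) :=
  forall e : R, 0 < e -> exists2 r : R, 0 < r & forall h : R, `|h| < r ->
    cabs (f (t + h) - f t - h%:C * d) <= e * `|h|.

(** The mean value theorem is applied to the real and the imaginary part separately, with different
    intermediate points; this costs the factor 2. *)
Lemma mean_value_bound (f : R -> C) (a b L : R) : a <= b ->
  (forall t, a <= t <= b -> exists2 d, has_rderiv f t d & cabs d <= L) ->
  cabs (f b - f a) <= L * (b - a) *+ 2.
Proof.
move=> ab H.
have [d Hd] : {d : R -> C & forall t, a <= t <= b -> has_rderiv f t (d t) /\ cabs (d t) <= L}.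
  apply: (choice (P := fun t d => a <= t <= b -> has_rderiv f t d /\ cabs d <= L)) => t.
  have [tab|tab] := boolP (a <= t <= b); last by exists 0.
  by have [d] := H t tab; exists d.
have [c1 c1b E1] : exists2 c, a <= c <= b & complex.Re (f b) - complex.Re (f a) =
    complex.Re (d c) * (b - a).
  apply: (@mvt_closed R (fun t => complex.Re (f t)) (fun t => complex.Re (d t))) => // t tab.
  apply: bound_is_derive => e e0; have [r r0 Hr] := (Hd t tab).1 e e0.
  exists r => // h hr; apply: le_trans (Hr h hr).
  apply: le_trans (Re_le_cabs _); rewrite !(ReD, ReN) ReM /=.
  by rewrite le_eqVlt; apply/orP; left; apply/eqP; congr `|_|; ring.
have [c2 c2b E2] : exists2 c, a <= c <= b & complex.Im (f b) - complex.Im (f a) =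
    complex.Im (d c) * (b - a).
  apply: (@mvt_closed R (fun t => complex.Im (f t)) (fun t => complex.Im (d t))) => // t tab.
  apply: bound_is_derive => e e0; have [r r0 Hr] := (Hd t tab).1 e e0.
  exists r => // h hr; apply: le_trans (Hr h hr).
  apply: le_trans (Im_le_cabs _); rewrite !(ImD, ImN) ImM /=.
  by rewrite le_eqVlt; apply/orP; left; apply/eqP; congr `|_|; ring.
apply: le_trans (cabs_le_ReIm _) _; rewrite ReD ReN ImD ImN E1 E2 !normrM mulr2n.
have ba : 0 <= b - a by rewrite subr_ge0.
rewrite (ger0_norm ba) lerD// ler_wpM2r//.
  by apply: le_trans (Re_le_cabs _) _; exact: (Hd c1 c1b).2.
by apply: le_trans (Im_le_cabs _) _; exact: (Hd c2 c2b).2.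
Qed.

Definition hdot m (c h : 'rV[C]_m) : C := \sum_j c 0 j * h 0 j.

Lemma hdotZ m (c h : 'rV[C]_m) (a : C) : hdot c (a *: h) = a * hdot c h.
Proof. by rewrite /hdot mulr_sumr; apply: eq_bigr => j _; rewrite mxE mulrCA. Qed.

Lemma hdotBl m (c c' h : 'rV[C]_m) : hdot (c - c') h = hdot c h - hdot c' h.
Proof.
by rewrite /hdot -sumrB; apply: eq_bigr => j _; rewrite !mxE mulrBl.
Qed.

Lemma hdot_delta m (c : 'rV[C]_m) j : hdot c (delta_mx 0 j) = c 0 j.
Proof.
rewrite /hdot (bigD1 j)//= mxE !eqxx mulr1 big1 ?addr0// => i ij.
by rewrite mxE (negbTE ij) andbF mulr0.
Qed.

Lemma vabs_delta m (j : 'I_m) : vabs (delta_mx 0 j : 'rV[C]_m) = 1.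
Proof.
rewrite /vabs (bigD1 j)//= mxE !eqxx cabs1 big1 ?addr0// => i ij.
by rewrite mxE (negbTE ij) andbF cabs0.
Qed.

Lemma cabs_hdot m (c h : 'rV[C]_m) (L : R) :
  (forall j, cabs (c 0 j) <= L) -> cabs (hdot c h) <= L * vabs h.
Proof.
move=> cL; apply: le_trans (cabs_sum _ _ _) _; rewrite /vabs mulr_sumr.
by apply: ler_sum => j _; rewrite cabsM ler_wpM2r ?cabs_ge0.
Qed.

Lemma line_cderiv m (f : 'rV[C]_m -> C) (p h c : 'rV[C]_m) :
  has_gradient f p c -> has_cderiv (fun z => f (p + z *: h)) 0 (hdot c h).
Proof.
move=> fc e e0; have V0 : 0 < vabs h + 1 by rewrite ltr_wpDl ?vabs_ge0.
have e'0 : 0 < e / (vabs h + 1) by rewrite divr_gt0.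
have [r r0 H] := fc _ e'0; exists (r / (vabs h + 1)); first by rewrite divr_gt0.
move=> z zr; rewrite add0r scale0r addr0 mulrC -hdotZ.
have zh : cabs z * vabs h <= cabs z * (vabs h + 1).
  by rewrite ler_wpM2l ?cabs_ge0// lerDl.
apply: le_trans (H _ _) _.
  by rewrite vabsZ; apply: le_lt_trans zh _; rewrite -ltr_pdivlMr.
by rewrite vabsZ mulrAC ler_pdivrMr// -mulrA ler_pM2l.
Qed.

Lemma line_rderiv m (f : 'rV[C]_m -> C) (p h c : 'rV[C]_m) (t : R) :
  has_gradient f (p + t%:C *: h) c ->
  has_rderiv (fun x => f (p + x%:C *: h)) t (hdot c h).
Proof.
move=> /(line_cderiv h) fc e e0; have [r r0 H] := fc e e0; exists r => // x xr.
have := H x%:C; rewrite cabs_real => /(_ xr).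
have -> : p + (t + x)%:C *: h = p + t%:C *: h + x%:C *: h.
  by rewrite rmorphD scalerDl addrA.
by rewrite add0r scale0r addr0 [hdot _ _ * _]mulrC.
Qed.

(** Cauchy's estimate on the complex line [p + z *: h], with the circle of radius
    [rho / vabs h / 2]. *)
Lemma gradient_bound m (f : 'rV[C]_m -> C) (p h c : 'rV[C]_m) (rho M : R) :
  0 < rho ->
  (forall h, vabs h < rho -> differentiable f (p + h)) ->
  (forall h, vabs h < rho -> cabs (f (p + h)) <= M) ->
  has_gradient f p c -> cabs (hdot c h) <= M *+ 4 / rho * vabs h.
Proof.
move=> rho0 df fM fc.
have [h0|h0] := eqVneq (vabs h) 0.
  have hj j : h 0 j = 0.
    by apply: cabs0_eq0; apply/eqP; rewrite eq_le cabs_ge0 -h0 cabs_le_vabs.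
  rewrite /hdot big1 ?cabs0 ?h0 ?mulr0// => j _; by rewrite hj mulr0.
have hp : 0 < vabs h by rewrite lt_def h0 vabs_ge0.
have r0 : 0 < rho / vabs h by rewrite divr_gt0.
have r2 : rho / vabs h / 2 < rho / vabs h by rewrite ltr_pdivrMr// ltr_pMr// ltr1n.
have := @cderiv_bound R (fun z => f (p + z *: h)) (hdot c h) (rho / vabs h / 2)
  (rho / vabs h) M.
have -> : M *+ 2 / (rho / vabs h / 2) = M *+ 4 / rho * vabs h.
  by rewrite !invfM !invrK -mulr_natr -[M *+ 4]mulr_natr (natrM _ 2 2); ring.
apply => //; first by rewrite divr_gt0.
- move=> z; rewrite ltr_pdivlMr// -vabsZ => zr.
  apply: (@differentiable_comp _ _ _ _ (fun z => p + z *: h) f); last exact: df.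
  apply: differentiableD; first exact: differentiable_cst.
  by apply: differentiableZl; exact: ex_diff.
- by move=> z; rewrite ltr_pdivlMr// -vabsZ; exact: fM.
- exact: line_cderiv.
Qed.

(** The factor 16 is 4 from the gradient bound, 2 from using it at radius [rho / 2] about the points
    of the segment, and 2 from [mean_value_bound]. *)
Lemma lipschitz_ball m (f : 'rV[C]_m -> C) (p h : 'rV[C]_m) (rho M : R) :
  0 < rho ->
  (forall h, vabs h < rho -> differentiable f (p + h)) ->
  (forall h, vabs h < rho -> cabs (f (p + h)) <= M) ->
  vabs h < rho / 2 -> cabs (f (p + h) - f p) <= M *+ 16 / rho * vabs h.
Proof.
move=> rho0 df fM hr.
have rho2 : 0 < rho / 2 by rewrite divr_gt0.
have := @mean_value_bound (fun x => f (p + x%:C *: h)) 0 1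
  (M *+ 4 / (rho / 2) * vabs h) ler01.
rewrite scale0r addr0 scale1r subr0 mulr1.
have -> : M *+ 4 / (rho / 2) * vabs h *+ 2 = M *+ 16 / rho * vabs h.
  rewrite -mulr_natr -[M *+ 4]mulr_natr -[M *+ 16]mulr_natr invfM invrK.
  rewrite (natrM _ 2 8) (natrM _ 2 4) (natrM _ 2 2); ring.
apply=> t /andP[t0 t1].
have thr : vabs (t%:C *: h) < rho / 2.
  apply: le_lt_trans hr; rewrite vabsZ cabs_real ger0_norm//.
  by rewrite ler_piMl ?vabs_ge0.
have sub h' : vabs h' < rho / 2 -> vabs (t%:C *: h + h') < rho.
  move=> h'r; apply: le_lt_trans (vabsD _ _) _.
  by apply: lt_le_trans (ltrD thr h'r) _; rewrite -splitr.
have thr' : vabs (t%:C *: h) < rho by rewrite -[_ *: _]addr0 sub ?vabs0.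
have [c fc] := differentiable_gradient (df _ thr').
exists (hdot c h); first exact: line_rderiv.
apply: (gradient_bound _ rho2 _ _ fc) => h' h'r; rewrite -addrA.
  by apply: df; exact: sub.
by apply: fM; exact: sub.
Qed.

Lemma cauchy_cplx (u : nat -> C) :
  (forall e : R, 0 < e -> exists N, forall n m, (N <= n)%N -> (N <= m)%N ->
    cabs (u n - u m) <= e) ->
  exists l, forall e : R, 0 < e -> exists N, forall n, (N <= n)%N -> cabs (u n - l) <= e.
Proof.
move=> H.
have cvr (v : nat -> R) : (forall n m, `|v n - v m| <= cabs (u n - u m)) ->
    exists l, forall e : R, 0 < e -> exists N, forall n, (N <= n)%N -> `|v n - l| <= e.
  move=> vu; have cv : cvg (v @ \oo).
    apply/cauchy_cvgP/cauchy_exP => e e0.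
    have e2 : 0 < e / 2 by rewrite divr_gt0.
    have [N HN] := H _ e2; exists (v N); exists N => // n /= nN.
    rewrite -ball_normE /=; apply: le_lt_trans (vu _ _) _.
    apply: le_lt_trans (HN N n (leqnn _) nN) _.
    by rewrite ltr_pdivrMr// ltr_pMr// ltr1n.
  exists (lim (v @ \oo)) => e e0; have /cvgrPdist_le/(_ e e0) [N _ HN] := cv.
  by exists N => n nN; rewrite distrC; apply: HN.
have [|a Ha] := cvr (fun n => complex.Re (u n)).
  by move=> n m; rewrite -ReN -ReD; exact: Re_le_cabs.
have [|b Hb] := cvr (fun n => complex.Im (u n)).
  by move=> n m; rewrite -ImN -ImD; exact: Im_le_cabs.
exists (a +i* b) => e e0; have e2 : 0 < e / 2 by rewrite divr_gt0.
have [N1 H1] := Ha _ e2; have [N2 H2] := Hb _ e2.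
exists (maxn N1 N2) => n; rewrite geq_max => /andP[n1 n2].
apply: le_trans (cabs_le_ReIm _) _; rewrite ReD ReN ImD ImN /= [leRHS]splitr.
by rewrite lerD ?H1 ?H2.
Qed.

(** Cauchy's estimate for [F n - F k] makes the gradients at [p] a Cauchy sequence and the Lipschitz
    constants of these differences small. The linear approximation of one [F N] therefore carries
    over to [G]. *)
Theorem weierstrass_differentiable m (F : nat -> 'rV[C]_m -> C)
    (G : 'rV[C]_m -> C) (p : 'rV[C]_m) (rho : R) : 0 < rho ->
  (forall n h, vabs h < rho -> differentiable (F n) (p + h)) ->
  (forall e : R, 0 < e -> exists N, forall n, (N <= n)%N ->
     forall h, vabs h < rho -> cabs (F n (p + h) - G (p + h)) <= e) ->
  differentiable G p.
Proof.
move=> rho0 dF uF.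
have p0 (h : 'rV[C]_m) : h = 0 -> vabs h < rho by move=> ->; rewrite vabs0.
have [c Hc] : {c : nat -> 'rV[C]_m & forall n, has_gradient (F n) p (c n)}.
  apply: (choice (P := fun n c => has_gradient (F n) p c)) => n.
  by apply: differentiable_gradient; rewrite -[p]addr0; apply: dF; exact: p0.
have uFF e : 0 < e -> exists N, forall n k, (N <= n)%N -> (N <= k)%N ->
     forall h, vabs h < rho -> cabs (F n (p + h) - F k (p + h)) <= e.
  move=> e0; have e2 : 0 < e / 2 by rewrite divr_gt0.
  have [N HN] := uF _ e2; exists N => n k nN kN h hr.
  have -> : F n (p + h) - F k (p + h) =
    (F n (p + h) - G (p + h)) - (F k (p + h) - G (p + h)) by ring.
  by apply: le_trans (cabsB _ _) _; rewrite [leRHS]splitr lerD// HN.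
have dFF n k h : vabs h < rho -> differentiable (fun s => F n s - F k s) (p + h).
  by move=> hr; apply: differentiableB; exact: dF.
have gFF n k : has_gradient (fun s => F n s - F k s) p (c n - c k).
  move=> e e0; have e2 : 0 < e / 2 by rewrite divr_gt0.
  have [r r0 H] := Hc n _ e2; have [r' r'0 H'] := Hc k _ e2.
  exists (Num.min r r'); first by rewrite lt_min r0.
  move=> h; rewrite lt_min => /andP[hr hr'].
  rewrite -/(hdot _ _) hdotBl.
  have -> : F n (p + h) - F k (p + h) - (F n p - F k p) - (hdot (c n) h - hdot (c k) h)
    = (F n (p + h) - F n p - hdot (c n) h) - (F k (p + h) - F k p - hdot (c k) h).
    by ring.
  apply: le_trans (cabsB _ _) _; rewrite [e]splitr mulrDl lerD//.
    exact: H.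
  exact: H'.
have cc n k e : (forall h, vabs h < rho -> cabs (F n (p + h) - F k (p + h)) <= e) ->
    forall j, cabs (c n 0 j - c k 0 j) <= e *+ 4 / rho.
  move=> He j; have := gradient_bound (delta_mx 0 j) rho0 (@dFF n k) He (@gFF n k).
  by rewrite hdot_delta vabs_delta mulr1 !mxE.
have [l Hl] : {l : 'I_m -> C & forall j, forall e : R, 0 < e -> exists N, forall n,
    (N <= n)%N -> cabs (c n 0 j - l j) <= e}.
  apply: (choice (P := fun j l => forall e : R, 0 < e -> exists N, forall n,
    (N <= n)%N -> cabs (c n 0 j - l) <= e)) => j.
  apply: cauchy_cplx => e e0; have e4 : 0 < e * rho / 4 by rewrite divr_gt0// mulr_gt0.
  have [N HN] := uFF _ e4; exists N => n k nN kN.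
  apply: le_trans (cc n k _ (HN n k nN kN) j) _.
  by rewrite -mulr_natr; rewrite le_eqVlt; apply/orP; left; apply/eqP; field; rewrite gt_eqF.
apply: (@gradient_differentiable _ _ _ _ (\row_j l j)) => e e0.
(* With this choice the Lipschitz constant [e1 *+ 16 / rho] is [e / 3], and the gradients differ by
   at most [e1 *+ 4 / rho], which is [e / 12]. *)
pose e1 := e * rho / 48.
have e10 : 0 < e1 by rewrite divr_gt0// mulr_gt0.
have [N HN] := uFF _ e10.
have e3 : 0 < e / 3 by rewrite divr_gt0.
have [r r0 Hr] := Hc N _ e3.
exists (Num.min r (rho / 2)); first by rewrite lt_min r0 divr_gt0.
move=> h; rewrite lt_min -/(hdot _ _) => /andP[hr hr2].
have hrho : vabs h < rho.
  by apply: lt_trans hr2 _; rewrite ltr_pdivrMr// ltr_pMr// ltr1n.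
have B1 : cabs ((G (p + h) - F N (p + h)) - (G p - F N p)) <= e / 3 * vabs h.
  apply/ler_addgt0Pr => d d0; have d2 : 0 < d / 2 by rewrite divr_gt0.
  have [K HK] := uF _ d2; pose k := maxn K N.
  have kK : (K <= k)%N by exact: leq_maxl.
  have := lipschitz_ball rho0 (@dFF k N) (HN k N (leq_maxr _ _) (leqnn _)) hr2.
  have -> : e1 *+ 16 / rho = e / 3.
    by rewrite /e1 -mulr_natr; field; rewrite gt_eqF.
  have h1 := HK k kK h hrho; have h2 := HK k kK 0 (p0 _ erefl).
  rewrite addr0 in h2 => B.
  have -> : G (p + h) - F N (p + h) - (G p - F N p) =
    (F k (p + h) - F N (p + h) - (F k p - F N p)) -
    ((F k (p + h) - G (p + h)) - (F k p - G p)) by ring.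
  rewrite [d]splitr; apply: le_trans (cabsB _ _) _; rewrite lerD//.
  by apply: le_trans (cabsB _ _) _; rewrite lerD.
have B2 := Hr h hr; rewrite -/(hdot _ _) in B2.
have B3 : cabs (hdot (c N) h - hdot (\row_j l j) h) <= e / 3 * vabs h.
  rewrite -hdotBl; apply: cabs_hdot => j; rewrite !mxE.
  apply/ler_addgt0Pr => d d0; have [K HK] := Hl j _ d0.
  pose k := maxn K N.
  have := cc N k _ (HN N k (leqnn _) (leq_maxr _ _)) j.
  have := HK k (leq_maxl _ _).
  have -> : c N 0 j - l j = (c N 0 j - c k 0 j) + (c k 0 j - l j) by ring.
  move=> h1 h2; apply: le_trans (cabsD _ _) _; rewrite lerD//.
  apply: le_trans h2 _.
  rewrite /e1 -mulr_natr [X in X <= _](_ : _ = e / 12); last by field; rewrite gt_eqF.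
  by rewrite ler_pM2l// lef_pV2 ?posrE// ler_nat.
have -> : G (p + h) - G p - hdot (\row_j l j) h =
  (G (p + h) - F N (p + h) - (G p - F N p)) + (F N (p + h) - F N p - hdot (c N) h)
  + (hdot (c N) h - hdot (\row_j l j) h) by ring.
have -> : e * vabs h = e / 3 * vabs h + e / 3 * vabs h + e / 3 * vabs h by field.
apply: le_trans (cabsD _ _) _; apply: lerD => //.
by apply: le_trans (cabsD _ _) _; apply: lerD.
Qed.

End Weierstrass.

(** * Bernoulli polynomials and the Euler-Maclaurin expansion *)

Section Bernoulli.
Variable R : realType.

(** The product of partial sums differs from the partial sum of the Cauchy product by the
    coefficients of index N to 2N - 1 of a product of polynomials. There are N of them, each at most
    2N / 8^N; the ratio 1/8 leaves ample room for both factors N. *)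
Lemma cauchy_product (u v : nat -> R) (U V : R) :
  (forall n, `|u n| <= 8^-1 ^+ n) -> (forall n, `|v n| <= 8^-1 ^+ n) ->
  series u @ \oo --> U -> series v @ \oo --> V ->
  series (fun m => \sum_(k < m.+1) u k * v (m - k)%N) @ \oo --> U * V.
Proof.
move=> bu bv cu cv.
have q0 : 0 <= 8^-1 :> R by rewrite invr_ge0.
have bound N : `|series u N * series v N -
    series (fun m => \sum_(k < m.+1) u k * v (m - k)%N) N| <= 2 * 2^-1 ^+ N.
  pose p := \poly_(i < N) u i; pose q := \poly_(i < N) v i.
  have hp : p.[1] = series u N.
    rewrite (@horner_coef_wide _ N) ?size_poly// seriesEord; apply: eq_bigr => i _.
    by rewrite coef_poly ltn_ord expr1n mulr1.
  have hq : q.[1] = series v N.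
    rewrite (@horner_coef_wide _ N) ?size_poly// seriesEord; apply: eq_bigr => i _.
    by rewrite coef_poly ltn_ord expr1n mulr1.
  have spq : (size (p * q)%R <= N + N)%N.
    apply: leq_trans (size_polyMleq _ _) _; apply: leq_trans (leq_pred _) _.
    by rewrite leq_add ?size_poly.
  have coefs m : (m < N)%N -> (p * q)`_m = \sum_(k < m.+1) u k * v (m - k)%N.
    move=> mN; rewrite coefM; apply: eq_bigr => k _; rewrite !coef_poly.
    by rewrite (leq_trans (ltn_ord k) mN) (leq_ltn_trans (leq_subr _ _) mN).
  have coefb m : `|(p * q)`_m| <= m.+1%:R * 8^-1 ^+ m.
    rewrite coefM; apply: le_trans (ler_norm_sum _ _ _) _.
    apply: (@le_trans _ _ (\sum_(k < m.+1) 8^-1 ^+ m)); last first.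
      by rewrite sumr_const card_ord mulr_natl.
    apply: ler_sum => k _; rewrite normrM.
    rewrite -[X in _ ^+ X](@subnKC k m); last by rewrite -ltnS.
    rewrite exprD; apply: ler_pM => //; rewrite coef_poly.
      by case: ifP => _ //; rewrite normr0 exprn_ge0.
    by case: ifP => _ //; rewrite normr0 exprn_ge0.
  have -> : series u N * series v N = \sum_(0 <= m < N + N) (p * q)`_m.
    rewrite -hp -hq -hornerM (@horner_coef_wide _ (N + N)) // big_mkord.
    by apply: eq_bigr => i _; rewrite expr1n mulr1.
  rewrite (big_cat_nat (n := N)) //=; last exact: leq_addr.
  rewrite /series /= [X in _ - X](@eq_big_nat _ _ _ _ _ _ (fun m => (p * q)`_m)); last first.
    by move=> m /andP[_ mN]; rewrite coefs.
  rewrite addrAC subrr add0r; apply: le_trans (ler_norm_sum _ _ _) _.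
  apply: (@le_trans _ _ (\sum_(N <= m < N + N) (2 * 2 ^+ N) * 8^-1 ^+ N)).
    rewrite !big_nat; apply: ler_sum => m /andP[Nm mNN].
    apply: le_trans (coefb m) _; apply: ler_pM => //.
      apply: (@le_trans _ _ (2 * N%:R)).
        by rewrite -natrM ler_nat mul2n -addnn.
      by rewrite ler_pM2l// -natrX ler_nat ltnW// ltn_expl.
    by rewrite ler_wiXn2l// invf_le1// ler1n.
  rewrite sumr_const_nat addKn -[_ *+ N]mulr_natr.
  have n0 : 2 ^+ N != 0 :> R by rewrite expf_neq0.
  have -> : 8^-1 ^+ N = 2^-1 ^+ N * 2^-1 ^+ N * 2^-1 ^+ N :> R.
    by rewrite -!exprMn; congr (_ ^+ _); field.
  rewrite !exprVn.
  have -> : 2 * 2 ^+ N * ((2 ^+ N)^-1 * (2 ^+ N)^-1 * (2 ^+ N)^-1) * N%:R =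
     2 * (2 ^+ N)^-1 * ((2 ^+ N)^-1 * N%:R) :> R by field.
  rewrite ler_piMr ?mulr_ge0 ?invr_ge0 ?exprn_ge0//.
  by rewrite mulrC ler_pdivrMr ?exprn_gt0// mul1r -natrX ler_nat ltnW// ltn_expl.
have cprod : (fun N => series u N * series v N) @ \oo --> U * V by apply: cvgM.
have cdiff : (fun N => series u N * series v N -
    series (fun m => \sum_(k < m.+1) u k * v (m - k)%N) N) @ \oo --> (0 : R).
  apply/cvgr0Pnorm_le => e e0.
  have c0 : geometric (2 : R) 2^-1 @ \oo --> (0 : R).
    by apply: cvg_geometric; rewrite ger0_norm ?invr_ge0// invf_lt1// ltr1n.
  have /cvgr0Pnorm_le/(_ e e0) := c0; apply: filterS => N HN.
  apply: le_trans (bound N) _; apply: le_trans HN; exact: ler_norm.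
have -> : series (fun m => \sum_(k < m.+1) u k * v (m - k)%N) =
  (fun N => series u N * series v N - (series u N * series v N -
    series (fun m => \sum_(k < m.+1) u k * v (m - k)%N) N)).
  by apply/funext => N; rewrite opprB addrC subrK.
by rewrite -[U * V]subr0; apply: cvgB.
Qed.

(** Once the earlier coefficients vanish, [c m * x ^+ m] equals minus the tail. Boundedness of
    [c n * r ^+ n] at one [r > 0] makes the tail O(x^(m+1)), so [|c m|] is at most a constant times
    [x] for all small positive [x]. *)
Lemma power_series_zero (c : nat -> R) :
  (\forall x \near (0 : R)^', series (fun n => c n * x ^+ n) @ \oo --> (0 : R)) ->
  forall n, c n = 0.
Proof.
move=> H; elim/ltn_ind => m IH.
have [r r0 Hr] : exists2 r : R, 0 < r & forall x, 0 < x -> x <= r ->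
    series (fun n => c n * x ^+ n) @ \oo --> (0 : R).
  have [r /= r0 Hr] := (iffLR (nbhs_ballP _ _) H).
  exists (r / 2); first by rewrite divr_gt0.
  move=> x x0 xr; apply: Hr => /=; last by rewrite gt_eqF.
  rewrite -ball_normE /= sub0r normrN gtr0_norm//.
  by apply: le_lt_trans xr _; rewrite ltr_pdivrMr// ltr_pMr// ltr1n.
have [B HB] : exists B, forall n, `|c n * r ^+ n| <= B.
  have cv := cvg_series_cvg_0 (cvgP _ (Hr r r0 (lexx _))).
  have [B [_ HB]] := cvg_seq_bounded (cvgP _ cv).
  by exists (B + 1) => n; apply: HB => //; rewrite ltrDl.
have B0 : 0 <= B by apply: le_trans (HB 0%N).
have key x : 0 < x -> x <= r / 2 -> `|c m| <= B * 2 / r ^+ m.+1 * x.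
  move=> x0 xr.
  have xr' : x <= r.
    by apply: le_trans xr _; rewrite ler_pdivrMr// ler_pMr// ler1n.
  set t := x / r.
  have t0 : 0 <= t by rewrite divr_ge0// ltW.
  have t2 : t <= 2^-1 by rewrite ler_pdivrMr// mulrC.
  have xtr : x = t * r by rewrite divfK// gt_eqF.
  have part N : (m < N)%N ->
     `|series (fun n => c n * x ^+ n) N - c m * x ^+ m| <= B * t ^+ m.+1 * 2.
    move=> mN; rewrite /series /= (big_cat_nat (n := m)) ?(ltnW mN)//=.
    rewrite big_nat big1 ?add0r; last by move=> i /andP[_ im]; rewrite IH ?mul0r.
    rewrite big_ltn// (addrC (c m * _)) addrK.
    apply: le_trans (ler_norm_sum _ _ _) _.
    apply: (@le_trans _ _ (\sum_(m.+1 <= i < N) B * t ^+ m.+1 * (2^-1 ^+ (i - m.+1)))).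
      rewrite !big_nat; apply: ler_sum => i /andP[mi _].
      rewrite {1}xtr exprMn mulrCA normrM mulrC (ger0_norm (exprn_ge0 _ t0)).
      rewrite -mulrA; apply: ler_pM; rewrite ?exprn_ge0//.
      rewrite -{1}(subnKC mi) exprD ler_wpM2l ?exprn_ge0//.
      by rewrite lerXn2r ?nnegrE// invr_ge0.
    rewrite -mulr_sumr ler_wpM2l ?mulr_ge0 ?exprn_ge0//.
    rewrite -{1}[m.+1]add0n big_addn big_mkord.
    rewrite (eq_bigr (fun i : 'I_(N - m.+1) => 2^-1 ^+ i)); last first.
      by move=> i _; rewrite addnK.
    have h := @subrX1 R 2^-1 (N - m.+1).
    have e : \sum_(i < N - m.+1) 2^-1 ^+ i = 2 - 2^-1 ^+ (N - m.+1) * 2 :> R.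
      have : \sum_(i < N - m.+1) 2^-1 ^+ i = (2^-1 ^+ (N - m.+1) - 1) / (2^-1 - 1) :> R.
        by rewrite h mulrC mulKf//; lra.
      by move=> ->; field; lra.
    by rewrite e gerBl mulr_ge0 ?exprn_ge0 ?invr_ge0.
  have le1 : `|c m * x ^+ m| <= B * t ^+ m.+1 * 2.
    apply/ler_addgt0Pr => e e0.
    have /cvgrPdist_le/(_ e e0)[N _ HN] := Hr x x0 xr'.
    pose k := maxn N m.+1.
    have := HN k (leq_maxl _ _); have := part k (leq_maxr _ _).
    rewrite sub0r normrN => h1 h2.
    have -> : c m * x ^+ m = series (fun n => c n * x ^+ n) k -
      (series (fun n => c n * x ^+ n) k - c m * x ^+ m) by rewrite opprB addrC subrK.
    by rewrite [leRHS]addrC; apply: le_trans (ler_normB _ _) _; rewrite lerD.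
  move: le1; rewrite normrM (gtr0_norm (exprn_gt0 _ x0)) -ler_pdivlMr ?exprn_gt0//.
  move=> /le_trans; apply; rewrite /t expr_div_n exprS le_eqVlt; apply/orP; left.
  by apply/eqP; field; rewrite !gt_eqF ?exprn_gt0.
apply/eqP; rewrite -normr_eq0; apply/negPn/negP => cn0.
have cp : 0 < `|c m| by rewrite lt_def cn0 normr_ge0.
move: key; set L := B * 2 / r ^+ m.+1 => key.
have L0 : 0 <= L by rewrite divr_ge0 ?mulr_ge0 ?exprn_ge0// ltW.
have L1 : 0 < L + 1 by rewrite ltr_wpDl.
have y0 : 0 < `|c m| / (L + 1) / 2 by rewrite !divr_gt0.
have := key (Num.min (r / 2) (`|c m| / (L + 1) / 2)).
rewrite lt_min y0 divr_gt0// ge_min lexx => /(_ isT isT).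
have h : L * Num.min (r / 2) (`|c m| / (L + 1) / 2) <= (L + 1) * (`|c m| / (L + 1) / 2).
  by apply: ler_pM; rewrite ?lerDl// ?ge_min ?lexx ?orbT// le_min !divr_ge0 ?ltW.
move=> /le_trans/(_ h); rewrite mulrA [(L + 1) * _]mulrC divfK ?gt_eqF//.
by rewrite leNgt ltr_pdivrMr// ltr_pMr// ltr1n.
Qed.

(** The system is triangular with diagonal 1. Each value depends on all earlier ones, so [gl m]
    carries the list of the first [m] values. *)
Lemma triangular_solution (w : nat -> R) : exists g : nat -> R,
  forall m, \sum_(k < m.+1) g k / (m.+1 - k)`!%:R = w m.
Proof.
pose gl := fix gl m := if m is m'.+1 then
  rcons (gl m') (w m' - \sum_(k < m') (gl m')`_k / (m'.+1 - k)`!%:R) else [::].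
have sgl m : size (gl m) = m by elim: m => //= m IH; rewrite size_rcons IH.
have stable m k : (k < m)%N -> (gl m)`_k = (gl k.+1)`_k.
  elim: m => // m IH; rewrite ltnS leq_eqVlt => /orP[/eqP-> //|km].
  by rewrite [LHS]/= nth_rcons sgl km IH.
exists (fun k => (gl k.+1)`_k) => m.
rewrite big_ord_recr /= nth_rcons sgl ltnn eqxx subSnn divr1.
rewrite [X in X + _ = _](_ : _ = \sum_(k < m) (gl m)`_k / (m.+1 - k)`!%:R).
  by rewrite addrC subrK.
by apply: eq_bigr => k _; rewrite [in RHS]stable.
Qed.

Lemma fact_ge_expn2 j : (2 ^ j <= j.+1`!)%N.
Proof.
elim: j => // j IH; rewrite expnS factS leq_mul//.
Qed.

(** Geometric growth gives a positive radius of convergence. As (j+1)! >= 2^j and D >= 2, the k-th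
    term of the recursion is at most D^m / 4^(m-k); these sum to at most D^m / 3, and [a ^+ m / m!]
    takes the other half of the bound. *)
Lemma bernoulli_coeff_bound (a D : R) (g : nat -> R) : 2 <= D -> `|a| *+ 2 <= D ->
  (forall m, \sum_(k < m.+1) g k / (m.+1 - k)`!%:R = a ^+ m / m`!%:R) ->
  forall m, `|g m| <= D ^+ m.
Proof.
move=> D2 aD Hg; elim/ltn_ind => m IH.
have D0 : 0 < D by apply: lt_le_trans D2.
have := Hg m; rewrite big_ord_recr /= subSnn divr1 => E.
have -> : g m = a ^+ m / m`!%:R - \sum_(k < m) g k / (m.+1 - k)`!%:R.
  by rewrite -E addrAC subrr add0r.
case: m IH E => [|m] IH E; first by rewrite big_ord0 subr0 !expr0 fact0 divr1 normr1.
apply: le_trans (ler_normB _ _) _.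
have B1 : `|a ^+ m.+1 / m.+1`!%:R| <= D ^+ m.+1 / 2.
  rewrite normrM normfV normrX (normr_nat _ (m.+1)`!).
  apply: (@le_trans _ _ (`|a| ^+ m.+1)).
    by rewrite ler_pdivrMr ?ltr0n ?fact_gt0// ler_peMr ?exprn_ge0// ler1n fact_gt0.
  apply: (@le_trans _ _ ((D / 2) ^+ m.+1)).
    have aD2 : `|a| <= D / 2 by rewrite ler_pdivlMr// mulr_natr.
    by rewrite lerXn2r ?nnegrE// divr_ge0// ltW.
  rewrite expr_div_n ler_wpM2l ?exprn_ge0 ?(ltW D0)// lef_pV2 ?posrE ?exprn_gt0//.
  by rewrite exprS ler_peMr// exprn_ege1// ler1n.
have B2 : `|\sum_(k < m.+1) g k / (m.+2 - k)`!%:R| <= D ^+ m.+1 / 2.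
  apply: le_trans (ler_norm_sum _ _ _) _.
  apply: (@le_trans _ _ (\sum_(k < m.+1) D ^+ m.+1 * 4^-1 ^+ (m.+1 - k))).
    apply: ler_sum => k _; rewrite normrM normfV normr_nat.
    have km : (k <= m.+1)%N by rewrite ltnW.
    rewrite -[X in D ^+ X](subnKC km) exprD -mulrA; apply: ler_pM => //.
      exact: IH.
    rewrite subSn// -exprMn.
    apply: (@le_trans _ _ (2^-1 ^+ (m.+1 - k))); last first.
      rewrite lerXn2r ?nnegrE ?mulr_ge0 ?invr_ge0// ?(ltW D0)//.
      by rewrite ler_pdivlMr//; move: D2; clear; lra.
    rewrite exprVn lef_pV2 ?posrE ?exprn_gt0 ?ltr0n ?fact_gt0//.
    by rewrite -natrX ler_nat fact_ge_expn2.
  rewrite -mulr_sumr ler_wpM2l ?exprn_ge0 ?(ltW D0)//.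
  rewrite (reindex_inj rev_ord_inj) /=.
  rewrite (eq_bigr (fun k : 'I_m.+1 => 4^-1 * 4^-1 ^+ k)); last first.
    by move=> k _; rewrite subKn -?exprS// ltnW.
  rewrite -mulr_sumr.
  have -> : \sum_(k < m.+1) 4^-1 ^+ k = (4^-1 ^+ m.+1 - 1) / (4^-1 - 1) :> R.
    by rewrite subrX1 mulrC mulKf//; lra.
  have : 0 <= 4^-1 ^+ m.+1 :> R by rewrite exprn_ge0.
  move: (_ ^+ m.+1) => q q0.
  have -> : (q - 1) / (4^-1 - 1) = (1 - q) * (4 / 3) by field; lra.
  by move: q0; clear; lra.
by rewrite [leRHS]splitr lerD.
Qed.

Lemma bernoulli_gen (a : R) (g : nat -> R) :
  (forall m, \sum_(k < m.+1) g k / (m.+1 - k)`!%:R = a ^+ m / m`!%:R) ->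
  \forall x \near (0 : R)^', series (fun n => g n * x ^+ n) n @[n --> \oo] -->
    x * expR (a * x) / (expR x - 1).
Proof.
move=> Hg; pose D := `|a| *+ 2 + 2.
have D2 : 2 <= D by rewrite lerDr mulrn_wge0.
have aD : `|a| *+ 2 <= D by rewrite lerDl.
have bg := bernoulli_coeff_bound D2 aD Hg.
have D0 : 0 < D by apply: lt_le_trans D2.
(* For [x] below this radius both [g n * x ^+ n] and the terms of the exponential series satisfy the
   bound 8^(-n) of [cauchy_product]. *)
have r0 : 0 < (8 * D)^-1 by rewrite invr_gt0 mulr_gt0.
near=> x.
have x0 : x != 0 by near: x; exact: nbhs_dnbhs_neq.
have xr : `|x| < (8 * D)^-1 by near: x; apply: dnbhs0_lt.
have xD : D * `|x| <= 8^-1.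
  by rewrite mulrC -ler_pdivlMr// -invfM ltW.
have x8 : `|x| <= 8^-1.
  by apply: le_trans xD; rewrite ler_peMl// (le_trans _ D2)// ler1n.
pose u n := g n * x ^+ n; pose v n := if n is 0 then 0 else exp_coeff x n.
have bu n : `|u n| <= 8^-1 ^+ n.
  rewrite normrM normrX; apply: (@le_trans _ _ (D ^+ n * `|x| ^+ n)).
    by rewrite ler_wpM2r ?exprn_ge0.
  by rewrite -exprMn lerXn2r ?nnegrE ?mulr_ge0 ?invr_ge0// ltW.
have bv n : `|v n| <= 8^-1 ^+ n.
  case: n => [|n]; first by rewrite normr0.
  rewrite /v /exp_coeff /= normrM normfV normrX normr_nat.
  rewrite ler_pdivrMr ?ltr0n ?fact_gt0//.
  apply: (@le_trans _ _ (8^-1 ^+ n.+1)); first by rewrite lerXn2r ?nnegrE ?invr_ge0.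
  by rewrite ler_peMr ?exprn_ge0 ?invr_ge0// ler1n fact_gt0.
have cu : cvgn (series u).
  apply: normed_cvg; apply: (@series_le_cvg _ _ (geometric 1 8^-1)) => //.
  - by move=> n; exact: normr_ge0.
  - by move=> n; rewrite /= mul1r exprn_ge0// invr_ge0.
  - by move=> n; rewrite /= mul1r.
  - by apply: is_cvg_geometric_series; rewrite ger0_norm ?invr_ge0// invf_lt1// ltr1n.
have cv : series v @ \oo --> expR x - 1.
  have cE : series (exp_coeff x) @ \oo --> expR x by exact: is_cvg_series_exp_coeff.
  have : (fun n => series (exp_coeff x) n - 1) @ \oo --> expR x - 1.
    by apply: cvgB => //; exact: cvg_cst.
  apply: cvg_trans; apply: near_eq_cvg; near=> n.
  have n0 : (0 < n)%N by near: n; exact: nbhs_infty_gt.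
  rewrite /series /= big_ltn// [in RHS]big_ltn// /v /exp_coeff /= expr0 fact0 divr1.
  rewrite (addrC 1) addrK add0r; apply: eq_big_nat => -[|i] //.
have cw := cauchy_product bu bv cu cv.
have cW : series (fun m => \sum_(k < m.+1) u k * v (m - k)%N) @ \oo -->
    x * expR (a * x).
  rewrite -(cvg_shiftS (series _)).
  have -> : (fun n => series (fun m => \sum_(k < m.+1) u k * v (m - k)%N) n.+1) =
      (fun n => x * series (exp_coeff (a * x)) n).
    apply/funext => n; rewrite /series /= big_nat_recl// big_ord_recl big_ord0 /v /= mulr0 !add0r.
    rewrite mulr_sumr; apply: eq_bigr => m _.
    rewrite big_ord_recr /= subnn mulr0 addr0 /exp_coeff /= exprMn.
    rewrite (_ : x * _ = (a ^+ m / m`!%:R) * x ^+ m.+1); last by rewrite exprS; ring.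
    rewrite -Hg mulr_suml; apply: eq_bigr => k _.
    have km : (k <= m)%N by rewrite -ltnS.
    rewrite subSn// /u -subSn//.
    rewrite (_ : x ^+ m.+1 = x ^+ k * x ^+ (m.+1 - k)); first by ring.
    by rewrite -exprD subnKC// leqW.
  by apply: cvgM; [exact: cvg_cst|exact: is_cvg_series_exp_coeff].
have E : limn (series u) * (expR x - 1) = x * expR (a * x).
  exact: cvg_unique cw cW.
have ex1 : expR x - 1 != 0.
  by rewrite subr_eq0 -expR0; apply: contra_neq x0 => /expR_inj.
by rewrite -E mulfK.
Unshelve. all: by end_near. Qed.

(** This compares coefficients of x^(m+1) in (sum of B_k(a) x^k / k!) (e^x - 1) = x e^(ax). As
    [bernoulli] is a choice, a sequence with the right generating function is produced first and
    then identified with it by uniqueness of power series. Later arguments use no other property of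
    [bernoulli]. *)
Lemma bernoulli_sum (a : R) m :
  \sum_(k < m.+1) bernoulli a k / (k`!%:R * (m.+1 - k)`!%:R) = a ^+ m / m`!%:R.
Proof.
have [g Hg] := triangular_solution (fun m => a ^+ m / m`!%:R).
have Hgen := bernoulli_gen Hg.
have Hb : \forall x \near (0 : R)^',
    series (fun n => bernoulli a n * x ^+ n / n`!%:R) n @[n --> \oo] -->
    x * expR (a * x) / (expR x - 1).
  apply: (@getPex _ (fun b : nat -> R => \forall x \near (0 : R)^',
    series (fun n => b n * x ^+ n / n`!%:R) n @[n --> \oo] -->
    x * expR (a * x) / (expR x - 1))).
  exists (fun n => g n * n`!%:R); apply: filterS Hgen => x.
  suff -> : (fun n => g n * n`!%:R * x ^+ n / n`!%:R) = (fun n => g n * x ^+ n) by [].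
  apply/funext => n; have fn0 : n`!%:R != 0 :> R by rewrite pnatr_eq0 -lt0n fact_gt0.
  by rewrite mulrAC mulfK.
have bg n : bernoulli a n / n`!%:R - g n = 0.
  apply: (power_series_zero (c := fun n => bernoulli a n / n`!%:R - g n)).
  apply: filterS2 Hb Hgen => x h1 h2.
  have -> : series (fun n => (bernoulli a n / n`!%:R - g n) * x ^+ n) =
    (fun n => series (fun n => bernoulli a n * x ^+ n / n`!%:R) n -
       series (fun n => g n * x ^+ n) n).
    apply/funext => N; rewrite /series /= -sumrB; apply: eq_bigr => i _.
    by rewrite mulrBl mulrAC.
  by rewrite -(subrr (x * expR (a * x) / (expR x - 1))); apply: cvgB.
rewrite -Hg; apply: eq_bigr => k _.
by rewrite -(subr0_eq (bg k)) invfM mulrA.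
Qed.

End Bernoulli.

(** * Complex powers, the binomial series and the Euler-Maclaurin coefficients *)

Section ComplexPowers.
Variable R : realType.
Local Notation C := (cplx R).
Implicit Types (x y : R) (z w : C).

Lemma cpowD x z w : cpow x (z + w) = cpow x z * cpow x w.
Proof. by rewrite /cpow mulrDl cexpD. Qed.

Lemma cpowN x z : cpow x (- z) = (cpow x z)^-1.
Proof. by rewrite /cpow mulNr cexpN. Qed.

Lemma cpow_neq0 x z : cpow x z != 0.
Proof. exact: cexp_neq0. Qed.

Lemma cpowM x y z : 0 < x -> 0 < y -> cpow (x * y) z = cpow x z * cpow y z.
Proof. by move=> x0 y0; rewrite /cpow lnM ?posrE// rmorphD mulrDr cexpD. Qed.

Lemma cpow1z z : cpow 1 z = 1.
Proof. by rewrite /cpow ln1 mulr0 cexp0. Qed.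

Lemma cpowz0 x : cpow x 0 = 1 :> C.
Proof. by rewrite /cpow mul0r cexp0. Qed.

Lemma cpowz1 x : 0 < x -> cpow x 1 = x%:C :> C.
Proof. by move=> x0; rewrite /cpow mul1r cexp_real lnK. Qed.

Lemma cpow_nat x n : 0 < x -> cpow x n%:R = x%:C ^+ n :> C.
Proof.
move=> x0; elim: n => [|n IH]; first by rewrite cpowz0.
by rewrite -natr1 cpowD IH cpowz1// exprSr.
Qed.

Lemma cabs_cpow x z : cabs (cpow x z) = expR (complex.Re z * ln x).
Proof. by rewrite /cpow cabs_cexp ReM /= mulr0 subr0. Qed.

Lemma differentiable_cpow x z : differentiable (cpow x) z.
Proof.
apply: (@differentiable_comp _ _ _ _ (fun z => z * (ln x)%:C) (@cexp R)).
  by apply: differentiableM; [exact: ex_diff|exact: differentiable_cst].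
exact: differentiable_cexp.
Qed.

Lemma has_rderivD (f g : R -> C) t d d' : has_rderiv f t d -> has_rderiv g t d' ->
  has_rderiv (fun x => f x + g x) t (d + d').
Proof.
move=> fd gd e e0; have e2 : 0 < e / 2 by rewrite divr_gt0.
have [r r0 H] := fd _ e2; have [r' r'0 H'] := gd _ e2.
exists (Num.min r r'); first by rewrite lt_min r0.
move=> h; rewrite lt_min => /andP[hr hr'].
have -> : f (t + h) + g (t + h) - (f t + g t) - h%:C * (d + d') =
  (f (t + h) - f t - h%:C * d) + (g (t + h) - g t - h%:C * d') by ring.
apply: le_trans (cabsD _ _) _; rewrite [e]splitr mulrDl lerD//.
  exact: H.
exact: H'.
Qed.

Lemma has_rderiv_cst (c : C) t : has_rderiv (fun=> c) t 0.
Proof.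
move=> e e0; exists 1 => // h _; rewrite subrr sub0r mulr0 oppr0 cabs0.
by rewrite mulr_ge0// ltW.
Qed.

Lemma has_rderiv_sum (n : nat) (f : 'I_n -> R -> C) t (d : 'I_n -> C) :
  (forall i, has_rderiv (f i) t (d i)) ->
  has_rderiv (fun x => \sum_i f i x) t (\sum_i d i).
Proof.
elim: n f d => [|n IH] f d H.
  have -> : (fun x => \sum_i f i x) = (fun=> 0).
    by apply/funext => x; rewrite big_ord0.
  rewrite big_ord0; exact: has_rderiv_cst.
have -> : (fun x => \sum_i f i x) =
    (fun x => f ord0 x + \sum_i f (lift ord0 i) x).
  by apply/funext => x; rewrite big_ord_recl.
by rewrite big_ord_recl; apply: has_rderivD => //; apply: IH.
Qed.

Lemma has_rderiv_real (c : C) (f : R -> R) (t d : R) : is_derive t 1 f d ->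
  has_rderiv (fun x => c * (f x)%:C) t (c * d%:C).
Proof.
move=> fd e e0; have c1 : 0 < cabs c + 1 by rewrite ltr_wpDl ?cabs_ge0.
have e'0 : 0 < e / (cabs c + 1) by rewrite divr_gt0.
have [r r0 H] := is_derive_bound fd e'0; exists r => // h hr.
have -> : c * (f (t + h))%:C - c * (f t)%:C - h%:C * (c * d%:C) =
  c * (f (t + h) - f t - d * h)%:C by rewrite !(rmorphB, rmorphM); ring.
rewrite cabsM cabs_real.
apply: (@le_trans _ _ ((cabs c + 1) * (e / (cabs c + 1) * `|h|))).
  by apply: ler_pM; rewrite ?cabs_ge0// ?lerDl// H.
by rewrite mulrA [(_ + 1) * _]mulrC divfK// gt_eqF.
Qed.

Lemma has_rderiv_cexp (f : R -> C) t d : has_rderiv f t d ->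
  has_rderiv (fun x => cexp (f x)) t (cexp (f t) * d).
Proof.
move=> fd e e0.
pose E := cabs (cexp (f t)).
have E0 : 0 < E by rewrite cabs_gt0// cexp_neq0.
have D0 : 0 < cabs d + 1 by rewrite ltr_wpDl ?cabs_ge0.
have [r1 r10 H1] := fd 1 ltr01.
have e2 : 0 < e / 2 / E by rewrite !divr_gt0.
have [r2 r20 H2] := fd _ e2.
have e3 : 0 < e / 2 / (cabs d + 1) by rewrite !divr_gt0.
have [r3 r30 H3] := @cexp_cderiv _ (f t) _ e3.
exists (Num.min (Num.min r1 r2) (r3 / (cabs d + 1))).
  by rewrite !lt_min r10 r20 divr_gt0.
move=> h; rewrite !lt_min => /andP[/andP[hr1 hr2] hr3].
pose k := f (t + h) - f t.
have fk : f (t + h) = f t + k by rewrite /k; ring.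
have kb : cabs k <= (cabs d + 1) * `|h|.
  have -> : k = (k - h%:C * d) + h%:C * d by rewrite subrK.
  apply: le_trans (cabsD _ _) _; rewrite mulrDl addrC lerD//; last exact: H1.
  by rewrite cabsM cabs_real mulrC.
have kr : cabs k < r3.
  by apply: le_lt_trans kb _; rewrite mulrC -ltr_pdivlMr.
rewrite fk.
have -> : cexp (f t + k) - cexp (f t) - h%:C * (cexp (f t) * d) =
  (cexp (f t + k) - cexp (f t) - cexp (f t) * k) + cexp (f t) * (k - h%:C * d) by ring.
apply: le_trans (cabsD _ _) _; rewrite [e]splitr mulrDl lerD//.
  apply: le_trans (H3 k kr) _.
  apply: le_trans (ler_wpM2l (ltW e3) kb) _.
  by rewrite mulrA divfK// gt_eqF.
rewrite cabsM; apply: le_trans (ler_wpM2l (ltW E0) (H2 h hr2)) _.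
by rewrite mulrA [E * _]mulrC divfK// gt_eqF.
Qed.

Definition poch w n : C := \prod_(j < n) (w + j%:R).

Lemma poch0 w : poch w 0 = 1.
Proof. by rewrite /poch big_ord0. Qed.

Lemma pochS w n : poch w n.+1 = w * poch (w + 1) n.
Proof.
rewrite /poch big_ord_recl addr0; congr (_ * _); apply: eq_bigr => j _.
by rewrite -addrA nat1r.
Qed.

Lemma pochD w n m : poch w (n + m) = poch w n * poch (w + n%:R) m.
Proof.
rewrite /poch big_split_ord /=; congr (_ * _); apply: eq_bigr => j _.
by rewrite natrD addrA.
Qed.

Lemma cabs_poch w (W : R) n : cabs w <= W ->
  cabs (poch w n) <= \prod_(j < n) (W + j%:R).
Proof.
move=> wW; rewrite /poch cabs_prod; apply: ler_prod => j _.
by rewrite cabs_ge0/=; apply: le_trans (cabsD _ _) _; rewrite cabs_nat lerD.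
Qed.

(** The remainder after [J] terms of the binomial series of (1 - v)^(-w). *)
Definition taylor_rest J w (v : R) : C :=
  cpow (1 - v) (- w) - \sum_(j < J) poch w j / j`!%:R * (v ^+ j)%:C.

Fixpoint taylor_cst J (W : R) : R :=
  if J is J'.+1 then W * taylor_cst J' (W + 1) *+ 2 else expR W.

Lemma taylor_cst_ge0 J (W : R) : 0 <= W -> 0 <= taylor_cst J W.
Proof.
elim: J W => [|J IH] W W0 /=; first exact: expR_ge0.
by rewrite mulrn_wge0// mulr_ge0// IH// addr_ge0.
Qed.

Lemma ln_1B_bound (v : R) : `|v| <= 2^-1 -> `|ln (1 - v)| <= 1.
Proof.
rewrite !ler_norml => /andP[v1 v2].
have p : 0 < 1 - v by move: v2; clear; lra.
have e1 : 2 <= expR 1 :> R by have := expR_ge1Dx (1 : R).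
apply/andP; split.
  rewrite -[leLHS]expRK ler_ln ?posrE ?expR_gt0// expRN.
  apply: (@le_trans _ _ 2^-1); first by rewrite lef_pV2 ?posrE ?expR_gt0.
  by move: v2; clear; lra.
rewrite -[leRHS]expRK ler_ln ?posrE ?expR_gt0//.
by apply: le_trans e1; move: v1; clear; lra.
Qed.

(** The derivative in [t] of the remainder of order [J.+1] for [w] at [t * v] is [w * v] times that
    of order [J] for [w + 1]; [taylor_cst] records what the mean value bound costs. The bound
    depends on [w] only through [W], as locally uniform convergence in s requires. *)
Lemma taylor_rest_bound J : forall W w (v : R), cabs w <= W -> `|v| <= 2^-1 ->
  cabs (taylor_rest J w v) <= taylor_cst J W * `|v| ^+ J.
Proof.
elim: J => [|J IH] W w v wW v2.
  rewrite /taylor_rest big_ord0 subr0 mulr1 /= cabs_cpow ler_expR.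
  apply: le_trans (ler_norm _) _; rewrite normrM ReN normrN.
  apply: le_trans wW; apply: le_trans (Re_le_cabs w).
  by rewrite ler_piMr// ln_1B_bound.
have W0 : 0 <= W by apply: le_trans wW; exact: cabs_ge0.
have w1W : cabs (w + 1) <= W + 1.
  by apply: le_trans (cabsD _ _) _; rewrite cabs1 lerD2r.
pose L := W * taylor_cst J (W + 1) * `|v| ^+ J.+1.
have := @mean_value_bound R (fun t => taylor_rest J.+1 w (t * v)) 0 1 L ler01.
rewrite mul0r mul1r.
have -> : taylor_rest J.+1 w 0 = 0.
  rewrite /taylor_rest subr0 cpow1z big_ord_recl big1 ?addr0.
    by rewrite poch0 fact0 expr0 divr1 mulr1 subrr.
  by move=> i _; rewrite expr0n /= mulr0.
rewrite subr0 subr0 mulr1 => H.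
have -> : taylor_cst J.+1 W * `|v| ^+ J.+1 = L *+ 2 by rewrite /L /= mulrnAl.
apply: H => t /andP[t0 t1].
have tv : `|t * v| <= `|v| by rewrite normrM ger0_norm// ler_piMl.
have tv2 : `|t * v| <= 2^-1 by apply: le_trans v2.
have p : 0 < 1 - t * v by have := le_trans (ler_norm _) tv2; move: (t * v) => x; clear; lra.
exists (w * v%:C * taylor_rest J (w + 1) (t * v)); last first.
  rewrite !cabsM cabs_real /L exprS -!mulrA; apply: ler_pM; rewrite ?mulr_ge0 ?cabs_ge0//.
  rewrite mulrCA ler_wpM2l//; apply: le_trans (IH (W + 1) _ _ w1W tv2) _.
  rewrite ler_wpM2l ?taylor_cst_ge0 ?addr_ge0//.
  by rewrite lerXn2r ?nnegrE.
have dln : is_derive t 1 (fun t => ln (1 - t * v)) ((1 - t * v)^-1 * (- v)).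
  have d1 : is_derive t 1 (fun t => 1 - t * v) (- v).
    apply: bound_is_derive => e e0; exists 1 => // h _.
    rewrite (_ : _ - _ - _ = 0); last by ring.
    by rewrite normr0 mulr_ge0// ltW.
  exact: (@is_derive1_comp R (@ln R) (fun t => 1 - t * v) t _ _ (is_derive1_ln p) d1).
have d1 := has_rderiv_cexp (has_rderiv_real (- w) dln).
have dX j : is_derive t 1 (fun t => (t * v) ^+ j) (v * (j%:R * (t * v) ^+ j.-1)).
  have dv : is_derive t 1 (fun t => t * v) v.
    apply: bound_is_derive => e e0; exists 1 => // h _.
    rewrite (_ : _ - _ - _ = 0); last by ring.
    by rewrite normr0 mulr_ge0// ltW.
  have := is_deriveX j dv.
  rewrite (_ : ( *%R^~ v) ^+ j = (fun t => (t * v) ^+ j)); last first.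
    by apply/funext => x; rewrite fctE.
  move=> h; apply: (is_derive_eq h).
  by rewrite -[_ *: _]/(_ * _) mulrC.
have d2 : has_rderiv (fun t => \sum_(j < J.+1) - (poch w j / j`!%:R) * ((t * v) ^+ j)%:C) t
    (\sum_(j < J.+1) - (poch w j / j`!%:R) * (v * (j%:R * (t * v) ^+ j.-1))%:C).
  by apply: has_rderiv_sum => j; apply: has_rderiv_real.
have := has_rderivD d1 d2.
rewrite (_ : (fun x => _) = (fun t => taylor_rest J.+1 w (t * v))); last first.
  apply/funext => x; rewrite /taylor_rest /cpow -sumrN; congr (_ + _).
  by apply: eq_bigr => j _; rewrite mulNr.
rewrite (_ : _ + \sum_(j < J.+1) _ = w * v%:C * taylor_rest J (w + 1) (t * v))//.
rewrite big_ord_recl /= mul0r mulr0 mulr0 add0r /taylor_rest mulrBr; congr (_ + _).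
  rewrite opprD cpowD (cpowN _ 1) cpowz1// -/(cpow _ _) rmorphM rmorphN fmorphV /=.
  by ring.
rewrite mulr_sumr -sumrN; apply: eq_bigr => j _.
have jn0 : j`!%:R != 0 :> C by rewrite pnatr_eq0 -lt0n fact_gt0.
have j1 : 1 + j%:R != 0 :> C by rewrite nat1r pnatr_eq0.
rewrite /bump /= add1n pochS factS natrM !rmorphM rmorph_nat /= add0n.
rewrite -[j.+1]add1n natrD; field.
by rewrite jn0 j1.
Qed.

Variable a : R.

(* The coefficients (s - 1) c_k(s) of the asymptotic expansion of the Hurwitz
   zeta function, written in w = s - 1. *)
Definition em_coeff w k : C := poch w k * (bernoulli a k)%:C / k`!%:R.

Definition em_main K w x : C :=
  \sum_(k < K.+1) em_coeff w k * cpow x (- (w + k%:R)).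

(** For y = n + alpha_2 and a = alpha_2 - alpha_1 the last base is n + alpha_1 and, with w = s_1 -
    1, its exponent is -s_1. This is the error of one step of the telescoping. *)
Definition em_err K w y : C :=
  em_main K w (y - 1) - em_main K w y - w * cpow (y - a) (- (w + 1)).

Definition em_cst K (W : R) : R :=
  \sum_(k < K.+1) (\prod_(j < k) (W + j%:R)) * `|bernoulli a k| / k`!%:R
      * taylor_cst (K.+2 - k) (W + K%:R)
  + W * taylor_cst K.+1 (W + 1).

Lemma bernoulli_sum_cplx m :
  \sum_(k < m.+1) (bernoulli a k)%:C / (k`!%:R * (m.+1 - k)`!%:R) =
  (a ^+ m)%:C / m`!%:R :> C.
Proof.
have := congr1 (fun x : R => x%:C : C) (bernoulli_sum a m).
rewrite rmorph_sum /= rmorphM fmorphV rmorph_nat => <-; apply: eq_bigr => k _.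
by rewrite rmorphM fmorphV rmorphM !rmorph_nat.
Qed.

(** With m = j + k the Pochhammer symbols combine to [poch w m.+1], independent of [k]. The sum over
    [k] left as coefficient of u^(m+1) is exactly the Bernoulli recursion. This is where the
    Bernoulli values are forced. *)
Lemma em_cancel K w (u : R) :
  \sum_(k < K.+1) em_coeff w k * (u ^+ k)%:C *
    (\sum_(j < (K.+1 - k)) poch (w + k%:R) j.+1 / j.+1`!%:R * (u ^+ j.+1)%:C) =
  w * u%:C * \sum_(m < K.+1) poch (w + 1) m / m`!%:R * ((a * u) ^+ m)%:C.
Proof.
pose T k m : C := (bernoulli a k)%:C / (k`!%:R * (m.+1 - k)`!%:R) *
   (poch w m.+1 * (u ^+ m.+1)%:C).
transitivity (\sum_(k < K.+1) \sum_(m < K.+1 | (k <= m)%N) T k m).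
  apply: eq_bigr => k _.
  rewrite -(big_mkord (fun m => (k <= m)%N) (T k)).
  have -> : \sum_(0 <= m < K.+1 | (k <= m)%N) T k m = \sum_(k <= m < K.+1) T k m.
    by rewrite [RHS](@big_nat_widenl _ _ _ k 0).
  rewrite -[X in \sum_(X <= _ < _) _]add0n big_addn big_mkord mulr_sumr.
  apply: eq_bigr => j _.
  rewrite /T /em_coeff -addSn addnK [(j.+1 + k)%N]addnC pochD exprD rmorphM invfM.
  by ring.
rewrite (exchange_big_dep predT)//= mulr_sumr; apply: eq_bigr => m _.
rewrite (eq_bigl (fun k : 'I_K.+1 => (k < m.+1)%N)); last first.
  by move=> k; rewrite ltnS.
have mK : (m.+1 <= K.+1)%N by [].
rewrite -(big_ord_widen _ (fun k => T k m) mK) -mulr_suml bernoulli_sum_cplx.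
by rewrite pochS exprMn exprS !rmorphM; ring.
Qed.

End ComplexPowers.

(** * Size of the Euler-Maclaurin error; comparison of powers *)

Section EulerMaclaurin.
Variable R : realType.
Local Notation C := (cplx R).
Implicit Types (x y : R) (z w : C).

Lemma em_coeff_bound (a : R) K w (W : R) k : cabs w <= W -> (k < K.+1)%N ->
  cabs (em_coeff a w k) <= (\prod_(j < k) (W + j%:R)) * `|bernoulli a k| / k`!%:R.
Proof.
move=> wW kK; rewrite /em_coeff !cabsM cabsV cabs_nat cabs_real.
rewrite ler_wpM2r ?invr_ge0// ler_wpM2r//; exact: cabs_poch.
Qed.

Lemma cpow_shift w x (v : R) n : 0 < x ->
  cpow x (- (w + n%:R)) = cpow x (- w) * (x^-1 ^+ n)%:C.
Proof.
move=> x0; rewrite opprD cpowD (cpowN _ n%:R) cpow_nat// rmorphXn /= fmorphV.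
by rewrite exprVn.
Qed.

(** All powers are written as y^(-w) times a binomial in 1/y and expanded so that each product is
    exact up to order K + 1. By [em_cancel] the polynomial parts cancel and only binomial remainders
    stay. *)
Lemma em_errE (a : R) K w y : `|a| <= 1 -> 2 <= y ->
  em_err a K w y = cpow y (- w) *
   (\sum_(k < K.+1) em_coeff a w k * (y^-1 ^+ k)%:C *
       taylor_rest (K.+2 - k) (w + k%:R) y^-1
    - w * y^-1%:C * taylor_rest K.+1 (w + 1) (a * y^-1)).
Proof.
move=> a1 y2; have y0 : 0 < y by apply: lt_le_trans y2.
have yn0 : y != 0 by rewrite gt_eqF.
set u := y^-1.
have u0 : 0 < u by rewrite invr_gt0.
have u2 : u <= 2^-1 by rewrite lef_pV2 ?posrE.
have up : 0 < 1 - u by move: u2; move: u {u0} => u; clear; lra.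
have aup : 0 < 1 - a * u.
  have : `|a * u| <= 2^-1.
    rewrite normrM (gtr0_norm u0); apply: le_trans u2.
    by rewrite ler_piMl// ltW.
  by move/(le_trans (ler_norm _)); move: (a * u) => b; clear; lra.
have yu : y - 1 = y * (1 - u) by rewrite mulrBr mulr1 divff.
have yau : y - a = y * (1 - a * u) by rewrite mulrBr mulr1 mulrCA divff// mulr1.
have cs1 : cpow y (- (w + 1)) = cpow y (- w) * u%:C.
  by rewrite opprD cpowD (cpowN _ 1) cpowz1// /u fmorphV.
rewrite /em_err /em_main -sumrB yu yau [cpow (y * (1 - a * u)) _]cpowM// cs1.
have -> : \sum_(i < K.+1) (em_coeff a w i * cpow (y * (1 - u)) (- (w + i%:R)) -
    em_coeff a w i * cpow y (- (w + i%:R))) =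
  cpow y (- w) * \sum_(k < K.+1) (em_coeff a w k * (u ^+ k)%:C *
       taylor_rest (K.+2 - k) (w + k%:R) u + em_coeff a w k * (u ^+ k)%:C *
    (\sum_(j < (K.+1 - k)) poch (w + k%:R) j.+1 / j.+1`!%:R * (u ^+ j.+1)%:C)).
  rewrite mulr_sumr; apply: eq_bigr => k _.
  have kK : (k <= K.+1)%N by rewrite ltnW.
  rewrite cpowM// cpow_shift// -/u /taylor_rest subSn// big_ord_recl poch0 fact0.
  rewrite expr0 /= divr1 mulr1.
  under [X in _ = _ * (_ * (_ - (_ + X)) + _)]eq_bigr do rewrite /bump /= add1n.
  by ring.
rewrite big_split /= em_cancel /taylor_rest.
by ring.
Qed.

(** Every term has total order K + 2 in 1/y: y^(-k) times a remainder of order K + 2 - k, or 1/y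
    times one of order K + 1. The condition [2 <= y] keeps the arguments of the remainders within
    1/2. *)
Lemma em_err_bound (a : R) K w (W y : R) : `|a| <= 1 -> cabs w <= W -> 2 <= y ->
  cabs (em_err a K w y) <= em_cst a K W * expR (- (complex.Re w + K.+2%:R) * ln y).
Proof.
move=> a1 wW y2; have y0 : 0 < y by apply: lt_le_trans y2.
rewrite em_errE// cabsM.
have u0 : 0 < y^-1 by rewrite invr_gt0.
have u2 : y^-1 <= 2^-1 by rewrite lef_pV2 ?posrE.
have -> : expR (- (complex.Re w + K.+2%:R) * ln y) = cabs (cpow y (- w)) * y^-1 ^+ K.+2.
  have -> : cabs (cpow y (- w)) * y^-1 ^+ K.+2 = cabs (cpow y (- (w + K.+2%:R))).
    by rewrite cpow_shift// cabsM cabs_real ger0_norm// exprn_ge0// ltW.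
  by rewrite cabs_cpow ReN ReD Re_nat.
rewrite mulrCA ler_wpM2l ?cabs_ge0//.
set u := y^-1 in u0 u2 *.
have nu : `|u| = u by rewrite gtr0_norm.
have W0 : 0 <= W by apply: le_trans wW; exact: cabs_ge0.
apply: le_trans (cabsB _ _) _; rewrite /em_cst mulrDl lerD//.
  apply: le_trans (cabs_sum _ _ _) _; rewrite mulr_suml; apply: ler_sum => k _.
  have kK : (k <= K.+2)%N := leqW (ltnW (ltn_ord k)).
  have -> : u ^+ K.+2 = u ^+ k * u ^+ (K.+2 - k) by rewrite -exprD subnKC.
  rewrite cabsM [cabs (em_coeff _ _ _ * _)]cabsM (cabs_real (u ^+ k)).
  rewrite (ger0_norm (exprn_ge0 _ (ltW u0))).
  set A := _ * _ / _; set T := taylor_cst _ _.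
  have -> : A * T * (u ^+ k * u ^+ (K.+2 - k)) = A * u ^+ k * (T * u ^+ (K.+2 - k)).
    by ring.
  apply: ler_pM; rewrite ?mulr_ge0 ?cabs_ge0 ?exprn_ge0 ?(ltW u0)//.
    by rewrite ler_wpM2r ?exprn_ge0 ?(ltW u0)//; exact: em_coeff_bound (ltn_ord k).
  rewrite -{2}nu; apply: taylor_rest_bound; last by rewrite nu.
  apply: le_trans (cabsD _ _) _; rewrite cabs_nat lerD// ler_nat.
  by rewrite -ltnS.
rewrite cabsM [cabs (w * _)]cabsM cabs_real nu exprS.
have -> : W * taylor_cst K.+1 (W + 1) * (u * u ^+ K.+1) =
  W * u * (taylor_cst K.+1 (W + 1) * u ^+ K.+1) by ring.
apply: ler_pM; rewrite ?cabs_ge0 ?mulr_ge0 ?cabs_ge0 ?(ltW u0)//.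
  by rewrite ler_wpM2r ?(ltW u0).
apply: (@le_trans _ _ (taylor_cst K.+1 (W + 1) * `|a * u| ^+ K.+1)).
  apply: taylor_rest_bound.
    by apply: le_trans (cabsD _ _) _; rewrite cabs1 lerD2r.
  by rewrite normrM nu; apply: le_trans u2; rewrite ler_piMl// ltW.
rewrite ler_wpM2l ?taylor_cst_ge0 ?addr_ge0//.
by rewrite lerXn2r ?nnegrE ?(ltW u0)// normrM nu ler_piMl// ltW.
Qed.

(** The real power n^(-sg), the scale against which all terms are measured. *)
Definition rp (n : nat) (sg : R) : R := expR (- sg * ln n%:R).

Lemma rp_ge0 n sg : 0 <= rp n sg.
Proof. exact: expR_ge0. Qed.

Lemma rpD n s t : rp n (s + t) = rp n s * rp n t.
Proof. by rewrite /rp -expRD -mulrDl opprD. Qed.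

Lemma rp_anti n s t : (0 < n)%N -> s <= t -> rp n t <= rp n s.
Proof.
move=> n0 st; rewrite ler_expR ler_wpM2r ?lerN2// ln_ge0// ler1n//.
Qed.

Lemma rp_mono n m s : (0 < n)%N -> (n <= m)%N -> 0 <= s -> rp m s <= rp n s.
Proof.
move=> n0 nm s0; rewrite ler_expR !mulNr lerN2 ler_wpM2l//.
by rewrite ler_ln ?posrE ?ltr0n// ?ler_nat// (leq_trans n0).
Qed.

Lemma rp_le1 n s : (0 < n)%N -> 0 <= s -> rp n s <= 1.
Proof.
by move=> n0 s0; rewrite -expR0 ler_expR mulNr oppr_le0 mulr_ge0// ln_ge0 ?ler1n.
Qed.

(** A discrete form of the comparison with the integral of x^(-1-d), from 1 + x <= e^x and ln (1 -
    1/n) <= -1/n. *)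
Lemma rp_telescope n d : 0 < d -> (1 < n)%N ->
  rp n (1 + d) <= (rp n.-1 d - rp n d) / d.
Proof.
move=> d0 n1; have n0 : (0 < n)%N by apply: ltn_trans n1.
have np0 : 0 < n%:R :> R by rewrite ltr0n.
have nm0 : 0 < n.-1%:R :> R by rewrite ltr0n -ltnS prednK.
rewrite ler_pdivlMr// addrC rpD.
have -> : rp n 1 = n%:R^-1 by rewrite /rp mulN1r expRN lnK.
rewrite lerBrDr.
have -> : rp n.-1 d = rp n d * expR (- d * (ln n.-1%:R - ln n%:R)).
  by rewrite /rp -expRD; congr expR; ring.
have -> : rp n d / n%:R * d + rp n d = rp n d * (1 + d / n%:R) by ring.
rewrite ler_wpM2l ?rp_ge0//; apply: le_trans (expR_ge1Dx _); rewrite lerD2l mulNr -mulrN.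
rewrite ler_wpM2l ?(ltW d0)// opprB.
have q0 : 0 < n.-1%:R / n%:R :> R by rewrite divr_gt0.
have := @le_ln1Dx R (n.-1%:R / n%:R - 1).
rewrite addrCA subrr addr0 ln_div ?posrE// ltrBrDl subrr => /(_ q0).
have -> : n.-1%:R / n%:R - 1 = - n%:R^-1 :> R.
  rewrite -[in X in _ / X](prednK n0) -[in X in _ / X - _]natr1.
  have -> : n%:R = n.-1%:R + 1 :> R by rewrite natr1 prednK.
  by field; rewrite natr1 pnatr_eq0.
by rewrite lerNr opprB.
Qed.

Lemma rp_cvg0 d : 0 < d -> forall e : R, 0 < e -> exists N, forall n, (N <= n)%N ->
  rp n d <= e.
Proof.
move=> d0 e e0; pose N := (Num.bound (expR (- ln e / d))).+1.
exists N => n Nn; have n0 : (0 < n)%N by apply: leq_trans Nn.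
rewrite /rp -[leRHS]lnK// ler_expR mulNr lerNl -ler_pdivrMl// mulrC.
rewrite -[leLHS]expRK ler_ln ?posrE ?expR_gt0 ?ltr0n//.
apply: ltW; apply: lt_le_trans (archi_boundP (expR_ge0 _)) _.
by rewrite ler_nat (leq_trans _ Nn).
Qed.

End EulerMaclaurin.

(** * Nested sums *)

(* The sum over N > n_1 > ... > n_r > 0 of the products of the F j (n_(j+1)). *)
Fixpoint msum (K : pzRingType) r (F : nat -> nat -> K) (N : nat) : K :=
  if r is r'.+1 then
    \sum_(1 <= n < N) F 0%N n * msum r' (fun j => F j.+1) n
  else 1.

Section MultipleSums.
Variable R : realType.
Local Notation C := (cplx R).
Implicit Types (x y B d : R) (z : C) (sg : nat -> R).

Lemma msumS (K : pzRingType) r (F : nat -> nat -> K) N :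
  msum r.+1 F N = \sum_(1 <= n < N) F 0%N n * msum r (fun j => F j.+1) n.
Proof. by []. Qed.

Lemma msum_ge0 r (F : nat -> nat -> R) N :
  (forall j n, (j < r)%N -> (0 < n)%N -> 0 <= F j n) -> 0 <= msum r F N.
Proof.
elim: r F N => [|r IH] F N F0 //=.
rewrite big_nat; apply: sumr_ge0 => n /andP[n0 _]; apply: mulr_ge0; first exact: F0.
by apply: IH => j k jr; exact: F0.
Qed.

(** Because n < N and t >= 0, the weight N^(-t) may be replaced by n^(-t) and merged with the decay
    of the outermost factor, giving the weight for the next sum. Only the accumulated exponents have
    to be nonnegative; a single [sg j] may be negative. *)
Lemma weighted_msum r (F : nat -> nat -> R) (B : R) sg t N (w : nat -> R) :
  0 <= B -> (forall n, 0 <= w n) ->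
  (forall j n, (j < r)%N -> (0 < n)%N -> 0 <= F j n <= B * (rp n (sg j) * w n)) ->
  (forall i, (i <= r)%N -> 0 <= t + \sum_(j < i) sg j) -> (0 < N)%N ->
  rp N t * msum r F N <= B ^+ r * msum r (fun _ => w) N.
Proof.
move=> B0 w0; elim: r F sg t N => [|r IH] F sg t N HF Ht N0.
  rewrite /= !mulr1 expr0 rp_le1//.
  by have := Ht 0%N isT; rewrite big_ord0 addr0.
have t0 : 0 <= t by have := Ht 0%N isT; rewrite big_ord0 addr0.
rewrite !msumS !mulr_sumr !big_nat; apply: ler_sum => n /andP[n0 nN].
have /andP[F0 FB] := HF 0%N n isT n0.
have m0 : 0 <= msum r (fun j => F j.+1) n.
  by apply: msum_ge0 => j k jr k0; have /andP[] := HF j.+1 k jr k0.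
apply: (@le_trans _ _ (rp n t * (B * (rp n (sg 0%N) * w n) * msum r (fun j => F j.+1) n))).
  by apply: ler_pM; rewrite ?rp_ge0 ?mulr_ge0// ?rp_mono ?(ltnW nN)// ler_wpM2r.
have := IH (fun j => F j.+1) (fun j => sg j.+1) (t + sg 0%N) n.
have h1 : forall j n, (j < r)%N -> (0 < n)%N ->
    0 <= F j.+1 n <= B * (rp n (sg j.+1) * w n) by move=> j k jr; exact: HF.
have h2 : forall i, (i <= r)%N -> 0 <= t + sg 0%N + \sum_(j < i) sg j.+1.
  by move=> i ir; have := Ht i.+1 ir; rewrite big_ord_recl addrA.
move=> /(_ h1 h2 n0) H.
have -> : rp n t * (B * (rp n (sg 0%N) * w n) * msum r (fun j => F j.+1) n) =
  B * w n * (rp n (t + sg 0%N) * msum r (fun j => F j.+1) n) by rewrite rpD; ring.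
have -> : B ^+ r.+1 * (w n * msum r (fun=> w) n) =
  B * w n * (B ^+ r * msum r (fun=> w) n) by rewrite exprS; ring.
by rewrite ler_wpM2l// mulr_ge0.
Qed.

Lemma msum_pow r (w : nat -> R) (W : R) N : (forall n, 0 <= w n) ->
  (forall N, \sum_(1 <= n < N) w n <= W) -> msum r (fun _ => w) N <= W ^+ r.
Proof.
move=> w0 HW; elim: r N => [|r IH] N //=.
have W0 : 0 <= W by apply: le_trans (HW 0%N); rewrite big_geq.
rewrite exprS; apply: (@le_trans _ _ ((\sum_(1 <= n < N) w n) * W ^+ r)).
  by rewrite mulr_suml; apply: ler_sum => n _; rewrite ler_wpM2l.
by rewrite ler_wpM2r ?exprn_ge0.
Qed.

Lemma cabs_msum r (F : nat -> nat -> C) N :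
  cabs (msum r F N) <= msum r (fun j n => cabs (F j n)) N.
Proof.
elim: r F N => [|r IH] F N /=; first by rewrite cabs1.
apply: le_trans (cabs_sum _ _ _) _; apply: ler_sum => n _.
by rewrite cabsM ler_wpM2l ?cabs_ge0// IH.
Qed.

Lemma eq_msum (K : pzRingType) r (F G : nat -> nat -> K) N :
  (forall j n, (j < r)%N -> (0 < n)%N -> F j n = G j n) -> msum r F N = msum r G N.
Proof.
elim: r F G N => [|r IH] F G N FG //=; rewrite !big_nat.
apply: eq_bigr => n /andP[n0 _]; rewrite FG//; congr (_ * _).
by apply: IH => j k jr; exact: FG.
Qed.

Lemma rp_sum_tail d N M : 0 < d -> (1 < N)%N ->
  \sum_(N <= n < M) rp n (1 + d) <= rp N.-1 d / d.
Proof.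
move=> d0 N1; case: (leqP N M) => [NM|MN]; last first.
  by rewrite big_geq ?(ltnW MN)// divr_ge0 ?rp_ge0// ltW.
apply: (@le_trans _ _ (\sum_(N <= n < M) (rp n.-1 d - rp n d) / d)).
  rewrite !big_nat; apply: ler_sum => n /andP[Nn _].
  by apply: rp_telescope => //; exact: leq_trans Nn.
rewrite -mulr_suml ler_wpM2r ?invr_ge0 ?(ltW d0)//.
have -> : \sum_(N <= n < M) (rp n.-1 d - rp n d) = rp N.-1 d - rp M.-1 d.
  elim: M NM => [|M IH]; first by rewrite leqn0 => /eqP N0; rewrite N0 in N1.
  rewrite leq_eqVlt => /orP[/eqP<-|NM]; first by rewrite big_geq// subrr.
  by rewrite big_nat_recr//= IH//; ring.
by rewrite gerBl rp_ge0.
Qed.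

(** An upper bound for zeta(1 + d): the first term plus the telescoped tail. *)
Definition rp_total d : R := 1 + d^-1.

Lemma rp_sum_bound d N : 0 < d -> \sum_(1 <= n < N) rp n (1 + d) <= rp_total d.
Proof.
move=> d0; have T0 : 0 <= rp_total d by rewrite addr_ge0// invr_ge0 ltW.
case: N => [|[|N]]; first by rewrite big_geq.
  by rewrite big_geq.
rewrite big_ltn// lerD//; first by rewrite rp_le1// addr_ge0// ltW.
apply: le_trans (rp_sum_tail _ d0 (isT : (1 < 2)%N)) _.
by rewrite ler_piMl ?invr_ge0 ?(ltW d0)// rp_le1// ltW.
Qed.

(* The second condition makes the nested sum converge absolutely, with tails
   bounded uniformly over all tame [F] with the same constants. *)
Definition tame r (F : nat -> nat -> C) (B d : R) (sg : nat -> R) :=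
  (forall j n, (j < r)%N -> (0 < n)%N -> cabs (F j n) <= B * rp n (sg j)) /\
  (forall i, (0 < i <= r)%N -> i%:R * (1 + d) <= \sum_(j < i) sg j).

(** Each index reserves n^(-1-d) for its own summation. By the second condition of [tame] the
    exponents left over have nonnegative accumulated sums, so the inner sum is O(N^(sg 0 - 1 - d))
    and the outermost factor still leaves a summable term. *)
Lemma tame_weighted r (F : nat -> nat -> C) B d sg N : 0 < d -> 0 <= B ->
  tame r.+1 F B d sg -> (0 < N)%N ->
  rp N (sg 0%N - (1 + d)) * msum r (fun j n => cabs (F j.+1 n)) N
    <= (B * rp_total d) ^+ r.
Proof.
move=> d0 B0 [HF Hs] N0.
apply: (@le_trans _ _ (B ^+ r * msum r (fun _ n => rp n (1 + d)) N)).
  apply: (@weighted_msum _ _ _ (fun j => sg j.+1 - (1 + d))) => //.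
  - by move=> n; exact: rp_ge0.
  - by move=> j n jr n0; rewrite cabs_ge0 -rpD subrK HF.
  - move=> i ir; have := Hs i.+1 ir; rewrite big_ord_recl sumrB sumr_const card_ord.
    by rewrite -[_ *+ i]mulr_natl -natr1 mulrDl mul1r -subr_ge0 addrACA -opprD
       [1 + d + _]addrC.
rewrite exprMn ler_wpM2l ?exprn_ge0//; apply: msum_pow => [n|M]; first exact: rp_ge0.
exact: rp_sum_bound.
Qed.

Lemma tame_tail r (F : nat -> nat -> C) B d sg N M : 0 < d -> 0 <= B ->
  tame r.+1 F B d sg -> (1 < N)%N ->
  \sum_(N <= n < M) cabs (F 0%N n) * msum r (fun j n => cabs (F j.+1 n)) n <=
  B * (B * rp_total d) ^+ r * (rp N.-1 d / d).
Proof.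
move=> d0 B0 tF N1; have W0 : 0 <= rp_total d by rewrite addr_ge0// invr_ge0 ltW.
apply: (@le_trans _ _ (\sum_(N <= n < M) B * (B * rp_total d) ^+ r * rp n (1 + d))).
  rewrite !big_nat; apply: ler_sum => n /andP[Nn _].
  have n0 : (0 < n)%N by apply: leq_trans Nn; apply: ltnW.
  have H := tame_weighted d0 B0 tF n0; case: tF => HF _.
  have m0 : 0 <= msum r (fun j n => cabs (F j.+1 n)) n.
    by apply: msum_ge0 => *; exact: cabs_ge0.
  apply: (@le_trans _ _ (B * rp n (sg 0%N) * msum r (fun j n => cabs (F j.+1 n)) n)).
    by rewrite ler_wpM2r// HF.
  rewrite -{1}(subrK (1 + d) (sg 0%N)) rpD -!mulrA ler_wpM2l//.
  by rewrite mulrCA mulrC ler_wpM2r ?rp_ge0.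
rewrite -mulr_sumr ler_wpM2l ?mulr_ge0 ?exprn_ge0 ?mulr_ge0//.
exact: rp_sum_tail.
Qed.

Definition cconv (u : nat -> C) (l : C) :=
  forall e : R, 0 < e -> exists N, forall n, (N <= n)%N -> cabs (u n - l) <= e.

Definition clim (u : nat -> C) : C := get [set l | cconv u l].

Lemma cconv_uniq u l l' : cconv u l -> cconv u l' -> l = l'.
Proof.
move=> H H'; apply/eqP; rewrite -subr_eq0; apply/negPn/negP => n0.
have c0 := cabs_gt0 n0; have c4 : 0 < cabs (l - l') / 4 by rewrite divr_gt0.
have [N HN] := H _ c4; have [N' HN'] := H' _ c4.
have := HN _ (leq_maxl N N'); have := HN' _ (leq_maxr N N').
set x := u _ => h1 h2.
have : cabs (l - l') <= cabs (l - l') / 4 + cabs (l - l') / 4.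
  rewrite {1}(_ : l - l' = (x - l') - (x - l)); last by ring.
  by apply: le_trans (cabsB _ _) _; rewrite lerD.
by move: (cabs _) c0; clear => c; lra.
Qed.

Lemma climE u l : cconv u l -> clim u = l.
Proof.
by move=> ul; apply: (@cconv_uniq u) => //; apply: (@getPex _ (fun l => cconv u l)); exists l.
Qed.

Lemma cconvD u v a b : cconv u a -> cconv v b -> cconv (fun n => u n + v n) (a + b).
Proof.
move=> ua vb e e0; have e2 : 0 < e / 2 by rewrite divr_gt0.
have [N HN] := ua _ e2; have [N' HN'] := vb _ e2.
exists (maxn N N') => n; rewrite geq_max => /andP[n1 n2].
rewrite (_ : _ - _ = (u n - a) + (v n - b)); last by ring.
by apply: le_trans (cabsD _ _) _; rewrite [e]splitr lerD ?HN ?HN'.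
Qed.

Lemma cconvZ u a c : cconv u a -> cconv (fun n => c * u n) (c * a).
Proof.
move=> ua e e0; have c1 : 0 < cabs c + 1 by rewrite ltr_wpDl ?cabs_ge0.
have e' : 0 < e / (cabs c + 1) by rewrite divr_gt0.
have [N HN] := ua _ e'; exists N => n Nn; rewrite -mulrBr cabsM.
apply: (@le_trans _ _ ((cabs c + 1) * (e / (cabs c + 1)))).
  by apply: ler_pM; rewrite ?cabs_ge0 ?lerDl ?HN.
by rewrite mulrC divfK// gt_eqF.
Qed.

Lemma cconv_sum (n : nat) (u : 'I_n -> nat -> C) (a : 'I_n -> C) :
  (forall i, cconv (u i) (a i)) -> cconv (fun N => \sum_i u i N) (\sum_i a i).
Proof.
elim: n u a => [|n IH] u a H.
  move=> e e0; exists 0%N => N _; rewrite !big_ord0 subrr cabs0; exact: ltW.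
have -> : (fun N => \sum_i u i N) = (fun N => u ord0 N + \sum_i u (lift ord0 i) N).
  by apply/funext => N; rewrite big_ord_recl.
by rewrite big_ord_recl; apply: cconvD => //; apply: IH.
Qed.

Lemma cconv_near u v a : (exists N, forall n, (N <= n)%N -> u n = v n) ->
  cconv u a -> cconv v a.
Proof.
move=> [N0 uv] ua e e0; have [N HN] := ua e e0; exists (maxn N0 N) => n.
by rewrite geq_max => /andP[n0 n1]; rewrite -uv// HN.
Qed.

Definition mlim r F := clim (msum r F).

Definition tail_bound r (B d : R) N : R := B * (B * rp_total d) ^+ r * (rp N.-1 d / d).

Lemma tail_bound_cvg0 r (B d : R) : 0 < d -> 0 <= B -> forall e : R, 0 < e ->
  exists2 N0, (1 < N0)%N & forall N, (N0 <= N)%N -> tail_bound r B d N <= e.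
Proof.
move=> d0 B0 e e0.
have W0 : 0 <= rp_total d by rewrite addr_ge0// invr_ge0 ltW.
set K := B * (B * rp_total d) ^+ r.
have K0 : 0 <= K by rewrite mulr_ge0 ?exprn_ge0 ?mulr_ge0.
have K1 : 0 < K + 1 by rewrite ltr_wpDl.
have e' : 0 < e * d / (K + 1) by rewrite divr_gt0// mulr_gt0.
have [N HN] := rp_cvg0 d0 e'; exists N.+2 => // M NM; rewrite /tail_bound -/K.
have := HN M.-1; rewrite -ltnS (ltn_predK NM) => /(_ (ltnW NM)) h.
apply: (@le_trans _ _ ((K + 1) * (e * d / (K + 1) / d))).
  apply: ler_pM; rewrite ?lerDl// ?divr_ge0 ?rp_ge0 ?(ltW d0)//.
  by rewrite ler_wpM2r ?invr_ge0 ?(ltW d0).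
by rewrite le_eqVlt; apply/orP; left; apply/eqP; field; rewrite !gt_eqF.
Qed.

Lemma msum_diff r (F : nat -> nat -> C) B d sg N M : 0 < d -> 0 <= B ->
  tame r.+1 F B d sg -> (1 < N <= M)%N ->
  cabs (msum r.+1 F M - msum r.+1 F N) <= tail_bound r B d N.
Proof.
move=> d0 B0 tF /andP[N1 NM]; rewrite !msumS.
rewrite (big_cat_nat (n := N)) ?(ltnW N1)//= addrAC subrr add0r.
apply: le_trans (cabs_sum _ _ _) _; apply: le_trans (tame_tail M d0 B0 tF N1).
apply: ler_sum => n _; rewrite cabsM ler_wpM2l ?cabs_ge0//; exact: cabs_msum.
Qed.

Lemma msum_cconv r (F : nat -> nat -> C) B d sg : 0 < d -> 0 <= B ->
  tame r F B d sg -> cconv (msum r F) (mlim r F).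
Proof.
move=> d0 B0 tF; apply: (@getPex _ (fun l => cconv (msum r F) l)).
case: r tF => [|r] tF.
  by exists 1 => e e0; exists 0%N => n _; rewrite /= subrr cabs0 ltW.
apply: cauchy_cplx => e e0; have [N0 N01 HN] := tail_bound_cvg0 r d0 B0 e0.
exists N0 => n m Nn Nm; wlog nm : n m Nn Nm / (n <= m)%N.
  move=> H; case: (leqP n m) => [nm|/ltnW mn]; first exact: H.
  by rewrite cabs_distC; exact: H.
rewrite cabs_distC; apply: le_trans (HN n Nn).
by apply: msum_diff tF _ => //; rewrite nm (leq_trans N01).
Qed.

Lemma msum_uniform r B d sg : 0 < d -> 0 <= B -> forall e : R, 0 < e ->
  exists N0, forall N, (N0 <= N)%N -> forall F, tame r F B d sg ->
    cabs (msum r F N - mlim r F) <= e.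
Proof.
move=> d0 B0 e e0; case: r => [|r].
  exists 0%N => N _ F tF; rewrite /mlim (@climE _ 1).
    by rewrite /= subrr cabs0 ltW.
  by move=> e' e'0; exists 0%N => n _; rewrite /= subrr cabs0 ltW.
have e2 : 0 < e / 2 by rewrite divr_gt0.
have [N0 N01 HN] := tail_bound_cvg0 r d0 B0 e2; exists N0 => N NN F tF.
have [M HM] := msum_cconv d0 B0 tF e2.
have NM := leq_maxr M N; set k := maxn M N in NM.
have := HM k (leq_maxl _ _) => h1.
have h2 : cabs (msum r.+1 F k - msum r.+1 F N) <= e / 2.
  by apply: le_trans (msum_diff d0 B0 tF _) (HN N NN); rewrite NM (leq_trans N01).
rewrite (_ : _ - _ = (msum r.+1 F k - mlim r.+1 F) - (msum r.+1 F k - msum r.+1 F N));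
  last by ring.
by apply: le_trans (cabsB _ _) _; rewrite [e]splitr lerD.
Qed.

Lemma differentiable_bigsum (V : normedModType C) (I : Type) (s : seq I)
    (F : I -> V -> C) (x : V) :
  (forall i, differentiable (F i) x) ->
  differentiable (fun v => \sum_(i <- s) F i v) x.
Proof.
move=> dF; elim: s => [|i s IH].
  have -> : (fun v => \sum_(i <- [::]) F i v) = cst 0.
    by apply/funext => v; rewrite big_nil.
  exact: differentiable_cst.
have -> : (fun v => \sum_(i <- i :: s) F i v) =
    F i + (fun v => \sum_(i <- s) F i v).
  by apply/funext => v; rewrite big_cons.
exact: differentiableD.
Qed.

Lemma differentiable_msum (V : normedModType C) r (F : V -> nat -> nat -> C) N (x : V) :
  (forall j n, differentiable (fun s => F s j n) x) ->
  differentiable (fun s => msum r (F s) N) x.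
Proof.
elim: r F N => [|r IH] F N dF; first exact: differentiable_cst.
apply: differentiable_bigsum => n.
apply: (@differentiableM _ _ (fun s => F s 0%N n)
  (fun s => msum r (fun j => F s j.+1) n)) => //.
by apply: (IH (fun s j => F s j.+1)).
Qed.

(** The truncated sums are finite, hence holomorphic, and the common constants [B], [d], [sg] make
    them converge uniformly on the ball. *)
Lemma differentiable_mlim m r (F : 'rV[C]_m -> nat -> nat -> C) p rho B d sg :
  0 < rho -> 0 < d -> 0 <= B ->
  (forall h, vabs h < rho -> tame r (F (p + h)) B d sg) ->
  (forall h j n, vabs h < rho -> differentiable (fun s => F s j n) (p + h)) ->
  differentiable (fun s => mlim r (F s)) p.
Proof.
move=> rho0 d0 B0 tF dF.
apply: (@weierstrass_differentiable _ _ (fun N s => msum r (F s) N) _ p rho) => //.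
  by move=> N h hr; apply: differentiable_msum => j n; exact: dF.
move=> e e0; have [N0 HN] := msum_uniform r sg d0 B0 e0.
by exists N0 => N NN h hr; apply: HN => //; exact: tF.
Qed.

End MultipleSums.

(** * Finite sets of decreasing index tuples *)

Section DecreasingTuples.

Fixpoint dec_seqs r N : seq (seq nat) :=
  if r is r'.+1 then [seq n :: t | n <- index_iota 1 N, t <- dec_seqs r' n]
  else [:: [::]].

Lemma mem_dec_seqs r N t :
  (t \in dec_seqs r N) = [&& size t == r, path gtn N t & all (ltn 0) t].
Proof.
elim: r N t => [|r IH] N t /=.
  by rewrite inE; case: t.
apply/idP/idP.
  move=> /allpairsPdep[n [u [+ + ->]]]; rewrite mem_index_iota IH => /andP[n0 nN].
  by case/and3P=> /eqP<- p a /=; rewrite eqxx nN p n0 a.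
case: t => [|n t] //= /and3P[/eqP[sr] /andP[nN p] /andP[n0 a]].
apply/allpairsPdep; exists n, t; split=> //; first by rewrite mem_index_iota n0.
by rewrite IH sr eqxx p a.
Qed.

Lemma uniq_dec_seqs r N : uniq (dec_seqs r N).
Proof.
elim: r N => [|r IH] N //=.
apply: allpairs_uniq_dep; first exact: iota_uniq.
  by move=> n _; exact: IH.
by move=> [n t] [m u] _ _ /= [-> ->].
Qed.

Lemma msum_dec_seqs (K : pzRingType) r (F : nat -> nat -> K) N :
  msum r F N = \sum_(t <- dec_seqs r N) \prod_(j < r) F j (nth 0%N t j).
Proof.
elim: r F N => [|r IH] F N /=; first by rewrite big_seq1 big_ord0.
rewrite big_allpairs_dep /=; apply: eq_bigr => n _.
rewrite IH mulr_sumr; apply: eq_bigr => t _.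
by rewrite big_ord_recl.
Qed.

Variable r : nat.

Definition dtuple_of (t : seq nat) : option (dtuple r) :=
  if insub t is Some u then insub (u : r.-tuple nat) else None.

Definition dtuples_below N : {fset dtuple r} :=
  [fset x in pmap dtuple_of (dec_seqs r N)]%fset.

Lemma mem_dtuples_below N (x : dtuple r) :
  (x \in dtuples_below N) = path gtn N (val (val x)).
Proof.
rewrite inE /= mem_pmap; apply/mapP/idP.
  move=> [t]; rewrite mem_dec_seqs => /and3P[_ p _]; rewrite /dtuple_of.
  case: insubP => // u _ ut; case: insubP => // v _ vu [->].
  by rewrite vu ut.
move=> p; exists (val (val x)).
  rewrite mem_dec_seqs size_tuple eqxx p /=.
  by case/andP: (valP x).
by rewrite /dtuple_of valK valK.
Qed.

Lemma sum_dtuples_below (K : pzRingType) (F : nat -> nat -> K) N :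
  \sum_(x <- dtuples_below N) \prod_(j < r) F j (tnth (val x) j) = msum r F N.
Proof.
rewrite msum_dec_seqs.
pose g (x : dtuple r) : seq nat := val (val x).
have pe : perm_eq (map g (dtuples_below N)) (dec_seqs r N).
  apply: uniq_perm; last 1 first.
  - move=> t; apply/mapP/idP => [[x + ->]|tN].
      rewrite mem_dtuples_below mem_dec_seqs size_tuple eqxx /= => ->.
      by case/andP: (valP x).
    have := tN; rewrite mem_dec_seqs => /and3P[st p a].
    have sa : sorted gtn (Tuple st) && all (ltn 0) (Tuple st).
      by rewrite a andbT /=; exact: path_sorted p.
    by exists (exist _ (Tuple st) sa) => //; rewrite mem_dtuples_below.
  - by rewrite map_inj_uniq ?fset_uniq// => x y /val_inj/val_inj.
  - exact: uniq_dec_seqs.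
rewrite -(perm_big _ pe) big_map; apply: eq_bigr => x _; apply: eq_bigr => j _.
by rewrite (tnth_nth 0%N).
Qed.

(** The sets [dtuples_below] are cofinal among finite sets of indices: [M] has to exceed only the
    leading entries, as the tuples decrease. *)
Lemma dtuples_below_cover (A : {fset dtuple r}) N :
  exists2 M, (N <= M)%N & (A `<=` dtuples_below M)%fset.
Proof.
pose h (x : dtuple r) := head 0%N (val (val x)).
exists (maxn N (\max_(x <- A) h x).+1); first exact: leq_maxl.
apply/fsubsetP => x xA; rewrite mem_dtuples_below.
have hx : (h x <= \max_(x <- A) h x)%N by apply: leq_bigmax_seq.
have so : sorted gtn (val (val x)) by case/andP: (valP x).
move: so hx; rewrite {1}/h; move: (val (val x)) (\max_(x <- A) h x) => v m.
case: v => [|n t] //= so hx; apply/andP; split=> //.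
by rewrite /= leq_max ltnS hx orbT.
Qed.

End DecreasingTuples.

(** * Unordered sums as limits of nested sums *)

Section ZetaSeries.
Variable R : realType.
Local Notation C := (cplx R).

Lemma big_fset_split (I : choiceType) (V : zmodType) (A B : {fset I}) (F : I -> V) :
  (A `<=` B)%fset ->
  \sum_(i <- B) F i = \sum_(i <- A) F i + \sum_(i <- B | i \notin A) F i.
Proof.
move=> AB; rewrite (bigID (mem A)) /=; congr (_ + _).
rewrite -big_filter; apply: perm_big; apply: uniq_perm; rewrite ?filter_uniq ?fset_uniq//.
by move=> i; rewrite mem_filter /=; case iA : (i \in A) => //=; rewrite (fsubsetP AB).
Qed.

Lemma tame_abs_tail r (F : nat -> nat -> C) (B d : R) sg : 0 < d -> 0 <= B ->
  tame r F B d sg -> forall e : R, 0 < e -> exists N0, forall N M, (N0 <= N)%N -> (N <= M)%N ->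
    msum r (fun j n => cabs (F j n)) M - msum r (fun j n => cabs (F j n)) N <= e.
Proof.
move=> d0 B0; case: r => [|r] tF e e0.
  by exists 0%N => N M _ _; rewrite /= subrr ltW.
have [N0 N01 HN] := tail_bound_cvg0 r d0 B0 e0; exists N0 => N M NN NM.
have N1 : (1 < N)%N := leq_trans N01 NN.
rewrite !msumS (big_cat_nat (n := N)) ?(ltnW N1)//= addrAC subrr add0r.
exact: le_trans (tame_tail M d0 B0 tF N1) (HN N NN).
Qed.

(** A finite set containing all tuples below [N] lies below some [M]; what it adds to the nested sum
    up to [N] is at most the absolute sum between [N] and [M], which is small. *)
Lemma sum_dtuples_cvg r (F : nat -> nat -> C) (B d : R) sg : 0 < d -> 0 <= B ->
  tame r F B d sg ->
  summability.sum (fun x : dtuple r => \prod_(j < r) F j (tnth (val x) j) : C) =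
    mlim r F.
Proof.
move=> d0 B0 tF; set f := fun x : dtuple r => _.
have FF := @summability.totally_filter (dtuple r).
apply: cvg_lim; first exact: norm_hausdorff.
apply/cvgrPdist_le => e' /gt0_complexE[e e0 ->].
have e2 : 0 < e / 2 by rewrite divr_gt0.
have [N1 H1] := tame_abs_tail d0 B0 tF e2.
have [N2 H2] := msum_cconv d0 B0 tF e2.
pose N := maxn N1 N2.
exists (dtuples_below r N) => // A /= NA.
have -> : summability.partial_sum f A = \sum_(i <- A) f i.
  by rewrite big_seq_fsetE.
rewrite normE lecR cabs_distC (big_fset_split f NA) sum_dtuples_below.
rewrite addrAC [e]splitr; apply: le_trans (cabsD _ _) _; apply: lerD.
  by apply: H2; exact: leq_maxr.
have [M NM AM] := dtuples_below_cover A N.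
apply: le_trans (cabs_sum _ _ _) _.
pose g (x : dtuple r) : R := cabs (f x).
have gE : g = (fun x : dtuple r => \prod_(j < r) cabs (F j (tnth (val x) j))).
  by apply/funext => x; rewrite /g /f cabs_prod.
have s1 := big_fset_split g NA; have s2 := big_fset_split g AM.
have s3 k : \sum_(x <- dtuples_below r k) g x = msum r (fun j n => cabs (F j n)) k.
  by rewrite -sum_dtuples_below; apply: eq_bigr => x _; rewrite gE.
have pos : 0 <= \sum_(i <- dtuples_below r M | i \notin A) g i.
  by apply: sumr_ge0 => i _; exact: cabs_ge0.
apply: le_trans (H1 N M (leq_maxl _ _) NM).
rewrite -!s3 s2 s1.
set S := \sum_(i <- dtuples_below r N) _; set P := \sum_(i <- dtuples_below r M | _) _.
by rewrite addrAC [S + _]addrC addrK lerDl.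
Qed.

(** Indexing by natural numbers, with value 0 past the end, allows points of different depths to be
    compared without transport. *)
Definition coord r (s : 'rV[C]_r) (j : nat) : C :=
  if insub j is Some i then s 0 i else 0.

Lemma coordE r (s : 'rV[C]_r) (j : 'I_r) : coord s j = s 0 j.
Proof. by rewrite /coord valK. Qed.

Definition zeta_factor r (alpha : seq R) (s : 'rV[C]_r) (j n : nat) : C :=
  (cpow (n%:R + alpha`_j) (coord s j))^-1.

Lemma zeta_series_mlim r (alpha : r.-tuple R) (s : 'rV[C]_r) (B d : R) sg :
  0 < d -> 0 <= B -> tame r (zeta_factor alpha s) B d sg ->
  zeta_series alpha s = mlim r (zeta_factor alpha s).
Proof.
move=> d0 B0 tF; rewrite -(sum_dtuples_cvg d0 B0 tF) /zeta_series; congr summability.sum.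
apply/funext => x; apply: eq_bigr => j _.
by rewrite /zeta_factor coordE -(tnth_nth 0 alpha).
Qed.

End ZetaSeries.

(** * Hyperplanes *)

Section AffineMaps.
Variable R : realType.
Local Notation C := (cplx R).

Definition mxabs m n (M : 'M[C]_(m, n)) : R := \sum_i \sum_j cabs (M i j).

Lemma mxabs_ge0 m n (M : 'M[C]_(m, n)) : 0 <= mxabs M.
Proof. by apply: sumr_ge0 => i _; apply: sumr_ge0 => j _; exact: cabs_ge0. Qed.

Lemma vabs_mulmx m n (h : 'rV[C]_m) (M : 'M[C]_(m, n)) :
  vabs (h *m M) <= mxabs M * vabs h.
Proof.
rewrite /vabs /mxabs exchange_big mulr_suml; apply: ler_sum => j _.
rewrite mxE; apply: le_trans (cabs_sum _ _ _) _.
rewrite mulr_suml; apply: ler_sum => i _; rewrite cabsM mulrC ler_wpM2l ?cabs_ge0//.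
exact: cabs_le_vabs.
Qed.

Lemma hdot_mulmx m n (c : 'rV[C]_n) (h : 'rV[C]_m) (M : 'M[C]_(m, n)) :
  hdot c (h *m M) = hdot (M *m c^T)^T h.
Proof.
have E k (d v : 'rV[C]_k) : hdot d v = (v *m d^T) 0 0.
  by rewrite mxE; apply: eq_bigr => j _; rewrite mxE mulrC.
by rewrite !E trmxK mulmxA.
Qed.

Lemma near_affine m n (M : 'M[C]_(m, n)) (b : 'rV[C]_n) (p : 'rV[C]_m)
    (P : set 'rV[C]_n) :
  (\forall s \near p *m M + b, P s) -> \forall s \near p, P (s *m M + b).
Proof.
move=> /near_rV[e e0 H]; apply/near_rV.
have c0 : 0 < mxabs M + 1 by rewrite ltr_wpDl ?mxabs_ge0.
exists (e / (mxabs M + 1)); first by rewrite divr_gt0.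
move=> h; rewrite ltr_pdivlMr// mulrC => he.
rewrite mulmxDl addrAC; apply: H; apply: le_lt_trans he.
apply: le_trans (vabs_mulmx _ _) _.
by rewrite ler_wpM2r ?vabs_ge0// lerDl.
Qed.

Lemma differentiable_affine m n (M : 'M[C]_(m, n)) (b : 'rV[C]_n) (p : 'rV[C]_m)
    (f : 'rV[C]_n -> C) :
  differentiable f (p *m M + b) -> differentiable (fun s => f (s *m M + b)) p.
Proof.
move=> /differentiable_gradient[c fc].
apply: (@gradient_differentiable _ _ _ _ (M *m c^T)^T) => e e0.
have c0 : 0 < mxabs M + 1 by rewrite ltr_wpDl ?mxabs_ge0.
have e'0 : 0 < e / (mxabs M + 1) by rewrite divr_gt0.
have [r r0 H] := fc _ e'0.
exists (r / (mxabs M + 1)); first by rewrite divr_gt0.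
move=> h; rewrite ltr_pdivlMr// mulrC => he.
have hM : vabs (h *m M) <= (mxabs M + 1) * vabs h.
  by apply: le_trans (vabs_mulmx _ _) _; rewrite ler_wpM2r ?vabs_ge0// lerDl.
rewrite -/(hdot _ _) -hdot_mulmx mulmxDl (addrAC (p *m M)).
apply: le_trans (H _ (le_lt_trans hM he)) _.
by rewrite mulrAC ler_pdivrMr// -mulrA ler_pM2l// mulrC.
Qed.

Lemma differentiable_coordn r (s : 'rV[C]_r) j :
  differentiable (fun s : 'rV[C]_r => coord s j) s.
Proof.
rewrite /coord; case: insubP => [i _ _|_]; last exact: differentiable_cst.
exact: differentiable_coord.
Qed.

Lemma coordD r (s t : 'rV[C]_r) j : coord (s + t) j = coord s j + coord t j.
Proof. by rewrite /coord; case: insubP => [i _ _|_]; rewrite ?mxE ?addr0. Qed.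

Lemma cabs_coord r (s : 'rV[C]_r) j : cabs (coord s j) <= vabs s.
Proof.
rewrite /coord; case: insubP => [i _ _|_]; first exact: cabs_le_vabs.
by rewrite cabs0 vabs_ge0.
Qed.

Lemma psum_coord r (s : 'rV[C]_r) i : (i <= r)%N ->
  psum i s = \sum_(j < i) coord s j.
Proof.
move=> ir; rewrite /psum (big_ord_widen r (fun j => coord s j) ir).
by apply: eq_bigr => j _; rewrite coordE.
Qed.

Lemma psumD r (s t : 'rV[C]_r) i : psum i (s + t) = psum i s + psum i t.
Proof. by rewrite /psum -big_split; apply: eq_bigr => j _; rewrite mxE. Qed.

Lemma psumZ r (z : C) (s : 'rV[C]_r) i : psum i (z *: s) = z * psum i s.
Proof. by rewrite /psum mulr_sumr; apply: eq_bigr => j _; rewrite mxE. Qed.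

Lemma cabs_psum r (s : 'rV[C]_r) i : cabs (psum i s) <= vabs s.
Proof.
apply: le_trans (cabs_sum _ _ _) _; rewrite big_mkcond; apply: ler_sum => j _.
by case: ifP => _ //; exact: cabs_ge0.
Qed.

Lemma differentiable_psum r i (s : 'rV[C]_r) :
  differentiable (fun s : 'rV[C]_r => psum i s) s.
Proof.
have -> : (fun s : 'rV[C]_r => psum i s) =
    (fun s : 'rV[C]_r => \sum_(j < r) (if (j < i)%N then s 0 j else 0)).
  by apply/funext => t; rewrite /psum big_mkcond.
apply: differentiable_bigsum => j.
by case: (j < i)%N; [exact: differentiable_coord|exact: differentiable_cst].
Qed.

Lemma differentiable_hform r i k (s : 'rV[C]_r) :
  differentiable (fun s : 'rV[C]_r => hform i k s) s.
Proof.
apply: differentiableD; last exact: differentiable_cst.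
by apply: differentiableB; [exact: differentiable_psum|exact: differentiable_cst].
Qed.

Lemma hform_eq0 r i k (s : 'rV[C]_r) : hyp i k s <-> hform i k s = 0.
Proof.
rewrite /hyp /hform /=; split=> [->|H]; first by ring.
by apply/eqP; rewrite -subr_eq0 opprB addrA addrAC H.
Qed.

(** [c = 0] gives [Udom]; [c = K.+1] is the domain on which the remainder with parameter [K]
    converges. *)
Definition above r (c : R) : set 'rV[C]_r :=
  [set s | forall i, (1 <= i <= r)%N -> i%:R - c < complex.Re (psum i s)].

Lemma above0 r (s : 'rV[C]_r) : above 0 s <-> Udom s.
Proof. by split=> H i /H; rewrite subr0. Qed.

Lemma common_lower_bound r (f : nat -> R) :
  (forall i, (1 <= i <= r)%N -> 0 < f i) ->
  exists2 g : R, 0 < g & forall i, (1 <= i <= r)%N -> g <= f i.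
Proof.
elim: r => [|r IH] H.
  by exists 1 => // i; rewrite leqn0 => /andP[+ /eqP i0]; rewrite i0.
have [|g g0 Hg] := IH.
  by move=> i /andP[i1 ir]; apply: H; rewrite i1 leqW.
exists (Num.min g (f r.+1)); first by rewrite lt_min g0 H//= leqnn.
move=> i /andP[i1]; rewrite leq_eqVlt => /orP[/eqP->|ir]; first by rewrite ge_min lexx orbT.
by rewrite ge_min Hg// i1.
Qed.

(** The gap is doubled because one [d] per index is lost in moving from [s] to a neighbour within
    distance [d]; the other remains for the convergence condition in [tame]. *)
Lemma above_gap r c (s : 'rV[C]_r) : above c s -> exists2 d : R, 0 < d &
  forall i, (1 <= i <= r)%N -> i%:R * (1 + d *+ 2) <= complex.Re (psum i s) + c.
Proof.
move=> H; have [|g g0 Hg] := @common_lower_bound r (fun i => complex.Re (psum i s) + c - i%:R).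
  by move=> i /H; rewrite subr_gt0 ltrBlDr.
case: r s H Hg => [|r] s H Hg.
  by exists 1 => // i; rewrite leqn0 => /andP[+ /eqP i0]; rewrite i0.
exists (g / r.+1%:R / 2); first by rewrite !divr_gt0.
move=> i ir; have := Hg i ir; rewrite lerBrDl; apply: le_trans.
rewrite -[_ / 2 *+ 2]mulr_natr divfK// mulrDr mulr1 lerD2l.
rewrite mulrCA ler_piMr ?(ltW g0)// ler_pdivrMr// mul1r ler_nat.
by case/andP: ir.
Qed.

Lemma near_above r c (s : 'rV[C]_r) : above c s -> \forall s' \near s, above c s'.
Proof.
move=> H; have [|g g0 Hg] := @common_lower_bound r (fun i => complex.Re (psum i s) + c - i%:R).
  by move=> i /H; rewrite subr_gt0 ltrBlDr.
apply/near_rV; exists g => // h hg i ir; have := Hg i ir.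
rewrite psumD ReD => gi.
have : `|complex.Re (psum i h)| < g.
  by apply: le_lt_trans (Re_le_cabs _) _; apply: le_lt_trans (cabs_psum _ _) _.
by rewrite ltr_norml => /andP[h1 _]; move: gi h1;
  move: (complex.Re _) (complex.Re _) => x y; clear; lra.
Qed.

Definition poles r B : seq (nat * nat) :=
  [seq h <- [seq (i, k) | i <- iota 1 r, k <- iota 0 B] | polar r h.1 h.2].

Lemma polar_le r i k : polar r i k -> (1 <= i <= r)%N.
Proof.
by rewrite /polar => /orP[/and3P[/eqP-> _ ->]|/andP[i2 ->]] //; rewrite (ltnW i2).
Qed.

Lemma mem_poles r B i k : ((i, k) \in poles r B) = polar r i k && (k < B)%N.
Proof.
rewrite mem_filter /=; case p : (polar r i k) => //=.
have /andP[i1 ir] := polar_le p.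
apply/allpairsP/idP => [[[x y]] /= [_ + [_ ->]]|kB]; first by rewrite mem_iota.
by exists (i, k); rewrite /= !mem_iota i1 add1n ltnS ir.
Qed.

Lemma uniq_poles r B : uniq (poles r B).
Proof.
by apply: filter_uniq; apply: allpairs_uniq; rewrite ?iota_uniq// => -[? ?] [? ?] _ _ /= [-> ->].
Qed.

Definition pole_prod r B (s : 'rV[C]_r) : C := \prod_(h <- poles r B) hform h.1 h.2 s.

Lemma differentiable_pole_prod r B (s : 'rV[C]_r) : differentiable (@pole_prod r B) s.
Proof. by apply: differentiable_prod => h; exact: differentiable_hform. Qed.

Lemma pole_prod_polar r B (s : 'rV[C]_r) : pole_prod B s = 0 -> @polar_locus R r s.
Proof.
move=> /eqP; rewrite prodf_seq_eq0 => /hasP[[i k] + /= /eqP/hform_eq0 H].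
by rewrite mem_poles => /andP[p _]; exists i, k.
Qed.

(** Local finiteness: a point of H_(i,k) within distance 1 of [p] has k = i - Re (s_1 + ... + s_i),
    at most r + [vabs p] + 1. *)
Lemma polar_pole_prod r (p : 'rV[C]_r) : exists B0, forall B, (B0 <= B)%N ->
  forall h, vabs h < 1 -> @polar_locus R r (p + h) -> pole_prod B (p + h) = 0.
Proof.
exists (Num.bound (r%:R + vabs p + 1)) => B B0 h h1 [i [k [pik H]]].
have kB : (k < B)%N.
  apply: leq_trans B0; rewrite -(ltr_nat R).
  apply: le_lt_trans (archi_boundP _); last by rewrite !addr_ge0 ?vabs_ge0.
  have /andP[_ ir] := polar_le pik.
  have -> : k%:R = i%:R - complex.Re (psum i (p + h)).
    by rewrite H ReD ReN !Re_nat; ring.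
  rewrite -addrA lerD ?ler_nat//; apply: le_trans (ler_norm _) _; rewrite normrN.
  apply: le_trans (Re_le_cabs _) _; apply: le_trans (cabs_psum _ _) _.
  by apply: le_trans (vabsD _ _) _; rewrite lerD2l ltW.
apply/eqP; rewrite prodf_seq_eq0; apply/hasP; exists (i, k); first by rewrite mem_poles pik.
by apply/eqP/hform_eq0.
Qed.

(** Near [p] the polar locus is contained in the zero set of a single continuous function, a finite
    product of linear forms that is nonzero at [p]. *)
Lemma near_nonpolar r (p : 'rV[C]_r) : ~ polar_locus p -> \forall s \near p, ~ @polar_locus R r s.
Proof.
move=> np; have [B0 HB] := polar_pole_prod p.
have n0 : pole_prod B0 p != 0 by apply: contra_notN np => /eqP/pole_prod_polar.
have := differentiable_continuous (differentiable_pole_prod B0 p).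
move=> /cvgr_neq0/(_ n0) H1.
have H2 : \forall s \near p, @polar_locus R r s -> pole_prod B0 s = 0.
  by apply/near_rV; exists 1 => // h; exact: HB.
by apply: filterS2 H1 H2 => s /eqP s0 h /h.
Qed.

End AffineMaps.

(** * The translation formula *)

Section Translation.
Variable R : realType.
Local Notation C := (cplx R).
Implicit Types (alpha : seq R) (d B : R).

(* In depth one the expansion is taken at x = 1, as if there were a last index
   n_2 = 0 with alpha_2 = 1. *)
Definition next_shift alpha : R := nth 1 alpha 1.
Definition shift_gap alpha : R := next_shift alpha - alpha`_0.

(** The bound on [em_err] needs y >= 2. With n >= 1 and shifts in [0, 1) this fails only for n = 1
    in depth at least two, where the sum over n_2 < 1 is empty; the factor may then be set to 0. In
    depth one the shift is 1 and y >= 2 always. *)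
Definition err_factor r K alpha (s : 'rV[C]_r) (j n : nat) : C :=
  if j is 0 then
    if n%:R + next_shift alpha < 2 then 0
    else em_err (shift_gap alpha) K (coord s 0 - 1) (n%:R + next_shift alpha)
  else zeta_factor alpha s j n.

Definition merge_mx q : 'M[C]_(q.+1, q) := \matrix_(i, j)
  ((i == lift ord0 j)%:R + ((i == ord0) && (val j == 0%N))%:R).

Definition merge_cst q k : 'rV[C]_q := \row_j (if val j == 0%N then k%:R - 1 else 0).

(* (s_1, ..., s_r) |-> (s_1 + s_2 - 1 + k, s_3, ..., s_r). *)
Definition merge q k (s : 'rV[C]_q.+1) : 'rV[C]_q := s *m merge_mx q + merge_cst q k.

Lemma coord_merge q k (s : 'rV[C]_q.+1) j : (j < q)%N ->
  coord (merge k s) j =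
  coord s j.+1 + (if j == 0%N then coord s 0 - 1 + k%:R else 0).
Proof.
move=> jq; pose j' := Ordinal jq; rewrite -[j in LHS]/(val j') coordE !mxE.
have -> : coord s j.+1 = s 0 (lift ord0 j').
  by rewrite -coordE.
have -> : coord s 0 = s 0 ord0 by rewrite -coordE.
rewrite big_ord_recl mxE (negbTE (neq_lift ord0 j')) eqxx /= add0r.
rewrite (bigD1 j') //= mxE eqxx /= addr0 mulr1 big1; last first.
  by move=> i ij; rewrite mxE (inj_eq (@lift_inj _ _)) (negbTE ij) /= addr0 mulr0.
by case: (j == 0%N) => /=; ring.
Qed.

Lemma psum_merge q k (s : 'rV[C]_q.+1) i : (1 <= i <= q)%N ->
  psum i (merge k s) = psum i.+1 s - 1 + k%:R.
Proof.
case: i => // i /= iq; rewrite !psum_coord// [LHS]big_ord_recl.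
rewrite coord_merge ?(leq_trans _ iq)//= [in RHS]big_ord_recl.
rewrite (eq_bigr (fun j : 'I_i => coord s j.+2)); last first.
  by move=> j _; rewrite coord_merge ?addr0//= (leq_trans _ iq)// ltnS.
rewrite [in RHS]big_ord_recl /=.
rewrite [X in _ = _ + (_ + X) - _ + _](eq_bigr (fun j : 'I_i => coord s j.+2))//.
by rewrite /bump /=; ring.
Qed.

Lemma pow_shift_bound (n : nat) (x sg : R) : (0 < n)%N -> 0 <= x <= 1 ->
  expR (- sg * ln (n%:R + x)) <= expR `|sg| * rp n sg.
Proof.
move=> n0 /andP[x0 x1]; have np : 0 < n%:R :> R by rewrite ltr0n.
have n1 : 1 <= n%:R :> R by rewrite ler1n.
have l0 : ln n%:R <= ln (n%:R + x) by rewrite ler_ln ?posrE ?lerDl// ltr_pwDl.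
have l1 : ln (n%:R + x) <= ln n%:R + 1.
  have e2 : 2 <= expR 1 :> R by have := expR_ge1Dx (1 : R).
  rewrite -[X in _ <= X]expRK ler_ln ?posrE ?expR_gt0 ?ltr_pwDl//.
  rewrite expRD lnK//; apply: (@le_trans _ _ (n%:R * 2)); last by rewrite ler_pM2l.
  by rewrite mulr_natr mulr2n lerD2l (le_trans x1).
rewrite /rp -expRD ler_expR.
have -> : - sg * ln (n%:R + x) = - sg * (ln (n%:R + x) - ln n%:R) + - sg * ln n%:R by ring.
rewrite lerD2r; apply: le_trans (ler_norm _) _; rewrite normrM normrN ler_piMr//.
by rewrite ger0_norm ?subr_ge0// lerBlDl.
Qed.

Section Bounds.
Variables (alpha : seq R).
Hypothesis alphaP : forall j, 0 <= alpha`_j <= 1.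
Variable r : nat.
Implicit Types (s h : 'rV[C]_r).

Lemma zeta_factor_bound s h d j n : (0 < n)%N -> vabs h < d ->
  cabs (zeta_factor alpha (s + h) j n) <=
  expR (vabs s + d) * rp n (complex.Re (coord s j) - d).
Proof.
move=> n0 hd; rewrite /zeta_factor -cpowN cabs_cpow ReN.
apply: le_trans (pow_shift_bound _ n0 (alphaP j)) _.
rewrite coordD; apply: ler_pM; rewrite ?expR_ge0 ?rp_ge0//.
  rewrite ler_expR; apply: le_trans (Re_le_cabs _) _; apply: le_trans (cabsD _ _) _.
  by rewrite lerD ?cabs_coord// (le_trans (cabs_coord _ _))// ltW.
apply: rp_anti => //; rewrite ReD lerD2l lerNl.
apply: le_trans (ler_norm _) _; rewrite normrN; apply: le_trans (Re_le_cabs _) _.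
by rewrite (le_trans (cabs_coord _ _))// ltW.
Qed.

Lemma tame_zeta s : above 0 s -> exists2 d : R, 0 < d & forall h, vabs h < d ->
  tame r (zeta_factor alpha (s + h)) (expR (vabs s + d)) d
    (fun j => complex.Re (coord s j) - d).
Proof.
move=> /above_gap[d d0 Hd]; exists d => // h hd; split.
  by move=> j n _ n0; exact: zeta_factor_bound.
move=> i ir; have := Hd i ir; rewrite addr0 psum_coord; last by case/andP: ir.
have -> : complex.Re (\sum_(j < i) coord s j) = \sum_(j < i) complex.Re (coord s j).
  by apply: (big_morph (@complex.Re R) (@ReD R)).
rewrite sumrB sumr_const card_ord -[d *+ i]mulr_natl.
by rewrite lerBrDr -mulrDr mulr2n addrA.
Qed.

Lemma next_shiftP : 0 <= next_shift alpha <= 1.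
Proof.
rewrite /next_shift; case: alpha alphaP => [|x [|y t]] H /=; rewrite ?ler01 ?lexx//.
exact: (H 1%N).
Qed.

Lemma shift_gapP : `|shift_gap alpha| <= 1.
Proof.
have /andP[a0 a1] := alphaP 0; have /andP[b0 b1] := next_shiftP.
rewrite /shift_gap ler_norml; move: (alpha`_0) (next_shift alpha) a0 a1 b0 b1.
by clear=> x y *; lra.
Qed.

(** The first factor decays with exponent Re w + K + 2 = Re s_1 + K + 1. This gain of K + 1 enters
    every partial sum of exponents, so the whole domain of convergence moves by K + 1. *)
Lemma tame_err K s : (0 < r)%N -> above K.+1%:R s ->
  exists (d B : R) (sg : nat -> R), [/\ 0 < d, 0 <= B & forall h, vabs h < d ->
    tame r (err_factor K alpha (s + h)) B d sg].
Proof.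
move=> r0 /above_gap[d d0 Hd].
pose W : R := vabs s + d + 1.
pose sg j := complex.Re (coord s j) - d + (if j == 0%N then K.+1%:R else 0).
pose B : R := `|em_cst (shift_gap alpha) K W| + expR (vabs s + d).
have B0 : 0 <= B by rewrite addr_ge0// expR_ge0.
exists d, B, sg; split => // h hd.
have sgE i : (1 <= i <= r)%N -> i%:R * (1 + d) <= \sum_(j < i) sg j.
  move=> ir; have := Hd i ir; rewrite psum_coord; last by case/andP: ir.
  have -> : complex.Re (\sum_(j < i) coord s j) = \sum_(j < i) complex.Re (coord s j).
    by apply: (big_morph (@complex.Re R) (@ReD R)).
  rewrite big_split sumrB sumr_const card_ord -[d *+ i]mulr_natl /=.
  have -> : \sum_(j < i) (if j == 0%N :> nat then K.+1%:R else 0) = K.+1%:R :> R.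
    case: i ir => // i _; rewrite big_ord_recl /= big1 ?addr0//.
  by rewrite addrAC lerBrDr -mulrDr mulr2n addrA.
split=> // -[|j] n _ n0; last first.
  apply: le_trans (zeta_factor_bound _ _ n0 hd) _.
  by rewrite /sg /= addr0 ler_wpM2r ?rp_ge0// /B lerDr.
rewrite /err_factor; case: ltP => y2.
  by rewrite cabs0 mulr_ge0// rp_ge0.
have cs0 : cabs (coord (s + h) 0 - 1) <= W.
  apply: le_trans (cabsB _ _) _; rewrite cabs1 lerD2r coordD.
  apply: le_trans (cabsD _ _) _; rewrite lerD ?cabs_coord//.
  by rewrite (le_trans (cabs_coord _ _))// ltW.
apply: le_trans (em_err_bound K shift_gapP cs0 y2) _.
have np : 0 < n%:R :> R by rewrite ltr0n.
have /andP[ns0 ns1] := next_shiftP.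
have nl : ln n%:R <= ln (n%:R + next_shift alpha).
  by rewrite ler_ln ?posrE ?lerDl// ltr_pwDl.
have l0 : 0 <= ln n%:R :> R by rewrite ln_ge0// ler1n.
(* Nonnegativity permits replacing the base n + alpha_2 by the smaller n in the final comparison. *)
have sg0 : 0 <= sg 0%N.
  have := sgE 1%N r0; rewrite big_ord1 mul1r; apply: le_trans.
  by rewrite addr_ge0// ltW.
have e1 : sg 0%N <= complex.Re (coord (s + h) 0 - 1) + K.+2%:R.
  rewrite /sg /= coordD !ReD ReN -natr1 /=.
  have : - d <= complex.Re (coord h 0).
    rewrite lerNl; apply: le_trans (ler_norm _) _; rewrite normrN.
    apply: le_trans (Re_le_cabs _) _.
    by rewrite (le_trans (cabs_coord _ _))// ltW.
  rewrite -[K.+2%:R]natr1 -[K.+1%:R]natr1.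
  move: (complex.Re (coord h 0)) (complex.Re (coord s 0)) => x y.
  by move: (K%:R) => k; clear; lra.
have leB : em_cst (shift_gap alpha) K W <= B.
  by rewrite /B; apply: le_trans (ler_norm _) _; rewrite lerDl expR_ge0.
apply: le_trans (ler_wpM2r (expR_ge0 _) leB) _; rewrite ler_wpM2l//.
rewrite /rp ler_expR !mulNr lerN2.
apply: (@le_trans _ _ (sg 0%N * ln (n%:R + next_shift alpha))); first by rewrite ler_wpM2l.
by rewrite ler_wpM2r// (le_trans l0).
Qed.

End Bounds.

Lemma differentiable_zeta_factor r alpha (s : 'rV[C]_r) j n :
  differentiable (fun s : 'rV[C]_r => zeta_factor alpha s j n) s.
Proof.
apply: differentiableV; last exact: cpow_neq0.
apply: (@differentiable_comp _ _ _ _ (fun s : 'rV[C]_r => coord s j) (cpow (n%:R + alpha`_j))).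
  exact: differentiable_coordn.
exact: differentiable_cpow.
Qed.

Lemma differentiable_poch (V : normedModType C) (f : V -> C) (x : V) k :
  differentiable f x -> differentiable (fun v => poch (f v) k) x.
Proof.
move=> df; apply: (@differentiable_prod _ _ _ (index_enum 'I_k) (fun j v => f v + j%:R)) => j.
by apply: differentiableD => //; exact: differentiable_cst.
Qed.

Lemma differentiable_em_coeff (V : normedModType C) a (f : V -> C) (x : V) k :
  differentiable f x -> differentiable (fun v => em_coeff a (f v) k) x.
Proof.
move=> df; apply: (@differentiableM _ _ (fun v => poch (f v) k * (bernoulli a k)%:C)
  (fun=> k`!%:R^-1)); last exact: differentiable_cst.
apply: (@differentiableM _ _ (fun v => poch (f v) k) (fun=> (bernoulli a k)%:C)).
  exact: differentiable_poch.
exact: differentiable_cst.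
Qed.

Lemma differentiable_cpowN (V : normedModType C) (f : V -> C) (x : V) (y : R) (c : C) :
  differentiable f x -> differentiable (fun v => cpow y (- (f v + c))) x.
Proof.
move=> df; apply: (@differentiable_comp _ _ _ _ (fun v => - (f v + c)) (cpow y)).
  by apply: differentiableN; apply: differentiableD => //; exact: differentiable_cst.
exact: differentiable_cpow.
Qed.

Lemma differentiable_em_main (V : normedModType C) a K (f : V -> C) (x : V) (y : R) :
  differentiable f x -> differentiable (fun v => em_main a K (f v) y) x.
Proof.
move=> df; apply: (@differentiable_bigsum _ _ _ (index_enum 'I_K.+1)
  (fun k v => em_coeff a (f v) k * cpow y (- (f v + k%:R)))) => k.
apply: differentiableM; first exact: differentiable_em_coeff.
exact: differentiable_cpowN.
Qed.

Lemma differentiable_err_factor r K alpha (s : 'rV[C]_r) j n :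
  differentiable (fun s : 'rV[C]_r => err_factor K alpha s j n) s.
Proof.
case: j => [|j]; last exact: differentiable_zeta_factor.
rewrite /err_factor; case: (_ < 2); first exact: differentiable_cst.
have dw : differentiable (fun s : 'rV[C]_r => coord s 0 - 1) s.
  by apply: differentiableB; [exact: differentiable_coordn|exact: differentiable_cst].
apply: differentiableB.
  by apply: differentiableB; exact: differentiable_em_main.
exact: (differentiableM dw (differentiable_cpowN _ _ dw)).
Qed.

Lemma differentiable_remainder r K alpha (s : 'rV[C]_r) :
  (forall j, 0 <= alpha`_j <= 1) -> (0 < r)%N -> above K.+1%:R s ->
  differentiable (fun s => mlim r (err_factor K alpha s)) s.
Proof.
move=> aP r0 /(tame_err aP r0)[d [B [sg [d0 B0 H]]]].
apply: (differentiable_mlim d0 d0 B0 H) => h j n _.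
exact: differentiable_err_factor.
Qed.

Lemma abel_sum (f T : nat -> C) N :
  \sum_(1 <= n < N.+1) (f n.-1 - f n) * T n =
  f 0%N * T 1%N + \sum_(1 <= n < N.+1) f n * (T n.+1 - T n) - f N * T N.+1.
Proof.
elim: N => [|N IH]; first by rewrite !big_geq// addr0 subrr.
by rewrite big_nat_recr// [in RHS]big_nat_recr//= IH; ring.
Qed.

Lemma msum1 r (F : nat -> nat -> C) : (0 < r)%N -> msum r F 1 = 0.
Proof. by case: r => // r _; rewrite msumS big_geq. Qed.

(** [T n.+1 - T n] is the block with n_2 = n; its power of n + alpha_2 absorbs the one in [Phi n],
    which merges the first two arguments. In depth one [T] is constantly 1 and only [Phi 0] remains,
    where all powers have base 1. *)
Lemma main_translation q alpha (s : 'rV[C]_q.+1) K N : size alpha = q.+1 ->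
  let w := coord s 0 - 1 in let a := shift_gap alpha in
  let Phi n := em_main a K w (n%:R + next_shift alpha) in
  let T := msum q (fun j => zeta_factor alpha s j.+1) in
  Phi 0%N * T 1%N + \sum_(1 <= n < N.+1) Phi n * (T n.+1 - T n) =
  \sum_(k < K.+1) em_coeff a w k * msum q (zeta_factor (behead alpha) (merge k s)) N.+1.
Proof.
case: q s => [|q] s sa w a Phi T.
  rewrite mulr1 [X in _ + X]big1 ?addr0; last by move=> n _; rewrite /= subrr mulr0.
  rewrite /Phi /em_main /next_shift nth_default ?sa// add0r; apply: eq_bigr => k _.
  by rewrite cpow1z.
rewrite /T msum1// mulr0 add0r.
rewrite [RHS](eq_bigr (fun k : 'I_K.+1 => \sum_(1 <= n < N.+1) em_coeff a w k *
  (zeta_factor (behead alpha) (merge k s) 0 n *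
   msum q (fun j => zeta_factor (behead alpha) (merge k s) j.+1) n))); last first.
  by move=> k _; rewrite msumS mulr_sumr.
rewrite exchange_big /= !big_nat; apply: eq_bigr => n /andP[n0 _].
rewrite big_nat_recr//= addrAC subrr add0r /Phi /em_main mulr_suml.
apply: eq_bigr => k _; rewrite -mulrA; congr (em_coeff a w k * _).
have ns : next_shift alpha = alpha`_1.
  by rewrite /next_shift (set_nth_default 0)// sa.
have e0 : cpow (n%:R + next_shift alpha) (- (w + k%:R)) * zeta_factor alpha s 1 n =
    zeta_factor (behead alpha) (merge k s) 0 n.
  have c0 : coord (merge k s) 0 = coord s 1 + (coord s 0 - 1 + k%:R) by exact: coord_merge.
  rewrite ns /zeta_factor c0 nth_behead -!cpowN -cpowD.
  by rewrite (_ : - (w + k%:R) - coord s 1 = - (coord s 1 + (coord s 0 - 1 + k%:R)))// /w; ring.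
rewrite mulrA e0 (@eq_msum _ q _ (fun j => zeta_factor (behead alpha) (merge k s) j.+1))//.
by move=> j m jq _; rewrite /zeta_factor coord_merge// addr0 nth_behead.
Qed.

Lemma msum_translation q alpha (s : 'rV[C]_q.+1) K N : size alpha = q.+1 ->
  (forall j, 0 <= alpha`_j < 1) ->
  let a := shift_gap alpha in let w := coord s 0 - 1 in
  w * msum q.+1 (zeta_factor alpha s) N.+1 =
  \sum_(k < K.+1) em_coeff a w k * msum q (zeta_factor (behead alpha) (merge k s)) N.+1
  - msum q.+1 (err_factor K alpha s) N.+1
  - em_main a K w (N%:R + next_shift alpha) * msum q (fun j => zeta_factor alpha s j.+1) N.+1.
Proof.
move=> sa aP a w.
pose T n := msum q (fun j => zeta_factor alpha s j.+1) n.
pose Phi n := em_main a K w (n%:R + next_shift alpha).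
have aP' j : 0 <= alpha`_j <= 1 by have /andP[-> /ltW->] := aP j.
have /andP[ns0 ns1] := next_shiftP aP'.
have step n : (0 < n)%N -> w * zeta_factor alpha s 0 n * T n =
    (Phi n.-1 - Phi n) * T n - err_factor K alpha s 0 n * T n.
  move=> n0; rewrite /err_factor; case: ltP => y2.
    suff -> : T n = 0 by rewrite !mulr0 subrr.
    have n1 : n = 1%N.
      case: n n0 y2 => [|[|n]] // _ h; exfalso; move: h.
      rewrite -(addn2 n) natrD; have : 0 <= n%:R :> R by [].
      by move: (n%:R) (next_shift alpha) ns0; clear=> x y *; lra.
    rewrite n1 in y2 *; apply: msum1; apply: contraTT y2; rewrite -eqn0Ngt => /eqP q0.
    by rewrite /next_shift nth_default ?sa ?q0// ltxx.
  rewrite -mulrBl; congr (_ * _); rewrite /em_err /Phi.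
  have -> : n%:R + next_shift alpha - 1 = n.-1%:R + next_shift alpha.
    by rewrite -[in n%:R](prednK n0) -natr1; ring.
  have -> : n%:R + next_shift alpha - shift_gap alpha = n%:R + alpha`_0.
    by rewrite /shift_gap; ring.
  rewrite -/w -/a subrK cpowN /zeta_factor.
  by ring.
rewrite !msumS mulr_sumr.
rewrite (eq_big_nat _ _ (F2 := fun n => (Phi n.-1 - Phi n) * T n -
  err_factor K alpha s 0 n * T n)); last first.
  by move=> n /andP[n0 _]; rewrite mulrA step.
rewrite sumrB abel_sum -/(T N.+1) -/(Phi N).
by rewrite addrAC; congr (_ - _ - _); exact: main_translation.
Qed.

End Translation.

(** * The limit of the translation formula *)

Section Boundary.
Variable R : realType.
Local Notation C := (cplx R).
Implicit Types (alpha : seq R).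

Lemma cconv_shift (u : nat -> C) (a : C) : cconv u a -> cconv (fun N => u N.+1) a.
Proof. by move=> H e /H[N HN]; exists N => n Nn; apply: HN; exact: leqW. Qed.

Lemma cabs_em_main (a : R) K (w : C) (x : R) : 1 <= x ->
  cabs (em_main a K w x) <=
  (\sum_(k < K.+1) cabs (em_coeff a w k)) * expR (- complex.Re w * ln x).
Proof.
move=> x1; apply: le_trans (cabs_sum _ _ _) _; rewrite mulr_suml.
apply: ler_sum => k _; rewrite cabsM ler_wpM2l ?cabs_ge0// cabs_cpow ler_expR.
rewrite ler_wpM2r ?ln_ge0// ReN ReD Re_nat lerN2 lerDl //.
Qed.

Lemma pow_shift_bound_succ (n : nat) (x sg : R) : (0 < n)%N -> 0 <= x -> 0 <= sg ->
  expR (- sg * ln (n%:R + x)) <= expR sg * rp n.+1 sg.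
Proof.
move=> n0 x0 s0; have n1 : 1 <= n%:R :> R by rewrite ler1n.
have np : 0 < n%:R + x by rewrite ltr_pwDl// (lt_le_trans ltr01).
rewrite /rp -expRD ler_expR.
have : ln n.+1%:R <= ln (n%:R + x) + 1.
  have e2 : 2 <= expR 1 :> R by have := expR_ge1Dx (1 : R).
  rewrite -[X in _ <= X]expRK ler_ln ?posrE ?expR_gt0//.
  rewrite expRD lnK ?posrE//; apply: (@le_trans _ _ ((n%:R + x) * 2)); last by rewrite ler_pM2l.
  by rewrite -natr1; move: (n%:R) n1 x0; clear=> y *; lra.
by move=> /(ler_wpM2l s0); rewrite mulrDr mulr1 !mulNr;
  move: (_ * _) (sg * ln (n%:R + x)); clear=> y z; lra.
Qed.

(** The main term is O(N^(-Re w)) and, by [tame_weighted], the inner sum is O(N^(Re w - 2d)); their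
    product is O(N^(-2d)). *)
Lemma boundary_cvg0 q alpha (s : 'rV[C]_q.+1) K :
  (forall j, 0 <= alpha`_j <= 1) -> above 0 s ->
  cconv (fun N => em_main (shift_gap alpha) K (coord s 0 - 1) (N%:R + next_shift alpha) *
    msum q (fun j => zeta_factor alpha s j.+1) N.+1) 0.
Proof.
move=> aP us; have [d d0 tz] := tame_zeta aP us; have /andP[ns0 _] := next_shiftP aP.
have t0 := tz 0; rewrite vabs0 addr0 in t0; have {tz t0} t0 := t0 d0.
set B := expR (vabs s + d) in t0; set w := coord s 0 - 1; set a := shift_gap alpha.
have B0 : 0 <= B by exact: expR_ge0.
have w0 : 0 <= complex.Re w.
  have /(_ isT) := us 1%N; rewrite subr0 psum_coord// big_ord1 => /ltW.
  by rewrite /w ReD ReN (Re_nat R 1) subr_ge0.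
pose A := (\sum_(k < K.+1) cabs (em_coeff a w k)) * expR (complex.Re w).
pose E := (B * rp_total d) ^+ q.
have A0 : 0 <= A by rewrite mulr_ge0 ?expR_ge0// sumr_ge0// => k _; exact: cabs_ge0.
have E0 : 0 <= E by rewrite exprn_ge0// mulr_ge0// addr_ge0// invr_ge0 ltW.
have AE1 : 0 < A * E + 1 by rewrite ltr_wpDl// mulr_ge0.
move=> e e0; have [||N HN] := @rp_cvg0 R (d *+ 2) _ (e / (A * E + 1)).
- by rewrite mulr2n addr_gt0.
- by rewrite divr_gt0.
exists N.+1 => -[//|n] Nn; rewrite subr0 cabsM.
have xn : 1 <= n.+1%:R + next_shift alpha by rewrite -natr1 addrAC lerDr addr_ge0.
have m1 : cabs (em_main a K w (n.+1%:R + next_shift alpha)) <= A * rp n.+2 (complex.Re w).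
  apply: le_trans (cabs_em_main _ _ _ xn) _; rewrite -mulrA ler_wpM2l//.
    by apply: sumr_ge0 => k _; exact: cabs_ge0.
  exact: pow_shift_bound_succ.
have m2 := tame_weighted d0 B0 t0 (isT : (0 < n.+2)%N).
have {m2} : rp n.+2 (complex.Re w - d *+ 2) *
    cabs (msum q (fun j => zeta_factor alpha s j.+1) n.+2) <= E.
  apply: le_trans m2; apply: ler_pM; rewrite ?rp_ge0 ?cabs_ge0 ?cabs_msum//.
  rewrite (_ : complex.Re w - _ = complex.Re (coord s 0) - d - (1 + d))//.
  by rewrite /w ReD ReN (Re_nat R 1) mulr2n; ring.
set M := cabs (msum _ _ _) => m2.
have M0 : 0 <= M by exact: cabs_ge0.
apply: (@le_trans _ _ (A * E * rp n.+2 (d *+ 2))).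
  apply: le_trans (ler_wpM2r M0 m1) _.
  rewrite [in leLHS](_ : complex.Re w = d *+ 2 + (complex.Re w - d *+ 2)); last by ring.
  rewrite rpD -[leRHS]mulrA [E * _]mulrC mulrA -(mulrA _ _ M) -(mulrA A).
  by rewrite ler_wpM2l// ler_wpM2l ?rp_ge0.
apply: (@le_trans _ _ ((A * E + 1) * (e / (A * E + 1)))); last by rewrite mulrC divfK// lt0r_neq0.
have l1 : A * E <= A * E + 1 by rewrite lerDl.
have hN : rp n.+2 (d *+ 2) <= e / (A * E + 1) by apply: HN; rewrite leqW// ltnW.
exact: ler_pM (mulr_ge0 A0 E0) (rp_ge0 _ _) l1 hN.
Qed.

Lemma above_merge q k (s : 'rV[C]_q.+1) : above 0 s -> above 0 (merge k s).
Proof.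
move=> us i iq; rewrite psum_merge// !ReD ReN (Re_nat R 1) Re_nat subr0.
have := us i.+1; rewrite subr0 ltnS => /(_ _)-H; have /andP[_ iq'] := iq.
have := H iq'; rewrite -natr1; have : 0 <= k%:R :> R by [].
by move: (complex.Re _) (k%:R) (i%:R); clear=> x y z; lra.
Qed.

Lemma translation_limit q alpha (s : 'rV[C]_q.+1) K : size alpha = q.+1 ->
  (forall j, 0 <= alpha`_j < 1) -> above 0 s ->
  let a := shift_gap alpha in let w := coord s 0 - 1 in
  w * mlim q.+1 (zeta_factor alpha s) =
  \sum_(k < K.+1) em_coeff a w k * mlim q (zeta_factor (behead alpha) (merge k s))
  - mlim q.+1 (err_factor K alpha s).
Proof.
move=> sa aP us a w.
have aP' j : 0 <= alpha`_j <= 1 by have /andP[-> /ltW->] := aP j.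
have bP' j : 0 <= (behead alpha)`_j <= 1 by rewrite nth_behead.
have czeta r (be : seq R) (t : 'rV[C]_r) : (forall j, 0 <= be`_j <= 1) -> above 0 t ->
    cconv (msum r (zeta_factor be t)) (mlim r (zeta_factor be t)).
  move=> bP ut; have [d d0 tz] := tame_zeta bP ut.
  have t0 := tz 0; rewrite vabs0 addr0 in t0.
  exact: (msum_cconv d0 (expR_ge0 _) (t0 d0)).
have uK : above K.+1%:R s.
  by move=> i ir; apply: le_lt_trans (us i ir); rewrite subr0 gerBl.
have cerr : cconv (msum q.+1 (err_factor K alpha s)) (mlim q.+1 (err_factor K alpha s)).
  have [d [B [sg [d0 B0 te]]]] := @tame_err R alpha aP' q.+1 K s isT uK.
  have t0 := te 0; rewrite vabs0 addr0 in t0.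
  exact: (msum_cconv d0 B0 (t0 d0)).
have c1 := cconvZ w (cconv_shift (czeta _ _ _ aP' us)).
have c2 : cconv (fun N => \sum_(k < K.+1) em_coeff a w k *
    msum q (zeta_factor (behead alpha) (merge k s)) N.+1)
    (\sum_(k < K.+1) em_coeff a w k * mlim q (zeta_factor (behead alpha) (merge k s))).
  apply: cconv_sum => k; apply: cconvZ; apply: cconv_shift; apply: czeta => //.
  exact: above_merge.
have c3 := cconvZ (-1) (cconv_shift cerr).
have c4 := cconvZ (-1) (boundary_cvg0 K aP' us).
have := cconvD (cconvD c2 c3) c4; rewrite mulr0 addr0 mulN1r.
apply: cconv_uniq; apply: cconv_near c1; exists 0%N => N _.
by rewrite (msum_translation s K N sa aP) !mulN1r.
Qed.

End Boundary.

(** * Analytic continuation *)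

Section Uniqueness.
Variable R : realType.
Local Notation C := (cplx R).

(* Along [s + t *: u] with such slopes, t >= 0, the real parts of the partial sums
   grow and their imaginary parts move away from 0, so that a path starting off
   the polar locus never meets it. *)
Definition slope (b : bool) : C := Complex 1 (if b then 1 else -1).

Lemma escape_direction r (s : 'rV[C]_r) : exists u : 'rV[C]_r,
  forall i, (1 <= i <= r)%N -> psum i u = slope (0 <= complex.Im (psum i s)).
Proof.
(* [tau] lists the required partial sums; the coordinates of [u] are its increments. *)
pose tau i := if i == 0%N then 0 else slope (0 <= complex.Im (psum i s)).
exists (\row_j (tau j.+1 - tau j)) => i /andP[i0 ir].
rewrite psum_coord// (eq_bigr (fun j : 'I_i => tau j.+1 - tau j)); last first.
  move=> j _; have jr : (j < r)%N by apply: leq_trans ir.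
  by rewrite -[val j]/(val (Ordinal jr)) coordE mxE.
rewrite -(big_mkord xpredT (fun j => tau j.+1 - tau j)) telescope_sumr//.
by rewrite /tau (gtn_eqF i0) eqxx subr0.
Qed.

Lemma near_line r (s u : 'rV[C]_r) (z0 : C) (P : set 'rV[C]_r) :
  (\forall t \near s + z0 *: u, P t) -> \forall z \near z0, P (s + z *: u).
Proof.
move=> /near_rV[e e0 H]; apply/near_cplx.
have u1 : 0 < vabs u + 1 by rewrite ltr_wpDl ?vabs_ge0.
exists (e / (vabs u + 1)); first by rewrite divr_gt0.
move=> z; rewrite ltr_pdivlMr// => ze.
have -> : s + z *: u = s + z0 *: u + (z - z0) *: u by rewrite -addrA -scalerDl [z0 + _]addrC subrK.
apply: H; rewrite vabsZ; apply: le_lt_trans ze.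
by rewrite ler_wpM2l ?cabs_ge0// lerDl.
Qed.

Lemma differentiable_line r (F : 'rV[C]_r -> C) (s u : 'rV[C]_r) (z : C) :
  differentiable F (s + z *: u) -> differentiable (fun x : C => F (s + x *: u)) z.
Proof.
move=> /differentiable_gradient[c /(line_cderiv u) H].
apply: (@cderiv_differentiable _ _ _ (hdot c u)) => e /H[d d0 Hd]; exists d => // h /Hd.
by rewrite !add0r scale0r addr0 scalerDl addrA.
Qed.

(** Restriction to the complex line through [s] in the escape direction turns this into
    [zero_along_segment]: increasing real parts keep the segment in [above c], and its far end lies
    in [above 0]. *)
Lemma eq_on_above r (c : R) (F G : 'rV[C]_r -> C) : 0 <= c ->
  (forall s, above c s -> ~ polar_locus s -> differentiable F s) ->
  (forall s, above c s -> ~ polar_locus s -> differentiable G s) ->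
  (forall s, above 0 s -> F s = G s) ->
  forall s, above c s -> ~ polar_locus s -> F s = G s.
Proof.
move=> c0 dF dG FG s cs nps; have [u pu] := escape_direction s.
(* At this parameter the real part of each partial sum exceeds r, since it was at least
   [- vabs s]. *)
pose T : R := r%:R + vabs s + 1.
have T0 : 0 <= T by rewrite !addr_ge0 ?vabs_ge0.
pose f (z : C) := F (s + z *: u) - G (s + z *: u).
suff : f 0 = 0 by rewrite /f scale0r addr0 => /eqP; rewrite subr_eq0 => /eqP.
have Rep (t : R) i : (1 <= i <= r)%N ->
    complex.Re (psum i (s + t%:C *: u)) = complex.Re (psum i s) + t.
  move=> ir; rewrite psumD psumZ pu// ReD ReM /= mulr1 mul0r subr0 //.
have Imp (t : R) i : (1 <= i <= r)%N -> complex.Im (psum i (s + t%:C *: u)) =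
    complex.Im (psum i s) + (if 0 <= complex.Im (psum i s) then t else - t).
  move=> ir; rewrite psumD psumZ pu// ImD ImM /= mul0r addr0.
  by case: ifP => _; rewrite ?mulr1 ?mulrN1.
apply: (@zero_along_segment _ f T T0) => [t /andP[t0 tT]|].
  have ab : above c (s + t%:C *: u).
    by move=> i ir; rewrite Rep// (lt_le_trans (cs i ir))// lerDl.
  have npo : ~ polar_locus (s + t%:C *: u).
    move=> [i [k [pik H]]]; have ir := polar_le pik.
    have : complex.Im (psum i (s + t%:C *: u)) = 0.
      by rewrite H ImD ImN !Im_nat subr0.
    rewrite Imp//; case: (leP 0 (complex.Im (psum i s))) => I0 I1.
      have t00 : t = 0 by move: I0 I1 t0; move: (complex.Im _); clear=> x *; lra.
      by apply: nps; exists i, k; split => //; move: H; rewrite /hyp t00 /= scale0r addr0.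
    by move: I0 I1 t0; move: (complex.Im _); clear=> x *; lra.
  have nb : \forall s' \near s + t%:C *: u, above c s' /\ ~ polar_locus s'.
    by apply: filterS2 (near_above ab) (near_nonpolar npo).
  move/near_line: nb; apply: filterS => z [za zn].
  apply: differentiableB; apply: differentiable_line; [exact: dF|exact: dG].
have ab : above 0 (s + T%:C *: u).
  move=> i ir; rewrite Rep// subr0.
  have : `|complex.Re (psum i s)| <= vabs s.
    by apply: le_trans (Re_le_cabs _) _; exact: cabs_psum.
  rewrite ler_norml => /andP[h _]; have : i%:R <= r%:R :> R by rewrite ler_nat; case/andP: ir.
  by rewrite /T; move: h; move: (complex.Re _) (vabs s) i%:R r%:R; clear=> x y z w *; lra.
move/near_above: ab => /near_line; apply: filterS => z za.
by rewrite /f FG// subrr.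
Qed.

End Uniqueness.

(** * Simple poles, locally *)

Section SimplePoles.
Variable R : realType.
Local Notation C := (cplx R).

(** The condition of [simple_poles_on_polar_locus] at one point, isolated because the formula
    representing the function changes with the point. *)
Definition simple_at r (F : 'rV[C]_r -> C) p :=
  exists (I : seq (nat * nat)) (g : 'rV[C]_r -> C),
    [/\ uniq I, all (fun h => polar r h.1 h.2) I, holomorphic_near p g
      & \forall s \near p, ~ polar_locus s ->
          g s = (\prod_(h <- I) hform h.1 h.2 s) * F s].

(** Multiplying by the missing linear forms replaces the list of hyperplanes by a standard one; two
    functions then share a denominator and can be added. *)
Lemma simple_at_poles r (F : 'rV[C]_r -> C) p : simple_at F p ->
  exists B0, forall B, (B0 <= B)%N -> exists2 g, holomorphic_near p g
    & \forall s \near p, ~ polar_locus s -> g s = pole_prod B s * F s.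
Proof.
move=> [I [g [uI pI hg Hg]]]; exists (\max_(h <- I) h.2).+1 => B B0.
pose J := [seq h <- poles r B | h \notin I].
have pe : perm_eq (poles r B) (I ++ J).
  apply: uniq_perm; first exact: uniq_poles.
    rewrite cat_uniq uI filter_uniq ?uniq_poles// andbT.
    by apply/hasPn => h; rewrite mem_filter => /andP[].
  move=> [i k]; rewrite mem_cat [(i, k) \in J]mem_filter.
  case iI : ((i, k) \in I); last by rewrite andTb.
  rewrite mem_poles (allP pI _ iI); apply: leq_trans B0.
  by rewrite ltnS (@leq_bigmax_seq _ _ xpredT (fun h : nat * nat => h.2) _ iI).
exists (fun s => (\prod_(h <- J) hform h.1 h.2 s) * g s).
  apply: filterS hg => s dg; apply: differentiableM => //.
  by apply: differentiable_prod => h; exact: differentiable_hform.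
apply: filterS Hg => s Hg np; rewrite Hg// /pole_prod (perm_big _ pe) big_cat /=.
by rewrite mulrCA mulrA.
Qed.

Lemma simple_atD r (F G : 'rV[C]_r -> C) p : simple_at F p -> simple_at G p ->
  simple_at (fun s => F s + G s) p.
Proof.
move=> /simple_at_poles[B HB] /simple_at_poles[B' HB'].
have [f hf Hf] := HB _ (leq_maxl B B'); have [g hg Hg] := HB' _ (leq_maxr B B').
exists (poles r (maxn B B')), (fun s => f s + g s); split.
- exact: uniq_poles.
- by apply/allP => -[i k]; rewrite mem_poles => /andP[].
- by apply: filterS2 hf hg => s df dg; apply: differentiableD.
- by apply: filterS2 Hf Hg => s Hf Hg np; rewrite Hf// Hg// mulrDr.
Qed.

Lemma simple_atM r (f F : 'rV[C]_r -> C) p : holomorphic_near p f -> simple_at F p ->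
  simple_at (fun s => f s * F s) p.
Proof.
move=> hf [I [g [uI pI hg Hg]]]; exists I, (fun s => f s * g s); split => //.
  by apply: filterS2 hf hg => s df dg; apply: differentiableM.
by apply: filterS Hg => s Hg np; rewrite Hg// mulrCA.
Qed.

Lemma simple_at_near r (F G : 'rV[C]_r -> C) p :
  (\forall s \near p, ~ polar_locus s -> F s = G s) -> simple_at F p -> simple_at G p.
Proof.
move=> FG [I [g [uI pI hg Hg]]]; exists I, g; split => //.
by apply: filterS2 FG Hg => s FG Hg np; rewrite Hg// FG.
Qed.

Lemma simple_at_sum r n (F : 'I_n -> 'rV[C]_r -> C) p : (forall i, simple_at (F i) p) ->
  simple_at (fun s => \sum_i F i s) p.
Proof.
elim: n F => [|n IH] F HF.
  exists [::], (cst 0); split => //.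
    by apply: filterE => s; exact: differentiable_cst.
  by apply: filterE => s; rewrite !big_ord0 mulr0.
apply: (@simple_at_near _ (fun s => F ord0 s + \sum_i F (lift ord0 i) s)).
  by apply: filterE => s _; rewrite big_ord_recl.
by apply: simple_atD => //; exact: IH.
Qed.

Lemma simple_poles_differentiable r (F : 'rV[C]_r -> C) p :
  simple_poles_on_polar_locus F -> ~ polar_locus p -> differentiable F p.
Proof.
move=> sF np; have [I [g [_ pI hg Hg]]] := sF p.
pose h (s : 'rV[C]_r) : C := \prod_(h <- I) hform h.1 h.2 s.
have h0 s : ~ polar_locus s -> h s != 0.
  move=> nps; apply/negP; rewrite prodf_seq_eq0 => /hasP[[i k] ikI /= /eqP/hform_eq0 H].
  by apply: nps; exists i, k; split => //; exact: (allP pI _ ikI).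
apply: (@near_eq_differentiable _ _ _ (fun s => (h s)^-1 * g s)).
  apply: filterS2 Hg (near_nonpolar np) => s Hg nps.
  by rewrite Hg// mulKf// h0.
apply: differentiableM; last exact: nbhs_singleton hg.
apply: differentiableV; last exact: h0.
by apply: differentiable_prod => ?; exact: differentiable_hform.
Qed.

End SimplePoles.

Section Merge.
Variable R : realType.
Local Notation C := (cplx R).

Lemma hform_merge q k i k' (s : 'rV[C]_q.+1) : (1 <= i <= q)%N ->
  hform i k' (merge k s) = hform i.+1 (k + k') s.
Proof. by move=> iq; rewrite /hform psum_merge// -natr1 natrD; ring. Qed.

Lemma hform10 q (s : 'rV[C]_q.+1) : hform 1 0 s = coord s 0 - 1.
Proof. by rewrite /hform psum_coord// big_ord1 addr0. Qed.

Lemma polarS q i k k' : polar q i k' -> polar q.+1 i.+1 k.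
Proof. by move=> /polar_le/andP[i1 iq]; rewrite /polar !ltnS i1 iq orbT. Qed.

Lemma polar_merge q k (s : 'rV[C]_q.+1) : polar_locus (merge k s) -> polar_locus s.
Proof.
move=> [i [k' [pik /hform_eq0]]]; rewrite hform_merge ?(polar_le pik)// => /hform_eq0 H.
by exists i.+1, (k + k')%N; split => //; exact: polarS pik.
Qed.

Lemma coord0_neq1 q (s : 'rV[C]_q.+1) : ~ polar_locus s -> coord s 0 - 1 != 0.
Proof.
move=> np; apply/eqP; rewrite -hform10 => /hform_eq0 H.
by apply: np; exists 1%N, 0%N.
Qed.

Lemma differentiable_merge q k (F : 'rV[C]_q -> C) (p : 'rV[C]_q.+1) :
  differentiable F (merge k p) -> differentiable (fun s => F (merge k s)) p.
Proof. exact: differentiable_affine. Qed.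

Lemma near_merge q k (p : 'rV[C]_q.+1) (P : set 'rV[C]_q) :
  (\forall s \near merge k p, P s) -> \forall s \near p, P (merge k s).
Proof. exact: near_affine. Qed.

Lemma zeta_series_above r (alpha : r.-tuple R) (s : 'rV[C]_r) :
  (forall j, 0 <= alpha`_j <= 1) -> above 0 s ->
  zeta_series alpha s = mlim r (zeta_factor alpha s).
Proof.
move=> aP us; have [d d0 tz] := tame_zeta aP us.
have t0 := tz 0; rewrite vabs0 addr0 in t0.
exact: (zeta_series_mlim d0 (expR_ge0 _) (t0 d0)).
Qed.

(** A value of [K] for which the translation formula is valid at [s]. *)
Definition level r (s : 'rV[C]_r) : nat := Num.bound (r%:R + vabs s).

Lemma above_level r (s : 'rV[C]_r) : above (level s).+1%:R s.
Proof.
move=> i /andP[_ ir].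
have b : r%:R + vabs s < (level s)%:R by apply: archi_boundP; rewrite addr_ge0 ?vabs_ge0.
have : `|complex.Re (psum i s)| <= vabs s.
  by apply: le_trans (Re_le_cabs _) _; exact: cabs_psum.
rewrite ler_norml => /andP[h _]; have : i%:R <= r%:R :> R by rewrite ler_nat.
by rewrite -natr1; move: b h; move: (complex.Re _) (vabs s) ((level s)%:R) i%:R r%:R;
  clear=> x y z w t *; lra.
Qed.

Lemma above_mono r (c c' : R) (s : 'rV[C]_r) : c <= c' -> above c s -> above c' s.
Proof. by move=> cc H i /H; apply: le_lt_trans; rewrite lerB. Qed.

End Merge.

(** * The continuation in one more variable *)

Section Continuation.
Variables (R : realType) (q : nat) (alpha : q.+1.-tuple R).
Local Notation C := (cplx R).
Hypothesis alphaP : forall j, 0 <= alpha`_j < 1.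

Let beta : q.-tuple R := [tuple of behead alpha].

Variable Z : 'rV[C]_q -> C.
Hypothesis ZP : is_zeta_continuation beta Z.

Let a := shift_gap alpha.

Definition translate K (s : 'rV[C]_q.+1) : C :=
  \sum_(k < K.+1) em_coeff a (coord s 0 - 1) k * Z (merge k s)
  - mlim q.+1 (err_factor K alpha s).

Definition continued K (s : 'rV[C]_q.+1) : C := (coord s 0 - 1)^-1 * translate K s.

Let alphaW j : 0 <= alpha`_j <= 1.
Proof. by have /andP[-> /ltW->] := alphaP j. Qed.

Let betaW j : 0 <= beta`_j <= 1.
Proof. by rewrite nth_behead. Qed.

Let dw (s : 'rV[C]_q.+1) : differentiable (fun s : 'rV[C]_q.+1 => coord s 0 - 1) s.
Proof. by apply: differentiableB; [exact: differentiable_coordn|exact: differentiable_cst]. Qed.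

Lemma continued_series K s : above 0 s -> continued K s = zeta_series alpha s.
Proof.
move=> us; have w0 : coord s 0 - 1 != 0.
  apply/eqP => /(congr1 (@complex.Re R)); apply/eqP; rewrite gt_eqF//= ReD ReN (Re_nat R 1).
  by have := us 1%N isT; rewrite psum_coord// big_ord1 subr0 subr_gt0.
apply: (mulfI w0); rewrite mulVKf// (zeta_series_above alphaW us).
rewrite (translation_limit K (size_tuple alpha) alphaP us) /translate.
congr (_ - _); apply: eq_bigr => k _; congr (_ * _).
have um := above_merge k us.
by rewrite ZP.1 ?(zeta_series_above betaW um)//; exact/above0.
Qed.

Lemma differentiable_translate_term k s : ~ polar_locus (merge k s) ->
  differentiable (fun s => em_coeff a (coord s 0 - 1) k * Z (merge k s)) s.
Proof.
move=> np; apply: differentiableM; first exact: differentiable_em_coeff.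
by apply: differentiable_merge; exact: simple_poles_differentiable ZP.2 np.
Qed.

Lemma differentiable_continued K s : above K.+1%:R s -> ~ polar_locus s ->
  differentiable (continued K) s.
Proof.
move=> us np; apply: differentiableM.
  by apply: differentiableV; [exact: dw|exact: coord0_neq1].
apply: differentiableB; last exact: differentiable_remainder.
apply: differentiable_bigsum => k; apply: differentiable_translate_term => //.
by move=> /polar_merge.
Qed.

Lemma continued_consistent K K' s : above K.+1%:R s -> above K'.+1%:R s ->
  ~ polar_locus s -> continued K s = continued K' s.
Proof.
wlog KK : K K' / (K <= K')%N => [H|].
  by case: (leqP K K') => [|/ltnW] k u u' np; [|symmetry]; apply: H.
move=> us _ np; apply: (@eq_on_above _ _ K.+1%:R) us np.
- exact: ler0n.
- by move=> t; exact: differentiable_continued.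
- move=> t ut; apply: differentiable_continued.
  by apply: above_mono ut; rewrite ler_nat ltnS.
- by move=> t ut; rewrite (continued_series K ut) (continued_series K' ut).
Qed.

(** Pulled back by [merge k], the hyperplane (i, j) becomes (i + 1, k + j). These are pairwise
    distinct and have first index at least 2, so the extra factor 1/w along (1, 0) creates no double
    pole. *)
Lemma simple_at_continued K p : above K.+1%:R p -> simple_at (continued K) p.
Proof.
move=> up.
have c0 (s : 'rV[C]_q.+1) : ~ polar_locus s -> \prod_(h <- [:: (1, 0)]%N) hform h.1 h.2 s *
    (coord s 0 - 1)^-1 = 1.
  by move=> np; rewrite big_seq1 hform10 divff// coord0_neq1.
apply: (@simple_at_near _ _ (fun s =>
  \sum_(k < K.+1) em_coeff a (coord s 0 - 1) k * ((coord s 0 - 1)^-1 * Z (merge k s))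
  + (-1) * ((coord s 0 - 1)^-1 * mlim q.+1 (err_factor K alpha s)))).
  apply: filterE => s _; rewrite /continued /translate mulrBr mulr_sumr mulN1r.
  by congr (_ - _); apply: eq_bigr => k _; rewrite mulrCA.
apply: simple_atD; last first.
  apply: simple_atM; first by apply: filterE => s; exact: differentiable_cst.
  exists [:: (1, 0)]%N, (fun s => mlim q.+1 (err_factor K alpha s)); split => //.
    by apply: filterS (near_above up) => s us; exact: differentiable_remainder.
  by apply: filterE => s np; rewrite mulrA c0// mul1r.
apply: simple_at_sum => k; apply: simple_atM.
  by apply: filterE => s; apply: differentiable_em_coeff; exact: dw.
have [I [g [uI pI hg Hg]]] := ZP.2 (merge k p).
pose up1 h : nat * nat := (h.1.+1, k + h.2)%N.
exists ((1, 0)%N :: map up1 I), (fun s => g (merge k s)); split.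
- rewrite /= map_inj_uniq ?uI; last by move=> [i j] [i' j'] [-> /addnI ->].
  rewrite andbT; apply/mapP => -[[i j] /(allP pI)/polar_le/andP[i1 _]] [i0 _].
  by rewrite -i0 in i1.
- rewrite /= ; apply/allP => h /mapP[[i j] /(allP pI) pij ->]; exact: polarS pij.
- by apply: filterS (near_merge hg) => s; exact: differentiable_merge.
- apply: filterS (near_merge Hg) => s H np.
  rewrite H; last by move=> /polar_merge.
  rewrite big_cons mulrACA hform10 divff ?coord0_neq1// mul1r big_map; congr (_ * _).
  rewrite big_seq [RHS]big_seq; apply: eq_bigr => -[i j] /(allP pI)/polar_le iq.
  by rewrite -hform_merge.
Qed.

Lemma zeta_continuationS : is_zeta_continuation alpha (zeta alpha).
Proof.
apply: (@getPex _ (is_zeta_continuation alpha)).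
(* [K] varies with the point; near a given [p] consistency allows it to be frozen at [level p]. *)
exists (fun s => continued (level s) s); split.
  by move=> s /above0; exact: continued_series.
move=> p; apply: (@simple_at_near _ _ (continued (level p))).
  apply: filterS (near_above (@above_level R q.+1 p)) => s us np.
  exact: (continued_consistent us (@above_level R q.+1 s) np).
exact: (simple_at_continued (@above_level R q.+1 p)).
Qed.

Lemma zeta_translate K s : above K.+1%:R s -> ~ polar_locus s ->
  (coord s 0 - 1) * zeta alpha s = translate K s.
Proof.
move=> us np; have [zU zP] := zeta_continuationS.
have -> : zeta alpha s = continued K s; last by rewrite mulVKf// coord0_neq1.
apply: (@eq_on_above _ _ K.+1%:R) us np.
- exact: ler0n.
- by move=> t _; exact: simple_poles_differentiable.
- by move=> t; exact: differentiable_continued.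
- by move=> t ut; rewrite (continued_series K ut) zU//; exact/above0.
Qed.

End Continuation.

Lemma zeta_continuation (R : realType) r (alpha : r.-tuple R) :
  (forall j, 0 <= alpha`_j < 1) -> is_zeta_continuation alpha (zeta alpha).
Proof.
elim: r alpha => [|r IH] alpha aP; last first.
  by apply: (zeta_continuationS aP); apply: IH => j; rewrite nth_behead.
have zc : zeta alpha = cst 1 by apply/funext => s; rewrite zeta0.
rewrite zc; split => [s _|p]; first by rewrite zeta_series0.
exists [::], (cst 1); split => //.
  by apply: filterE => s; exact: differentiable_cst.
by apply: filterE => s _; rewrite big_nil mul1r.
Qed.

(** * Residues *)

Section MeromorphicValues.
Variable R : realType.
Local Notation C := (cplx R).

Lemma mero_value_near r (F G : 'rV[C]_r -> C) p v :
  (\forall s \near p, ~ polar_locus s -> F s = G s) -> mero_value F p v -> mero_value G p v.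
Proof.
move=> FG [g [hg Hg gp]]; exists g; split => //.
by apply: filterS2 FG Hg => s FG Hg np; rewrite Hg// FG.
Qed.

Lemma mero_value_holo r (f : 'rV[C]_r -> C) p : holomorphic_near p f -> mero_value f p (f p).
Proof. by move=> hf; exists f; split => //; apply: filterE. Qed.

Lemma mero_valueD r (F G : 'rV[C]_r -> C) p v w : mero_value F p v -> mero_value G p w ->
  mero_value (fun s => F s + G s) p (v + w).
Proof.
move=> [f [hf Hf fp]] [g [hg Hg gp]]; exists (fun s => f s + g s); split.
- by apply: filterS2 hf hg => s df dg; apply: differentiableD.
- by apply: filterS2 Hf Hg => s Hf Hg np; rewrite Hf// Hg.
- by rewrite fp gp.
Qed.

Lemma mero_valueM r (f G : 'rV[C]_r -> C) p v : holomorphic_near p f -> mero_value G p v ->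
  mero_value (fun s => f s * G s) p (f p * v).
Proof.
move=> hf [g [hg Hg gp]]; exists (fun s => f s * g s); split.
- by apply: filterS2 hf hg => s df dg; apply: differentiableM.
- by apply: filterS Hg => s Hg np; rewrite Hg.
- by rewrite gp.
Qed.

Lemma mero_value_sum r n (F : 'I_n -> 'rV[C]_r -> C) p (v : 'I_n -> C) :
  (forall i, mero_value (F i) p (v i)) ->
  mero_value (fun s => \sum_i F i s) p (\sum_i v i).
Proof.
elim: n F v => [|n IH] F v HF.
  exists (cst 0); split; rewrite ?big_ord0//.
    by apply: filterE => s; exact: differentiable_cst.
  by apply: filterE => s; rewrite big_ord0.
rewrite big_ord_recl; apply: (@mero_value_near _ (fun s => F ord0 s + \sum_i F (lift ord0 i) s)).
  by apply: filterE => s _; rewrite big_ord_recl.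
by apply: mero_valueD => //; exact: IH.
Qed.

Lemma mero_value_merge q k (F : 'rV[C]_q -> C) (p : 'rV[C]_q.+1) v :
  mero_value F (merge k p) v -> mero_value (fun s => F (merge k s)) p v.
Proof.
move=> [g [hg Hg gp]]; exists (fun s => g (merge k s)); split => //.
- by apply: filterS (near_merge hg) => s; exact: differentiable_merge.
- by apply: filterS (near_merge Hg) => s Hg' np; apply: Hg' => /polar_merge.
Qed.

Lemma holomorphic_hform r i k (p : 'rV[C]_r) : holomorphic_near p (@hform R r i k).
Proof. by apply: filterE => s; exact: differentiable_hform. Qed.

Lemma holomorphic_zeta r (alpha : r.-tuple R) (p : 'rV[C]_r) :
  (forall j, 0 <= alpha`_j < 1) -> ~ polar_locus p -> holomorphic_near p (zeta alpha).
Proof.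
move=> aP np; apply: filterS (near_nonpolar np) => s.
exact: (simple_poles_differentiable (zeta_continuation aP).2).
Qed.

Lemma coord_default r (s : 'rV[C]_r) j : (r <= j)%N -> coord s j = 0.
Proof. by move=> rj; rewrite /coord insubN// -leqNgt. Qed.

Lemma coord_tail r i (s : 'rV[C]_r) j : coord (tail i s) j = coord s (i + j).
Proof.
case: (ltnP j (r - i)) => jr; last by rewrite !coord_default// -leq_subLR.
by rewrite -[j in LHS]/(val (Ordinal jr)) coordE mxE -coordE /= addnC.
Qed.

(** The depths reached by taking tails and by merging are equal by a proof, so parameters are
    compared as lists and arguments through [coord]. *)
Lemma eq_zeta r1 r2 (alpha1 : r1.-tuple R) (alpha2 : r2.-tuple R) s1 s2 :
  r1 = r2 -> alpha1 = alpha2 :> seq R -> (forall j, coord s1 j = coord s2 j) ->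
  zeta alpha1 s1 = zeta alpha2 s2.
Proof.
move=> e; case: r2 / e alpha2 s2 => alpha2 s2 /val_inj-> H; congr zeta.
by apply/rowP => j; rewrite -!coordE.
Qed.

End MeromorphicValues.

(** * The matrix product under merging *)

Section BernoulliMatrices.
Variable R : realType.
Local Notation C := (cplx R).

Lemma bernoulli0 (a : R) : bernoulli a 0 = 1.
Proof.
have := bernoulli_sum a 0; rewrite big_ord1 expr0 !fact0 subn0 (_ : 1`! = 1%N)//.
by rewrite mulr1 !divr1.
Qed.

Lemma bmx_shift (a : R) (t : C) l n m : bmx a (t + l%:R) n m = bmx a t (n + l) (m + l).
Proof.
rewrite /bmx ltn_add2r eqn_add2r subnDr -addSn big_addn addnK.
rewrite -addrA [l%:R + _]addrC -natrD.
have E : \prod_(n.+1 <= j < m) (t + l%:R + j%:R) = \prod_(n.+1 <= j < m) (t + (j + l)%:R).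
  by apply: eq_bigr => j _; rewrite -addrA [l%:R + _]addrC -natrD.
by rewrite E.
Qed.

Lemma bmx_em_coeff (a : R) (w : C) l : w != 0 -> bmx a w 0 l = w^-1 * em_coeff a w l.
Proof.
move=> w0; rewrite /bmx /em_coeff; case: l => [|l] /=.
  by rewrite addr0 poch0 bernoulli0 fact0 mul1r divr1 mulr1.
have E : poch (w + 1) l = \prod_(1 <= j < l.+1) (w + j%:R).
  by rewrite big_add1 /= big_mkord; apply: eq_bigr => j _; rewrite -natr1 -addrA [1 + _]addrC.
by rewrite subn0 pochS E -!mulrA mulKf//; congr (_ * _); exact: mulrC.
Qed.

(** Under [merge l] the argument s_1 + ... + s_d - d becomes s_1 + ... + s_(d+1) - (d+1) + l. Every
    factor from d = 2 on is thus shifted by l, and a common shift passes through products. *)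
Lemma bmx_prod_shift q (alpha : q.+1.-tuple R) (beta : q.-tuple R) l (p : 'rV[C]_q.+1) i :
  beta = behead alpha :> seq R -> (i <= q)%N -> forall n m,
  bmx_prod beta (merge l p) i.+1 n m =
  (\big[@umx_mul R/@umx1 R]_(2 <= d < i.+2)
     bmx (alpha`_d - alpha`_d.-1) (psum d p - d%:R)) (n + l)%N (m + l)%N.
Proof.
move=> be iq n m; rewrite /bmx_prod [in RHS]big_add1 [in LHS]big_nat [in RHS]big_nat.
move: n m.
apply: (big_rec2 (fun A B : nat -> nat -> C => forall n m, A n m = B (n + l)%N (m + l)%N)).
  by move=> n m; rewrite /umx1 eqn_add2r.
move=> d A B /andP[d0 di] AB n m; rewrite /umx_mul -addSn big_addn addnK.
apply: eq_bigr => j _; rewrite AB -bmx_shift be !nth_behead prednK// psum_merge.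
  by congr (bmx _ _ _ _ * _); rewrite -natr1; ring.
by rewrite d0 (leq_trans _ iq).
Qed.

(** Splitting off the factor d = 1 turns the (l, k) entry of the other factors into a (0, k - l)
    entry at merged arguments. The residues obey the same recursion. *)
Lemma bmx_prodS q (alpha : q.+1.-tuple R) (beta : q.-tuple R) (p : 'rV[C]_q.+1) i k :
  beta = behead alpha :> seq R -> (i < q)%N ->
  bmx_prod alpha p i.+2 0 k = \sum_(0 <= l < k.+1)
    bmx (alpha`_1 - alpha`_0) (coord p 0 - 1) 0 l * bmx_prod beta (merge l p) i.+1 0 (k - l).
Proof.
move=> be iq; rewrite {1}/bmx_prod big_ltn//; set A := \big[_/_]_(_ <= _ < _) _.
rewrite /umx_mul !big_nat; apply: eq_bigr => l /andP[_ lk].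
rewrite psum_coord// big_ord1; congr (_ * _).
by rewrite (bmx_prod_shift l p be (ltnW iq)) subnK.
Qed.

End BernoulliMatrices.

Section Residues.
Variable R : realType.
Local Notation C := (cplx R).

Lemma em_coeff0 (a : R) k : em_coeff a 0 k = (k == 0%N)%:R :> C.
Proof.
case: k => [|k]; last by rewrite /em_coeff pochS !mul0r.
by rewrite /em_coeff poch0 bernoulli0 fact0 mul1r divr1.
Qed.

Lemma em_err0 (a : R) K y : em_err a K 0 y = 0.
Proof.
have E x : em_main a K 0 x = 1 :> C.
  rewrite /em_main (bigD1 ord0)//= em_coeff0 eqxx mul1r big1 => [|j j0].
    by rewrite mulr0n !addr0 oppr0 cpowz0.
  by rewrite em_coeff0 -[val j == 0%N]/(j == ord0) (negbTE j0) mul0r.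
by rewrite /em_err !E subrr sub0r mul0r oppr0.
Qed.

Lemma mlim_err0 q K alpha (s : 'rV[C]_q.+1) : coord s 0 - 1 = 0 ->
  mlim q.+1 (err_factor K alpha s) = 0.
Proof.
move=> w0; apply: climE => e e0; exists 0%N => N _.
rewrite msumS big1 ?subrr ?cabs0 ?ltW// => n _.
by rewrite /err_factor w0 em_err0; case: ifP => _; rewrite mul0r.
Qed.

(** A polar hyperplane H_(i',k') through [merge l p] pulls back to the polar hyperplane
    H_(i'+1,l+k') through [p]. By genericity this is the given one, so i' = i and l + k' = k. *)
Lemma hyp_generic_nonpolar q i k l (p : 'rV[C]_q.+1) : hyp_generic i.+1 k p ->
  (forall k', polar q i k' -> (l + k')%N <> k) -> ~ polar_locus (merge l p).
Proof.
move=> [_ gp] nk [i' [k' [pik' /hform_eq0]]]; rewrite hform_merge ?(polar_le pik')//.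
move=> /hform_eq0; apply: gp; first exact: polarS pik'.
by move=> [ii kk]; apply: (nk k') => //; rewrite -ii.
Qed.

Lemma hyp_generic_merge q i k l (p : 'rV[C]_q.+1) : (1 <= i <= q)%N -> (l <= k)%N ->
  hyp_generic i.+1 k p -> hyp_generic i (k - l) (merge l p).
Proof.
move=> iq lk [hp gp]; split.
  by apply/hform_eq0; rewrite hform_merge// subnKC//; apply/hform_eq0.
move=> i' k' pik' ne /hform_eq0; rewrite hform_merge ?(polar_le pik')//.
move=> /hform_eq0; apply: gp; first exact: polarS pik'.
by move=> [ii kk]; apply: ne; rewrite ii -kk addKn.
Qed.

(** Here the linear form is w itself, so the residue is the right side of the translation formula at
    w = 0. There (w)_k vanishes for k > 0 and so does every error term; only the summand k = 0
    survives. *)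
Lemma residue10 q (alpha : q.+1.-tuple R) (p : 'rV[C]_q.+1) :
  (forall j, 0 <= alpha`_j < 1) -> hyp_generic 1 0 p ->
  zeta_residue_at alpha 1 0 p (zeta ([tuple of behead alpha] : q.-tuple R) (merge 0 p)).
Proof.
move=> aP gp; set beta : q.-tuple R := [tuple of behead alpha].
have bP j : 0 <= beta`_j < 1 by rewrite nth_behead.
have aW j : 0 <= alpha`_j <= 1 by have /andP[-> /ltW->] := aP j.
have w0 : coord p 0 - 1 = 0 by rewrite -hform10; apply/hform_eq0; case: gp.
pose K := level p; have uK : above K.+1%:R p by exact: above_level.
pose Rem (s : 'rV[C]_q.+1) := mlim q.+1 (err_factor K alpha s).
have hRem : holomorphic_near p Rem.
  by apply: filterS (near_above uK) => s us; exact: differentiable_remainder.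
apply: (@mero_value_near _ _ (fun s => \sum_(k < K.+1)
    em_coeff (shift_gap alpha) (coord s 0 - 1) k * zeta beta (merge k s) + (-1) * Rem s)).
  apply: filterS (near_above uK) => s us np.
  by rewrite hform10 (zeta_translate aP (zeta_continuation bP) us np) mulN1r.
pose v (k : 'I_K.+1) : C :=
  em_coeff (shift_gap alpha) (coord p 0 - 1) k * zeta beta (merge k p).
have -> : zeta beta (merge 0 p) = \sum_k v k + (-1) * Rem p.
  rewrite /Rem mlim_err0// mulr0 addr0 (bigD1 ord0)//= big1 => [|k k0].
    by rewrite addr0 /v w0 em_coeff0 mul1r.
  by rewrite /v w0 em_coeff0 -[val k == 0%N]/(k == ord0) (negbTE k0) mul0r.
apply: mero_valueD; last first.
  apply: mero_valueM; first by apply: filterE => s; exact: differentiable_cst.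
  exact: mero_value_holo.
apply: mero_value_sum => k; apply: mero_valueM.
  apply: filterE => s; apply: differentiable_em_coeff.
  by apply: differentiableB; [exact: differentiable_coordn|exact: differentiable_cst].
apply: mero_value_merge; apply: mero_value_holo; apply: holomorphic_zeta => //.
apply: (hyp_generic_nonpolar gp) => k' pk; by have := polar_le pk.
Qed.

(** For i = 1 the product is empty and its (0, k) entry is 1 if k = 0 and 0 otherwise, so one
    expression covers both cases of the theorem and also the hyperplanes H_(1,k), k >= 1, without
    pole. *)
Definition full_residue r (alpha : r.-tuple R) i k (p : 'rV[C]_r) : C :=
  zeta [tuple of drop i alpha] (tail i p) * bmx_prod alpha p i 0 k.

(** For l <= k the form on the left is the pullback of the form of H_(i+1,k-l), and the induction
    hypothesis applies at [merge l p]. For l > k the merged zeta function is holomorphic there and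
    the vanishing form gives 0. *)
Lemma residue_step q (alpha : q.+1.-tuple R) i k l (p : 'rV[C]_q.+1) :
  let beta : q.-tuple R := [tuple of behead alpha] in
  (forall j, 0 <= beta`_j < 1) ->
  (forall k p, hyp_generic i.+1 k p -> zeta_residue_at beta i.+1 k p (full_residue beta i.+1 k p)) ->
  (i < q)%N -> hyp_generic i.+2 k p ->
  mero_value (fun s => hform i.+2 k s * zeta beta (merge l s)) p
    (if (l <= k)%N then zeta [tuple of drop i.+2 alpha] (tail i.+2 p) *
       bmx_prod beta (merge l p) i.+1 0 (k - l) else 0).
Proof.
move=> beta bP IH iq gp; case: leqP => [lk|kl]; last first.
  rewrite -[X in mero_value _ _ X](mul0r (zeta beta (merge l p))).
  have -> : 0 = hform i.+2 k p by symmetry; apply/hform_eq0; case: gp.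
  apply: mero_valueM; first exact: holomorphic_hform.
  apply: mero_value_merge; apply: mero_value_holo; apply: holomorphic_zeta => //.
  apply: (hyp_generic_nonpolar gp) => k' _ e; move: kl.
  by rewrite -e ltnNge leq_addr.
have gm : hyp_generic i.+1 (k - l) (merge l p) by exact: hyp_generic_merge.
have := mero_value_merge (IH _ _ gm).
have -> : full_residue beta i.+1 (k - l) (merge l p) =
    zeta [tuple of drop i.+2 alpha] (tail i.+2 p) * bmx_prod beta (merge l p) i.+1 0 (k - l).
  congr (_ * _); apply: eq_zeta => //=.
    by rewrite -drop1 drop_drop addn1.
  move=> j; rewrite !coord_tail; case: (ltnP (i.+1 + j) q) => jq.
    by have := coord_merge l p jq; rewrite addr0.
  by rewrite !coord_default.
apply: mero_value_near; apply: filterE => s _.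
by rewrite hform_merge// subnKC.
Qed.

(** Allowing i = 1 with every k makes the induction close: the step for H_(2,k) calls on H_(1,k-l).
    For k >= 1 a generic point of H_(1,k) is not polar, and the value is 0. *)
Lemma residue r (alpha : r.-tuple R) i k (p : 'rV[C]_r) :
  (forall j, 0 <= alpha`_j < 1) -> (1 <= i <= r)%N -> hyp_generic i k p ->
  zeta_residue_at alpha i k p (full_residue alpha i k p).
Proof.
elim: r alpha i k p => [|q IH] alpha i k p aP.
  by rewrite leqn0 => /andP[+ /eqP i0]; rewrite i0.
pose beta : q.-tuple R := [tuple of behead alpha].
have bP j : 0 <= beta`_j < 1 by rewrite nth_behead.
have aW j : 0 <= alpha`_j <= 1 by have /andP[-> /ltW->] := aP j.
case: i => [//|[_|i /andP[_ iq]]] gp.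
  rewrite /full_residue /bmx_prod big_geq// /umx1; case: k gp => [|k] gp.
    rewrite mulr1.
    rewrite (@eq_zeta _ _ _ _ beta _ (merge 0 p)); first exact: residue10.
    - by rewrite subSS subn0.
    - by rewrite /= drop1.
    move=> j; rewrite coord_tail; case: (ltnP j q) => jq; last by rewrite !coord_default.
    have := coord_merge 0 p jq; have -> : coord p 0 - 1 = 0.
      by rewrite -hform10; apply/hform_eq0; case: gp.
    by move=> ->; rewrite addr0 if_same addr0.
  rewrite mulr0 /zeta_residue_at -[X in mero_value _ _ X](mul0r (zeta alpha p)).
  have -> : 0 = hform 1 k.+1 p by symmetry; apply/hform_eq0; case: gp.
  apply: mero_valueM; first exact: holomorphic_hform.
  apply: mero_value_holo; apply: holomorphic_zeta => // -[i' [k' [pik]]].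
  by case: gp => _; apply => // -[ii kk]; move: pik; rewrite ii kk.
have w0 : coord p 0 - 1 != 0.
  by apply/eqP; rewrite -hform10 => /hform_eq0; case: gp => _; apply.
(* [K] is at least the level, for validity at [p], and at least [k], so that all l <= k occur in the
   sum. *)
pose K := (level p + k)%N; have uK : above K.+1%:R p.
  by apply: above_mono (@above_level _ _ p); rewrite ler_nat ltnS leq_addr.
pose Rem (s : 'rV[C]_q.+1) := mlim q.+1 (err_factor K alpha s).
have hRem : holomorphic_near p Rem.
  by apply: filterS (near_above uK) => s us; exact: differentiable_remainder.
have dw (s : 'rV[C]_q.+1) : differentiable (fun s : 'rV[C]_q.+1 => coord s 0 - 1) s.
  by apply: differentiableB; [exact: differentiable_coordn|exact: differentiable_cst].
pose a := shift_gap alpha.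
apply: (@mero_value_near _ _ (fun s => (coord s 0 - 1)^-1 * (\sum_(l < K.+1)
    em_coeff a (coord s 0 - 1) l * (hform i.+2 k s * zeta beta (merge l s))
    + (- Rem s) * hform i.+2 k s))).
  apply: filterS (near_above uK) => s us np.
  have wn := coord0_neq1 np; apply: (mulfI wn); rewrite mulVKf//.
  rewrite [RHS]mulrCA (zeta_translate aP (zeta_continuation bP) us np) /translate.
  rewrite mulrBr mulr_sumr mulNr [Rem s * _]mulrC; congr (_ - _).
  by apply: eq_bigr => l _; rewrite mulrCA.
pose v l : C := if (l <= k)%N then zeta [tuple of drop i.+2 alpha] (tail i.+2 p) *
  bmx_prod beta (merge l p) i.+1 0 (k - l) else 0.
have -> : full_residue alpha i.+2 k p = (coord p 0 - 1)^-1 * (\sum_(l < K.+1)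
    em_coeff a (coord p 0 - 1) l * v l + (- Rem p) * 0).
  (* Terms with l > k vanish and the others match the expansion of the matrix product. The remainder
     is holomorphic at [p] and is multiplied by the vanishing linear form. *)
  rewrite mulr0 addr0 -(big_mkord xpredT (fun l => em_coeff a (coord p 0 - 1) l * v l)).
  rewrite (big_cat_nat (n := k.+1)) ?ltnS ?leq_addl//= [X in _ * (_ + X)]big_nat.
  rewrite [X in _ * (_ + X)]big1 ?addr0 => [|l /andP[kl _]]; last first.
    by rewrite /v leqNgt kl mulr0.
  rewrite /full_residue (@bmx_prodS _ _ alpha beta)// !mulr_sumr !big_nat.
  apply: eq_bigr => l /andP[_ lk]; rewrite bmx_em_coeff// /v -ltnS lk.
  have -> : alpha`_1 - alpha`_0 = a.
    by rewrite /a /shift_gap /next_shift (set_nth_default 0)// size_tuple (leq_trans _ iq).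
  by rewrite -(mulrA (coord p 0 - 1)^-1) mulrCA; congr (_ * _); exact: mulrCA.
apply: (@mero_valueM _ _ (fun s => (coord s 0 - 1)^-1)).
  have /differentiable_continuous/cvgr_neq0/(_ w0) := dw p.
  apply: filterS => s ws; apply: differentiableV; last exact: ws.
  exact: dw.
apply: mero_valueD.
  apply: (@mero_value_sum _ _ _ (fun l s =>
    em_coeff a (coord s 0 - 1) l * (hform i.+2 k s * zeta beta (merge l s)))) => l.
  apply: (@mero_valueM _ _ (fun s => em_coeff a (coord s 0 - 1) l)).
    by apply: filterE => s; apply: differentiable_em_coeff.
  by apply: residue_step => // k' p'; apply: IH.
have <- : hform i.+2 k p = 0 by apply/hform_eq0; case: gp.
apply: (@mero_valueM _ _ (fun s => - Rem s)).
  by apply: filterS hRem => s; exact: differentiableN.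
exact/mero_value_holo/holomorphic_hform.
Qed.

End Residues.

Theorem theorem6 (R : realType) (r : nat) (alpha : r.-tuple R)
    (hr : (1 <= r)%N)
    (halpha : forall j : 'I_r, 0 <= tnth alpha j < 1) :
  (forall p : 'rV[cplx R]_r, hyp_generic 1 0 p ->
     zeta_residue_at alpha 1 0 p
       (zeta [tuple of drop 1 alpha] (tail 1 p))) /\
  (forall i k : nat, (2 <= i <= r)%N ->
     forall p : 'rV[cplx R]_r, hyp_generic i k p ->
     zeta_residue_at alpha i k p
       (zeta [tuple of drop i alpha] (tail i p) * bmx_prod alpha p i 0%N k)).
Proof.
(* Past the end of the tuple the default 0 satisfies the same bounds, so no range condition on [j]
   has to be carried. *)
have aP j : 0 <= alpha`_j < 1.
  case: (ltnP j r) => jr; last by rewrite nth_default ?size_tuple// lexx ltr01.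
  by have := halpha (Ordinal jr); rewrite (tnth_nth 0).
split=> [p gp|i k /andP[i2 ir] p gp].
  have := residue aP (i := 1%N) _ gp.
  by rewrite /full_residue /bmx_prod big_geq// /umx1 mulr1; apply.
by apply: residue => //; rewrite (ltnW i2).
Qed.
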